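(* Let $K$ be an abstract simplicial complex on the vertex set $[m]$ and let $(\underline{X},\underline{A})=\{(X_i,A_i,x_i)\}_{i=1}^m$ be a family of connected, pointed CW-pairs. Then the homotopy equivalence $H:\Sigma(Y_1\times\cdots\times Y_m)\to\Sigma\big(\bigvee_{I\le[m]}\widehat{Y}^I\big)$ (natural in pointed CW-complexes $Y_1,\dots,Y_m$) induces a natural, pointed homotopy equivalence $$H:\Sigma\big(Z(K;(\underline{X},\underline{A}))\big)\longrightarrow \Sigma\Big(\bigvee_{I\le[m]}\widehat{Z}(K_I;(\underline{X_I},\underline{A_I}))\Big).$$
   Context: Simplicial complexes: $K$ is a family of subsets (simplices) of $[m]=\{1,\dots,m\}$, closed under passing to subsets, containing $\emptyset$, and such that every $i\in[m]$ lies in some simplex. Simplices are identified with increasing sequences in $[m]$. Families of pairs: $(X_i,A_i,x_i)$ is a CW-complex $X_i$, a subcomplex $A_i$, and a base-point $x_i\in A_i$; ''connected'' means $X_i$ and $A_i$ are connected. $I\le[m]$ means that $I=(i_1<\cdots<i_k)$ is a non-empty subsequence of $(1,\dots,m)$; $|I|=k$. $(\underline{X_I},\underline{A_I})=\{(X_{i_j},A_{i_j},x_{i_j})\}_{j=1}^{|I|}$. $K_I=\{\sigma\cap I:\sigma\in K\}$ is the full subcomplex of $K$ on $I$, regarded as a simplicial complex with vertex set $I$. Polyhedral product: for $\sigma\in K$ put $D(\sigma)=\prod_{i=1}^m Y_i$ with $Y_i=X_i$ if $i\in\sigma$ and $Y_i=A_i$ if $i\notin\sigma$. Then $Z(K;(\underline{X},\underline{A}))=\bigcup_{\sigma\in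 K}D(\sigma)\subset X_1\times\cdots\times X_m$, with base-point $(x_1,\dots,x_m)$. Smash version: $\widehat{Z}(K;(\underline{X},\underline{A}))$ is the image of $Z(K;(\underline{X},\underline{A}))$ in the smash product $X_1\wedge\cdots\wedge X_m$; similarly for $K_I$ and $(\underline{X_I},\underline{A_I})$ in $X_{i_1}\wedge\cdots\wedge X_{i_k}$. Notation: $\widehat{Y}^I=Y_{i_1}\wedge\cdots\wedge Y_{i_k}$; $\Sigma$ is the reduced suspension. The well-known natural pointed homotopy equivalence $H:\Sigma(Y_1\times\cdots\times Y_m)\to\Sigma(\bigvee_{I\le[m]}\widehat{Y}^I)$ is the standard splitting of the suspension of a product. ''Natural'' means natural for morphisms of $(\underline{X},\underline{A})$ (maps of pointed pairs) and for embeddings in $K$. *)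

(* Defs.v *)
From HB Require Import structures.
From mathcomp Require Import all_boot all_order all_algebra generic_quotient.
From mathcomp Require Import all_classical all_reals.
From mathcomp Require Import topology normedtype wedge_sigT.

Set Implicit Arguments.
Unset Strict Implicit.
Unset Printing Implicit Defensive.

Import Order.TTheory GRing.Theory Num.Theory.
Import numFieldNormedType.Exports.

Local Open Scope classical_set_scope.
Local Open Scope ring_scope.
Local Open Scope quotient_scope.

(* Pointed spaces are [ptopologicalType]s, with base-point [point]; products  *)
(* carry the product topology, and subsets the subspace topology.             *)

HB.instance Definition _ (X Y : ptopologicalType) := Pointed.on (X * Y)%type.
HB.instance Definition _ (V : Type) (X : V -> ptopologicalType) :=
  isPointed.Build (prod_topology X) (fun i => point).

Definition psub (X : ptopologicalType) (A : set X) (Apt : A point) : Type :=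
  set_type A.

Section Psub.
Context (X : ptopologicalType) (A : set X) (Apt : A point).
HB.instance Definition _ := Topological.copy (psub Apt) (set_type A).
HB.instance Definition _ :=
  isPointed.Build (psub Apt) (exist _ point (mem_set Apt)).
Definition psub_incl (x : psub Apt) : X := set_val x.
End Psub.

Definition psub_map (X Y : ptopologicalType) (A : set X) (B : set Y)
    (Apt : A point) (Bpt : B point) (f : X -> Y)
    (fAB : forall x, A x -> B (f x)) (x : psub Apt) : psub Bpt :=
  exist _ (f (sval x)) (mem_set (fAB _ (set_mem (svalP x)))).
Arguments psub_map {X Y A B Apt Bpt f} fAB x.

Section Collapse.
Context (X : ptopologicalType) (A : set X).

Let collapse_rel' (x y : X) := (x == y) || ((x \in A) && (y \in A)).

Let collapse_refl : reflexive collapse_rel'.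
Proof. by move=> x; rewrite /collapse_rel' eqxx. Qed.

Let collapse_sym : symmetric collapse_rel'.
Proof. by move=> x y; rewrite /collapse_rel' eq_sym andbC. Qed.

Let collapse_trans : transitive collapse_rel'.
Proof.
move=> y x z /predU1P[-> //|/andP[xA yA]] /predU1P[<-|/andP[_ zA]];
  by rewrite /collapse_rel' ?xA ?yA ?zA orbT.
Qed.

Definition collapse_rel :=
  EquivRel _ collapse_refl collapse_sym collapse_trans.

(* The quotient X / A, with the quotient topology. *)
Definition collapse : Type := {eq_quot collapse_rel}.

HB.instance Definition _ := Quotient.on collapse.
HB.instance Definition _ :=
  Topological.copy collapse (quotient_topology {eq_quot collapse_rel}).
HB.instance Definition _ := isPointed.Build collapse (\pi_collapse point).

Lemma collapseP (x y : X) :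
  \pi_collapse x = \pi_collapse y <-> x = y \/ A x /\ A y.
Proof.
split=> [/eqmodP/predU1P[->|/andP[/set_mem ? /set_mem ?]]|xy];
  [by left|by right|apply/eqmodP].
case: xy => [->|[Ax Ay]]; apply/orP; [by left|right].
by rewrite !mem_set.
Qed.

End Collapse.

(* The map X / A -> Y / B induced by f : X -> Y; meaningful if f(A) is        *)
(* contained in B, see [collapse_mapE].                                       *)
Definition collapse_map (X Y : ptopologicalType) (A : set X) (B : set Y)
  (f : X -> Y) (q : collapse A) : collapse B :=
  \pi_(collapse B) (f (repr q)).

Lemma collapse_mapE (X Y : ptopologicalType) (A : set X) (B : set Y)
    (f : X -> Y) : (forall x, A x -> B (f x)) ->
  forall x, collapse_map B f (\pi_(collapse A) x) = \pi_(collapse B) (f x).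
Proof.
move=> fAB x; rewrite /collapse_map; case: piP => y /collapseP[-> //|[Ax Ay]].
by apply/collapseP; right; split; exact: fAB.
Qed.

Definition unitI (R : realType) : Type := set_type `[0 : R, 1]%classic.

Section UnitI.
Context (R : realType).

Definition clamp (x : R) : R := Num.max 0 (Num.min 1 x).

Lemma clamp_in (x : R) : clamp x \in (`[0, 1]%classic : set R).
Proof.
rewrite inE /= in_itv /= /clamp le_max lexx /=.
by rewrite ge_max ler01 ge_min lexx.
Qed.

Definition clampI (x : R) : unitI R := exist _ (clamp x) (clamp_in x).

HB.instance Definition _ := Topological.copy (unitI R) (set_type `[0 : R, 1]%classic).
HB.instance Definition _ := isPointed.Build (unitI R) (clampI 0).
End UnitI.

Section Suspension.
Context (R : realType).

Definition susp_base (X : ptopologicalType) : set (unitI R * X) :=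
  [set p | [\/ sval p.1 = 0, sval p.1 = 1 | p.2 = point]].

Definition susp (X : ptopologicalType) : ptopologicalType :=
  collapse (@susp_base X).

Definition susp_pt (X : ptopologicalType) (t : unitI R) (x : X) : susp X :=
  \pi_(collapse (@susp_base X)) (t, x).

Definition susp_map (X Y : ptopologicalType) (f : X -> Y) : susp X -> susp Y :=
  collapse_map (@susp_base Y) (fun p => (p.1, f p.2)).

Definition pointed_map (X Y : ptopologicalType) (f : X -> Y) : Prop :=
  continuous f /\ f point = point.

Definition pointed_homotopic (X Y : ptopologicalType) (f g : X -> Y) : Prop :=
  exists h : unitI R * X -> Y,
    [/\ continuous h,
        forall x, h (clampI 0, x) = f x,
        forall x, h (clampI 1, x) = g x &
        forall t, h (t, point) = point].

Definition pointed_homotopy_equivalence (X Y : ptopologicalType)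
    (f : X -> Y) : Prop :=
  pointed_map f /\
  exists g : Y -> X,
    [/\ pointed_map g, pointed_homotopic (g \o f) id &
        pointed_homotopic (f \o g) id].

End Suspension.

Section CW.
Context (R : realType).

Definition disc n : set 'rV[R]_n := [set v | \sum_i v 0 i ^+ 2 <= 1].
Definition open_disc n : set 'rV[R]_n := [set v | \sum_i v 0 i ^+ 2 < 1].
Definition sphere n : set 'rV[R]_n := [set v | \sum_i v 0 i ^+ 2 = 1].

(* Whitehead's definition, in terms of characteristic maps. *)
Record cw_structure (X : topologicalType) := CWStructure {
  cell : Type;
  cell_dim : cell -> nat;
  char_map : forall e, 'rV[R]_(cell_dim e) -> X;
  open_cell := fun e => @char_map e @` @open_disc (cell_dim e);
  closed_cell := fun e => @char_map e @` @disc (cell_dim e);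
  cw_hausdorff : hausdorff_space X;
  char_map_continuous : forall e,
    {within @disc (cell_dim e), continuous (@char_map e)};
  char_map_inj : forall e, {in @open_disc (cell_dim e) &, injective (@char_map e)};
  cell_partition : forall x, exists! e, open_cell e x;
  closure_finite : forall e, exists F : set cell,
    [/\ finite_set F,
        forall e', F e' -> (cell_dim e' < cell_dim e)%N &
        @char_map e @` @sphere (cell_dim e) `<=` \bigcup_(e' in F) open_cell e'];
  weak_topology : forall B : set X,
    (forall e, closed (@disc (cell_dim e) `&` @char_map e @^-1` B)) -> closed B
}.

Definition subcomplex (X : topologicalType) (S : cw_structure X) (A : set X) :=
  exists C : set (cell S),
    A = \bigcup_(e in C) open_cell e /\
    forall e, C e -> @closed_cell X S e `<=` A.

Record cw_pair := CWPair {
  cw_space :> ptopologicalType;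
  cw_sub : set cw_space;
  cw_subP : exists S : cw_structure cw_space, subcomplex S cw_sub;
  cw_sub_point : cw_sub point
}.

Definition connected_pair (P : cw_pair) :=
  connected [set: P] /\ connected (@cw_sub P).

Record pair_map (P Q : cw_pair) := PairMap {
  pair_fun :> P -> Q;
  pair_funP : pointed_map pair_fun;
  pair_fun_sub : forall x, cw_sub x -> cw_sub (pair_fun x)
}.

End CW.

Record scomplex (V : finType) := SComplex {
  simplices :> {set {set V}};
  sc0 : finset.set0 \in simplices;
  scS : forall s t : {set V}, s \in simplices -> t \subset s -> t \in simplices;
  sc_vertex : forall i, exists2 s, s \in simplices & i \in s
}.

Section FullSubcomplex.
Context (V : finType) (K : scomplex V) (I : {set V}).

(* The simplices of K_I are the s :&: I, seen inside the vertex set I. *)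
Definition full_sub_simplices : {set {set {i : V | i \in I}}} :=
  [set [set j | val j \in s] | s : {set V} in simplices K]%SET.

Lemma full_sub0 : finset.set0 \in full_sub_simplices.
Proof.
apply/imsetP; exists finset.set0; first exact: sc0.
by apply/setP => j; rewrite !inE.
Qed.

Lemma full_subS (s t : {set {i : V | i \in I}}) :
  s \in full_sub_simplices -> t \subset s -> t \in full_sub_simplices.
Proof.
move=> /imsetP[s' s'K ->] /fintype.subsetP ts; apply/imsetP.
exists (val @: t).
  apply: scS s'K _; apply/fintype.subsetP => _ /imsetP[j jt ->].
  by have := ts j jt; rewrite inE.
by apply/setP => j; rewrite inE mem_imset //; exact: val_inj.
Qed.

Lemma full_sub_vertex j : exists2 s, s \in full_sub_simplices & j \in s.
Proof.
have [s sK js] := sc_vertex K (val j).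
by exists [set k | val k \in s]%SET; [exact: imset_f|rewrite inE].
Qed.

Definition full_sub : scomplex {i : V | i \in I} :=
  SComplex full_sub0 full_subS full_sub_vertex.

End FullSubcomplex.

Lemma full_sub_mono (V : finType) (K L : scomplex V) (I : {set V}) :
  {subset K <= L} -> {subset full_sub K I <= full_sub L I}.
Proof. by move=> KL _ /imsetP[s /KL sL ->]; exact: imset_f. Qed.

Definition fat_wedge (V : Type) (X : V -> ptopologicalType) :
  set (prod_topology X) := [set y | exists i, y i = point].

(* The product of the X i by its subspace of points with some coordinate at   *)
(* the base-point.                                                            *)
Definition smash (V : Type) (X : V -> ptopologicalType) : ptopologicalType :=
  collapse (@fat_wedge V X).

Definition prod_map (V : Type) (X Y : V -> ptopologicalType)
    (f : forall i, X i -> Y i) (y : prod_topology X) : prod_topology Y :=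
  fun i => f i (y i).

Definition smash_map (V : Type) (X Y : V -> ptopologicalType)
    (f : forall i, X i -> Y i) : smash X -> smash Y :=
  collapse_map (@fat_wedge V Y) (prod_map f).

(* For f injective: the point with coordinate y i at f i and the base-point   *)
(* elsewhere, see [extE] and [ext_out].                                       *)
Definition ext (V W : Type) (f : V -> W) (X : W -> ptopologicalType)
    (y : prod_topology (fun i => X (f i))) : prod_topology X :=
  fun j => xget point [set x | exists i, existT X (f i) (y i) = existT X j x].

Definition smash_ext (V W : Type) (f : V -> W) (X : W -> ptopologicalType) :
    smash (fun i => X (f i)) -> smash X :=
  collapse_map (@fat_wedge W X) (@ext V W f X).

Lemma extE (V : Type) (W : eqType) (f : V -> W) (X : W -> ptopologicalType)
    (y : prod_topology (fun i => X (f i))) i :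
  injective f -> ext y (f i) = y i.
Proof.
move=> fI; rewrite /ext; case: xgetP => [x _ [j]|/(_ (y i))]; last first.
  by case; exists i.
move=> e; have ij : j = i by apply: fI; exact: (f_equal (@projT1 _ _) e).
by move: e; rewrite ij => e; rewrite -(existT_inj2 e).
Qed.

Lemma ext_out (V W : Type) (f : V -> W) (X : W -> ptopologicalType)
    (y : prod_topology (fun i => X (f i))) j :
  ~ range f j -> ext y j = point.
Proof.
move=> jf; rewrite /ext; case: xgetP => [x _ [i e]|//].
by case: jf; exists i => //; exact: (f_equal (@projT1 _ _) e).
Qed.

Section PolyhedralProduct.
Context (R : realType) (V : finType) (K : scomplex V) (P : V -> cw_pair R).

Local Notation X := (fun i => cw_space (P i)).

Definition poly_box (s : {set V}) : set (prod_topology X) :=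
  [set y | forall i, (if i \in s then [set: P i] else @cw_sub _ (P i)) (y i)].

Definition poly_set : set (prod_topology X) :=
  \bigcup_(s in [set` simplices K]) poly_box s.

Lemma poly_set_point : poly_set point.
Proof.
exists finset.set0; first exact: sc0.
by move=> i /=; rewrite inE; exact: cw_sub_point.
Qed.

Definition Z : ptopologicalType := psub poly_set_point.

Definition Z_incl : Z -> prod_topology X := @psub_incl _ _ poly_set_point.

Definition smash_poly_set : set (smash X) :=
  [set \pi_(collapse (@fat_wedge V X)) y | y in poly_set].

Lemma smash_poly_set_point : smash_poly_set point.
Proof. by exists point => //; exact: poly_set_point. Qed.

Definition Zhat : ptopologicalType := psub smash_poly_set_point.

Definition Zhat_incl : Zhat -> smash X := @psub_incl _ _ smash_poly_set_point.

End PolyhedralProduct.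

(* Functoriality in the pairs, and for inclusions of complexes on the same    *)
(* vertex set.                                                                *)
Section PolyhedralMap.
Context (R : realType) (V : finType) (K L : scomplex V).
Context (P Q : V -> cw_pair R).
Context (KL : {subset K <= L}) (phi : forall i, pair_map (P i) (Q i)).

Lemma poly_set_map y : poly_set K y -> poly_set L (prod_map phi y).
Proof.
move=> [s sK ys]; exists s; first exact: KL.
move=> i; have := ys i; case: ifP => // _.
exact: pair_fun_sub.
Qed.

Lemma smash_poly_set_map y :
  smash_poly_set K y -> smash_poly_set L (smash_map phi y).
Proof.
move=> [x xK <-]; exists (prod_map phi x); first exact: poly_set_map.
rewrite /smash_map collapse_mapE // => z [i zi]; exists i.
by rewrite /prod_map zi; case: (pair_funP (phi i)).
Qed.

Definition Z_map : Z K P -> Z L Q := psub_map poly_set_map.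
Definition Zhat_map : Zhat K P -> Zhat L Q := psub_map smash_poly_set_map.

End PolyhedralMap.

(* Functoriality for embeddings f of K in L, with P a family on the vertex    *)
(* set of L: base-points are inserted at the vertices outside the range of f. *)
Section PolyhedralExt.
Context (R : realType) (V W : finType) (f : V -> W).
Context (K : scomplex V) (L : scomplex W) (P : W -> cw_pair R).
Context (fI : injective f) (fKL : forall s : {set V}, s \in K -> f @: s \in L).

Lemma poly_set_ext y :
  poly_set (P := fun i => P (f i)) K y -> poly_set (P := P) L (ext y).
Proof.
move=> [s sK ys]; exists (f @: s); first exact: fKL.
move=> j; have [[i _ <-]|jf] := pselect (range f j).
  by rewrite mem_imset // extE //; exact: ys.
rewrite ext_out //; case: ifP => // _; exact: cw_sub_point.
Qed.

Lemma smash_poly_set_ext y :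
  smash_poly_set (P := fun i => P (f i)) K y ->
  smash_poly_set (P := P) L (smash_ext (X := fun j => cw_space (P j)) y).
Proof.
move=> [x xK <-]; exists (ext x); first exact: poly_set_ext.
by rewrite /smash_ext collapse_mapE // => z [i zi]; exists (f i); rewrite extE.
Qed.

Definition Z_ext : Z K (fun i => P (f i)) -> Z L P := psub_map poly_set_ext.
Definition Zhat_ext : Zhat K (fun i => P (f i)) -> Zhat L P :=
  psub_map smash_poly_set_ext.

End PolyhedralExt.

Section EmbeddingFullSub.
Context (V W : finType) (f : V -> W).

Definition sub_fun (I : {set V}) (i : {i : V | i \in I}) :
  {j : W | j \in f @: I} := exist _ (f (val i)) (imset_f f (valP i)).

Context (K : scomplex V) (L : scomplex W) (fI : injective f).
Context (fKL : forall s : {set V}, s \in K -> f @: s \in L).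

Lemma sub_fun_inj I : injective (@sub_fun I).
Proof. by move=> i j /(congr1 val) /fI /val_inj. Qed.

Lemma full_sub_ext I s :
  s \in full_sub K I -> (@sub_fun I) @: s \in full_sub L (f @: I).
Proof.
move=> /imsetP[t tK ->]; apply/imsetP; exists (f @: t); first exact: fKL.
apply/setP => j; rewrite inE; apply/imsetP/idP => [[i it ->]|].
  by rewrite inE in it; exact: imset_f.
case: j => _ /[dup] /imsetP[i iI ->] fi /=; rewrite mem_imset // => it.
by exists (exist _ i iI); [rewrite inE|exact: val_inj].
Qed.

End EmbeddingFullSub.

(* The non-empty subsets of {0, ..., n}, i.e. of [m] with m = n + 1.          *)
Definition nesub n : Type := {I : {set 'I_n.+1} | I != finset.set0}.

Lemma set1_neq0 n (i : 'I_n.+1) : [set i]%SET != finset.set0.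
Proof. by apply/set0Pn; exists i; rewrite inE. Qed.

HB.instance Definition _ n := Finite.on (nesub n).
HB.instance Definition _ n :=
  isPointed.Build (nesub n) (exist _ [set ord0]%SET (set1_neq0 ord0)).

Lemma imset_neq0 n k (f : 'I_n.+1 -> 'I_k.+1) (I : nesub n) :
  f @: val I != finset.set0.
Proof.
by have /set0Pn[i iI] := valP I; apply/set0Pn; exists (f i); exact: imset_f.
Qed.

Definition nesub_image n k (f : 'I_n.+1 -> 'I_k.+1) (I : nesub n) : nesub k :=
  exist _ (f @: val I) (imset_neq0 f I).

Definition wedge_map (I J : pointedType) (X : I -> ptopologicalType)
    (Y : J -> ptopologicalType) (g : I -> J) (h : forall i, X i -> Y (g i)) :
    pwedge X -> pwedge Y :=
  wedge_fun (fun i x => wedge_lift (fun j => @point (Y j)) (h i x)).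

(* [slot] numbers the non-empty I by 0, ..., 2 ^ n.+1 - 2, in the order       *)
(* {0}, {1}, {0,1}, {2}, {0,2}, {1,2}, {0,1,2}, ... obtained by iterating     *)
(* the splitting of S(Y x Y') into SY v SY' v S(Y ^ Y').                      *)
Definition slot n (I : nesub n) : nat := (\sum_(i in val I) 2 ^ i).-1%N.

Lemma bits_inj n (p q : nat -> bool) :
  (\sum_(i < n) p i * 2 ^ i = \sum_(i < n) q i * 2 ^ i)%N ->
  forall i, (i < n)%N -> p i = q i.
Proof.
elim: n p q => [//|n IHn] p q.
have E (r : nat -> bool) : (\sum_(i < n.+1) r i * 2 ^ i =
    r 0%N + (\sum_(i < n) r i.+1 * 2 ^ i).*2)%N.
  rewrite big_ord_recl expn0 muln1 -muln2 big_distrl /=; congr addn.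
  by apply: eq_bigr => i _; rewrite /bump add1n expnSr mulnA.
rewrite !E => e.
have e0 : p 0%N = q 0%N.
  by have := congr1 odd e; rewrite !oddD !odd_double !addbF !oddb.
move: e; rewrite e0 => /addnI/double_inj/(IHn (p \o S) (q \o S)) IH.
by case=> [//|i]; rewrite ltnS => /IH.
Qed.

Lemma slot_inj n : injective (@slot n).
Proof.
have code_gt0 (I : nesub n) : (0 < \sum_(i in val I) 2 ^ i)%N.
  have /set0Pn[i iI] := valP I.
  by rewrite (bigD1 i) //= addn_gt0 expn_gt0.
move=> I J /(congr1 succn); rewrite /slot !prednK // => e.
have E (A : {set 'I_n.+1}) : (\sum_(i in A) 2 ^ i =
    \sum_(i < n.+1) (inord i \in A) * 2 ^ i)%N.
  rewrite big_mkcond /=; apply: eq_bigr => i _; rewrite inord_val.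
  by case: (_ \in _); rewrite ?mul1n ?mul0n.
rewrite !E in e; apply/val_inj/setP => i.
have := bits_inj (p := fun i => inord i \in val I)
  (q := fun i => inord i \in val J) e (ltn_ord i).
by rewrite inord_val.
Qed.

Lemma slot_lt n (I : nesub n) : (slot I < (2 ^ n.+1).-1)%N.
Proof.
have code_gt0 : (0 < \sum_(i in val I) 2 ^ i)%N.
  have /set0Pn[i iI] := valP I.
  by rewrite (bigD1 i) //= addn_gt0 expn_gt0.
rewrite /slot prednK // predn_exp mul1n.
by rewrite [leqRHS](bigID [in val I]) leq_addr.
Qed.

Section Splitting.
Context (R : realType) (n : nat).

(* The sum, for the co-H-structure given by the suspension coordinate, of the *)
(* maps S(q I) followed by the inclusion of the summand I: the suspension     *)
(* coordinate is divided into 2 ^ n.+1 - 1 intervals of equal lengths, and    *)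
(* S(q I) is run through on the one of number [slot I]; see [susp_sumE].      *)
Definition susp_sum (X : ptopologicalType) (W : nesub n -> ptopologicalType)
    (q : forall I, X -> W I) (s : susp R X) : susp R (pwedge W) :=
  let u : R := ((2 ^ n.+1).-1)%N%:R * sval (repr s).1 in
  if [pick I : nesub n | (slot I)%:R <= u <= (slot I).+1%:R] is Some J then
    susp_pt (clampI (u - (slot J)%:R))
      (wedge_lift (fun I => @point (W I)) (q J (repr s).2) : pwedge W)
  else point.

Lemma susp_sumE (X : ptopologicalType) (W : nesub n -> ptopologicalType)
    (q : forall I, X -> W I) (t : unitI R) (x : X) (I : nesub n) :
  (forall I, q I point = point) ->
  (slot I)%:R <= ((2 ^ n.+1).-1)%N%:R * sval t <= (slot I).+1%:R ->
  susp_sum q (susp_pt t x) =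
  susp_pt (clampI (((2 ^ n.+1).-1)%N%:R * sval t - (slot I)%:R))
    (wedge_lift (fun J => @point (W J)) (q I x) : pwedge W).
Proof.
move=> q0 tI.
set N := (_.-1)%N in tI *.
have pt0 (z : unitI R * pwedge W) : @susp_base R (pwedge W) z ->
    susp_pt z.1 z.2 = point.
  by case: z => r w z0; apply/collapseP; right; split => //; exact: Or33.
have clamp0 (r : R) : r <= 0 -> clamp r = 0.
  by move=> r0; rewrite /clamp; apply/max_idPl; rewrite ge_min r0 orbT.
have clamp1 (r : R) : 1 <= r -> clamp r = 1.
  by move=> r1; rewrite /clamp (min_idPl r1); apply/max_idPr.
have lift0 J : wedge_lift (fun J => @point (W J)) (q J point) = point :> pwedge W.
  by rewrite q0; exact: (@wedge_liftE _ _ (fun J => @point (W J)) point point J point).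
have base (z : unitI R * X) J : susp_base z ->
    (slot J)%:R <= N%:R * sval z.1 <= (slot J).+1%:R ->
    susp_pt (clampI (N%:R * sval z.1 - (slot J)%:R))
      (wedge_lift (fun J => @point (W J)) (q J z.2) : pwedge W) = point.
  move=> zB /andP[u1 u2]; apply: (pt0 (_, _)); case: zB => z0.
  - by apply: Or31 => /=; apply: clamp0; rewrite z0 mulr0 subr_le0 ler0n.
  - apply: Or32 => /=; apply: clamp1; rewrite z0 mulr1 lerBrDr -natr1 in u2 *.
    by rewrite addrC natr1 ler_nat slot_lt.
  - by apply: Or33; rewrite /= z0; exact: lift0.
rewrite /susp_sum -/N /susp_pt; case: piP => -[t' x'] /= /collapseP[[<- <-]|[tB t'B]].
  case: pickP => [J tJ|/(_ I)]; last by rewrite tI.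
  have [->//|IJ] := eqVneq J I.
  have sIJ : slot J != slot I by apply: contra_neq IJ; exact: slot_inj.
  move: tI tJ => /andP[I1 I2] /andP[J1 J2].
  have ends (K L : nesub n) : (slot K < slot L)%N ->
      (slot L)%:R <= N%:R * sval t -> N%:R * sval t <= (slot K).+1%:R ->
      clamp (N%:R * sval t - (slot K)%:R) = 1 /\
      clamp (N%:R * sval t - (slot L)%:R) = 0.
    move=> KL L1 K2; split; [apply: clamp1|apply: clamp0].
      by rewrite lerBrDr addrC natr1 (le_trans _ L1) // ler_nat.
    by rewrite subr_le0 (le_trans K2) // ler_nat.
  by case: (ltngtP (slot J) (slot I)) sIJ => // lt _;
    [have [cJ cI] := ends _ _ lt I1 J2|have [cI cJ] := ends _ _ lt J1 I2];
    transitivity (point : susp R (pwedge W)); [|symmetry| |symmetry];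
    apply: (pt0 (_, _)); (by apply: Or31) || (by apply: Or32).
rewrite [RHS](base (t, x)) //.
by case: pickP => [J tJ|//]; exact: (base (t', x')).
Qed.

Context (Y : 'I_n.+1 -> ptopologicalType).

Definition smash_sub (I : nesub n) : ptopologicalType :=
  smash (fun i : {i | i \in val I} => Y (val i)).

Definition smash_proj (I : nesub n) (y : prod_topology Y) : smash_sub I :=
  \pi_(smash_sub I) (fun i => y (val i)).

Definition splitting : susp R (prod_topology Y) -> susp R (pwedge smash_sub) :=
  susp_sum smash_proj.

End Splitting.

Arguments splitting R {n} Y s.

Section Summands.
Context (R : realType) (n : nat) (K : scomplex 'I_n.+1).
Context (P : 'I_n.+1 -> cw_pair R).

Definition Zhat_sub (I : nesub n) : ptopologicalType :=
  Zhat (full_sub K (val I)) (fun i => P (val i)).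

Definition Zhat_sub_incl (I : nesub n) :
    Zhat_sub I -> smash_sub (fun i => cw_space (P i)) I :=
  @Zhat_incl R _ (full_sub K (val I)) (fun i => P (val i)).

End Summands.

Definition Zhat_sub_map (R : realType) (n : nat) (K L : scomplex 'I_n.+1)
    (P Q : 'I_n.+1 -> cw_pair R) (KL : {subset K <= L})
    (phi : forall i, pair_map (P i) (Q i)) (I : nesub n) :
    Zhat_sub K P I -> Zhat_sub L Q I :=
  Zhat_map (full_sub_mono KL) (fun i => phi (val i)).

Definition Zhat_sub_ext (R : realType) (k n : nat) (f : 'I_k.+1 -> 'I_n.+1)
    (K : scomplex 'I_k.+1) (L : scomplex 'I_n.+1) (P : 'I_n.+1 -> cw_pair R)
    (fI : injective f)
    (fKL : forall s : {set 'I_k.+1}, s \in K -> f @: s \in L) (I : nesub k) :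
    Zhat_sub K (fun i => P (f i)) I -> Zhat_sub L P (nesub_image f I) :=
  @Zhat_ext R _ _ (@sub_fun _ _ f (val I)) _ _ (fun j => P (val j))
    (@sub_fun_inj _ _ f fI (val I)) (@full_sub_ext _ _ f K L fI fKL (val I)).

(* Main.v *)
Require Import Defs.
From mathcomp Require Import all_boot all_order all_algebra generic_quotient.
From mathcomp Require Import all_classical all_reals.
From mathcomp Require Import topology normedtype wedge_sigT realfun.
From mathcomp Require Import lra.

Set Implicit Arguments.
Unset Strict Implicit.
Unset Printing Implicit Defensive.

Import Order.TTheory GRing.Theory Num.Theory.
Import numFieldNormedType.Exports.

Local Open Scope classical_set_scope.
Local Open Scope ring_scope.
Local Open Scope quotient_scope.

(** The map [susp_sum zproj] is the sum, over the non-empty subsets I of the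
    vertex set, of the suspensions of the projections q_I : Z(K) -> Zhat(K_I).
    It is a homotopy equivalence because Z(K) has a filtration by closed
    cofibrations with strata the spaces Zhat(K_I), such that the projection of
    each stage onto its stratum is defined on the whole of Z(K).

    The filtration.  The support of a point is the set of its coordinates off
    the base-point, and [bincode] is the binary code of a set of vertices; let
    W_k be the set of the points of Z(K) whose support has a code at most k
    ([stage]).  W_0 is the base-point, W_k is Z(K) for k = 2^(n+1) - 1, and if I
    has code k+1, then q_I is trivial on W_k and identifies W_(k+1) / W_k with
    Zhat(K_I), since a point of W_(k+1) outside W_k has support exactly I.

    The algebra.  Pointed maps from S X to T are handled as families of loops of
    T ([loop]), and [S X, T] is a group for the concatenation of loops.  By
    induction on k, every element of [S W_k, T] is a sum of classes of the form
    b_i o S(q_i), i < k, for unique classes b_i.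
    - Existence ([sum_onto_step]): the restriction to W_k of a class c on
      W_(k+1) is such a sum, and as the q_i are defined on W_(k+1), so is the
      sum.  The difference is null-homotopic on W_k; by the homotopy extension
      property it can be made trivial there, and then it factors through q_k.
    - Uniqueness ([sum_inj_step]): restricting to W_k and cancelling, this is
      the injectivity of the composition with S(q_k) ([pull_inj]).  A
      null-homotopy of b o S(q_k) restricts on W_k to a loop of loops, hence to
      a family with a parameter, which extends to W_(k+1) by the existence part
      with a parameter.  After subtraction of this extension and a use of the
      homotopy extension property the null-homotopy is trivial on W_k, so that
      it comes from one of b.  This is an instance of the exactness of the
      Puppe sequence.
    Existence for the identity of S Z(K) gives a left inverse L of the sum H of
    the S(q_I); uniqueness applied to H o L o H = H gives H o L = id
    ([susp_sum_equiv]).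

    The cofibrations.  Products carry the product topology, so that cell
    structures on products are replaced by Strom's description of cofibrations:
    each pair (X_i, A_i, x_i) has a function u, vanishing only at x_i, and a
    deformation d of X_i that preserves A_i and has moved x to x_i at every time
    later than u x ([cw_contracts]).  These are built cell by cell.  On W_(k+1)
    one takes the minimum phi of the u_i over the set I of code k+1, and deforms
    the coordinate y_i up to the time min(s, 2 phi(y)) ([gap], [push]): at a
    time s > phi(y) some coordinate in I has reached the base-point, and points
    of W_k, where phi = 0, do not move.

    The topology.  Functions on quotients, wedges and complexes, with a
    parameter in the real line, are continuous if they are so before passing to
    the quotient, because the real line is locally compact ([final_prodR]).

    Naturality for maps of pairs holds on the nose ([susp_sum_nat]).  For an
    increasing embedding of vertex sets, both composites run through the same
    non-trivial loops in the same order but at different speeds, so that they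
    differ by a change of the suspension coordinate ([concat_alpha]). *)

(** * Continuity, pasting and final families of maps *)

Section Clamp.
Context (R : realType).
Implicit Types x : R.

Lemma clamp_ge0 x : 0 <= clamp x.
Proof. by rewrite /clamp le_max lexx. Qed.

Lemma clamp_le1 x : clamp x <= 1.
Proof. by rewrite /clamp ge_max ler01 ge_min lexx. Qed.

Lemma clamp_le0 x : x <= 0 -> clamp x = 0.
Proof. by move=> x0; apply/max_idPl; rewrite ge_min x0 orbT. Qed.

Lemma clamp_ge1 x : 1 <= x -> clamp x = 1.
Proof. by move=> x1; rewrite /clamp (min_idPl x1); apply/max_idPr. Qed.

Lemma clamp_id x : 0 <= x <= 1 -> clamp x = x.
Proof. by case/andP=> x0 x1; rewrite /clamp (min_idPr x1); apply/max_idPr. Qed.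

End Clamp.

Section Cts.
Context (T : topologicalType).

Lemma cts_cst (U : topologicalType) (u : U) : continuous (fun _ : T => u).
Proof. by move=> x; apply: cvg_cst; exact: nbhs_filter. Qed.

Lemma cts_id : continuous (fun x : T => x).
Proof. by move=> x; exact: cvg_id. Qed.

Lemma cts_pair (U V : topologicalType) (f : T -> U) (g : T -> V) :
  continuous f -> continuous g -> continuous (fun x => (f x, g x)).
Proof. by move=> cf cg x; apply: cvg_pair; [exact: cf|exact: cg]. Qed.

Lemma cts_comp (U V : topologicalType) (g : U -> V) (f : T -> U) :
  continuous g -> continuous f -> continuous (fun x => g (f x)).
Proof. by move=> cg cf x; apply: continuous_comp; [exact: cf|exact: cg]. Qed.

Lemma cts_fst (U V : topologicalType) (f : T -> U * V) :
  continuous f -> continuous (fun x => (f x).1).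
Proof. by move=> cf; apply: cts_comp cf => x; exact: cvg_fst. Qed.

Lemma cts_snd (U V : topologicalType) (f : T -> U * V) :
  continuous f -> continuous (fun x => (f x).2).
Proof. by move=> cf; apply: cts_comp cf => x; exact: cvg_snd. Qed.

Lemma cts_comp2 (U V W : topologicalType) (F : U -> V -> W)
    (f : T -> U) (g : T -> V) :
  continuous (fun p : U * V => F p.1 p.2) -> continuous f -> continuous g ->
  continuous (fun x => F (f x) (g x)).
Proof.
move=> cF cf cg.
by apply: (cts_comp (f := fun x => (f x, g x)) cF); exact: cts_pair.
Qed.

Context (R : realType).
Implicit Types f g : T -> R.

Lemma ctsD f g : continuous f -> continuous g -> continuous (fun x => f x + g x).
Proof. by move=> cf cg x; apply: cvgD; [exact: cf|exact: cg]. Qed.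

Lemma ctsN f : continuous f -> continuous (fun x => - f x).
Proof. by move=> cf x; apply: cvgN; exact: cf. Qed.

Lemma ctsM f g : continuous f -> continuous g -> continuous (fun x => f x * g x).
Proof. by move=> cf cg x; apply: cvgM; [exact: cf|exact: cg]. Qed.

Lemma cts_max f g :
  continuous f -> continuous g -> continuous (fun x => Num.max (f x) (g x)).
Proof. by move=> cf cg x; apply: continuous_max; [exact: cf|exact: cg]. Qed.

Lemma cts_min f g :
  continuous f -> continuous g -> continuous (fun x => Num.min (f x) (g x)).
Proof. by move=> cf cg x; apply: continuous_min; [exact: cf|exact: cg]. Qed.

Lemma cts_clamp f : continuous f -> continuous (fun x => clamp (f x)).
Proof.
by move=> cf; apply: cts_max; [exact: cts_cst|apply: cts_min => //; exact: cts_cst].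
Qed.

End Cts.

Ltac cts_step := first
  [ eassumption
  | match goal with
    | cf : continuous ?h |- continuous (fun x => ?h (@?f x)) =>
        apply: (@cts_comp _ _ _ h f cf)
    | cF : continuous (fun p => ?F (fst p) (snd p))
      |- continuous (fun x => ?F (@?f x) (@?g x)) =>
        apply: (@cts_comp2 _ _ _ _ F f g cF)
    end
  | lazymatch goal with
    | |- continuous (fun x => x) => apply: cts_id
    | |- continuous (fun x => (@?f x, @?g x)) => apply: (@cts_pair _ _ _ f g)
    | |- continuous (fun x => (@?f x) + (@?g x)) => apply: (@ctsD _ _ f g)
    | |- continuous (fun x => - (@?f x)) => apply: (@ctsN _ _ f)
    | |- continuous (fun x => (@?f x) * (@?g x)) => apply: (@ctsM _ _ f g)
    | |- continuous (fun x => Num.max (@?f x) (@?g x)) =>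
        apply: (@cts_max _ _ f g)
    | |- continuous (fun x => Num.min (@?f x) (@?g x)) =>
        apply: (@cts_min _ _ f g)
    | |- continuous (fun x => clamp (@?f x)) => apply: (@cts_clamp _ _ f)
    | |- continuous (fun x => fst (@?f x)) => apply: (@cts_fst _ _ _ f)
    | |- continuous (fun x => snd (@?f x)) => apply: (@cts_snd _ _ _ f)
    | |- continuous (fun x => ?c) => apply: cts_cst
    end ].
Ltac cts := repeat cts_step.

Lemma cts_addv (R : realType) (T : topologicalType) (V : normedModType R)
    (f g : T -> V) :
  continuous f -> continuous g -> continuous (fun x => f x + g x).
Proof. by move=> cf cg x; apply: cvgD; [exact: cf|exact: cg]. Qed.

Lemma cts_scalev (R : realType) (T : topologicalType) (V : normedModType R)
    (l : T -> R) (f : T -> V) :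
  continuous l -> continuous f -> continuous (fun x => l x *: f x).
Proof. by move=> cl cf x; apply: cvgZ; [exact: cl|exact: cf]. Qed.

Lemma within_comp (T U V : topologicalType) (S : set U) (g : U -> V) (f : T -> U) :
  {within S, continuous g} -> continuous f -> (forall x, S (f x)) ->
  continuous (fun x => g (f x)).
Proof.
move=> /subspace_continuousP cg cf Sf x B /(cg _ (Sf x)) /=.
rewrite nbhs_simpl /= /within /= => gB; have := cf x _ gB; rewrite nbhs_simpl /=.
by apply: filterS => y /= /(_ (Sf y)).
Qed.

Lemma within_comp_in (T U V : topologicalType) (S : set U) (S' : set T) (g : U -> V)
    (f : T -> U) :
  {within S, continuous g} -> {within S', continuous f} -> (forall x, S' x -> S (f x)) ->
  {within S', continuous (fun x => g (f x))}.
Proof.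
move=> /subspace_continuousP cg /subspace_continuousP cf Sf.
apply/subspace_continuousP => x S'x B /(cg _ (Sf x S'x)) /=.
rewrite nbhs_simpl /= /within /= => gB; have := cf x S'x _ gB.
rewrite !nbhs_simpl /= /within /=.
by apply: filterS => y /= + S'y => /(_ S'y) /(_ (Sf y S'y)).
Qed.

Lemma within_eq (T U : topologicalType) (S : set T) (f g : T -> U) :
  (forall x, S x -> f x = g x) -> {within S, continuous f} ->
  {within S, continuous g}.
Proof.
by move=> fg; apply: subspace_eq_continuous => x /set_mem /fg.
Qed.

Lemma paste (T U : topologicalType) (A B : set T) (f : T -> U) :
  closed A -> closed B -> (forall x, A x \/ B x) ->
  {within A, continuous f} -> {within B, continuous f} -> continuous f.
Proof.
move=> cA cB AB fA fB; have := withinU_continuous cA cB fA fB.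
rewrite (_ : A `|` B = setT); last by apply/seteqP; split => // x _; exact: AB.
exact: (iffRL (continuous_subspace_setT f)).
Qed.

Lemma closed_le_fun (T : topologicalType) (R : realType) (f g : T -> R) :
  continuous f -> continuous g -> closed [set x | f x <= g x].
Proof.
move=> cf cg.
have -> : [set x | f x <= g x] = (fun x => g x - f x) @^-1` [set y | 0 <= y].
  by apply/seteqP; split => x /=; rewrite subr_ge0.
apply: preimage_closed; last exact: (@closed_ge R 0).
by move=> x _; apply: ctsD => //; exact: ctsN.
Qed.

Lemma paste_le (T U : topologicalType) (R : realType) (a b : T -> R) (f g : T -> U) :
  continuous a -> continuous b ->
  {within [set x | a x <= b x], continuous f} ->
  {within [set x | b x <= a x], continuous g} ->
  (forall x, a x = b x -> f x = g x) ->
  continuous (fun x => if a x <= b x then f x else g x).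
Proof.
move=> ca cb cf cg fg.
apply: (@paste _ _ [set x | a x <= b x] [set x | b x <= a x]).
- exact: closed_le_fun.
- exact: closed_le_fun.
- by move=> x; exact/orP/le_total.
- by apply: within_eq cf => x /= ->.
- apply: within_eq cg => x /= ba; case: ifPn => // ab.
  by symmetry; apply: fg; apply/eqP; rewrite eq_le ab.
Qed.

(** Continuity along a subspace can be tested on any space that is embedded onto
    it; of the embedding only the comparison of neighbourhoods matters. *)
Lemma within_embed (P A X T : topologicalType) (i : A -> X) (F : P * X -> T) :
  (forall a V, nbhs a V -> exists2 U, nbhs (i a) U & forall a', U (i a') -> V a') ->
  continuous (fun p : P * A => F (p.1, i p.2)) ->
  {within [set p : P * X | range i p.2], continuous F}.
Proof.
move=> emb cF; apply/subspace_continuousP => -[p x] /= [a _ <-] B.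
move=> /(cF (p, a)) /= [[U V]] /= [pU aV] UV.
have [W iW WV] := emb _ _ aV.
rewrite nbhs_simpl /= /within /=; exists (U, W); first by split.
move=> [p' x'] /= [Up' Wx'] [a' _ ia']; rewrite -ia'.
by apply: (UV (p', a')); split => //=; apply: WV; rewrite ia'.
Qed.

Lemma set_val_embed (X : topologicalType) (A : set X) (a : set_type A) V :
  nbhs a V -> exists2 U, nbhs (sval a) U & forall a', U (sval a') -> V a'.
Proof.
case=> _ [[W oW <-] /= Wa WV]; exists W; first exact: open_nbhs_nbhs.
by move=> a' Wa'; exact: WV.
Qed.

Lemma set_val_cts (X : topologicalType) (A : set X) :
  continuous (fun a : set_type A => sval a).
Proof. exact: initial_continuous. Qed.

Lemma set_type_closed (X : topologicalType) (A : set X) (B : set (set_type A)) :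
  closed B -> exists2 F : set X, closed F & B = [set a | F (sval a)].
Proof.
move=> /closed_openC [W oW WB]; exists (~` W); first exact: open_closedC.
by rewrite -[LHS]setCK -WB.
Qed.

Lemma within_set_type (P X T : topologicalType) (A : set X) (F : P * X -> T) :
  continuous (fun p : P * set_type A => F (p.1, sval p.2)) <->
  {within [set p : P * X | A p.2], continuous F}.
Proof.
have -> : [set p : P * X | A p.2] = [set p : P * X | range (fun a : set_type A => sval a) p.2].
  apply/seteqP; split=> -[p x] /=; last by case=> a _ <-; exact: (set_mem (svalP a)).
  by move=> Ax; exists (exist _ x (mem_set Ax)).
split; first by apply: within_embed; exact: set_val_embed.
move=> cF; apply: (within_comp cF); last by move=> [p a] /=; exists a.
by have h := @set_val_cts X A; cts.
Qed.

Lemma within_post (T U V : topologicalType) (S : set T) (g : U -> V) (f : T -> U) :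
  continuous g -> {within S, continuous f} ->
  {within S, continuous (fun x => g (f x))}.
Proof.
move=> cg /subspace_continuousP cf; apply/subspace_continuousP => x Sx B gB.
exact: (cf x Sx _ (cg _ _ gB)).
Qed.

Lemma within_pair (T U V : topologicalType) (S : set T) (f : T -> U) (g : T -> V) :
  {within S, continuous f} -> {within S, continuous g} ->
  {within S, continuous (fun x => (f x, g x))}.
Proof.
move=> /subspace_continuousP cf /subspace_continuousP cg.
by apply/subspace_continuousP => x Sx; apply: cvg_pair; [exact: cf|exact: cg].
Qed.

Lemma within_preim_closed (T U : topologicalType) (D : set T) (C : set U) (f : T -> U) :
  closed D -> {within D, continuous f} -> closed C -> closed (D `&` f @^-1` C).
Proof.
move=> cD /continuous_closedP cf cC; have := cf _ cC.
by rewrite setIC closed_setIS.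
Qed.

Lemma within_bigcup (T U : topologicalType) (I : Type) (F : set I)
    (B : I -> set T) (f : T -> U) : finite_set F ->
  (forall i, F i -> closed (B i)) ->
  (forall i, F i -> {within (B i), continuous f}) ->
  {within \bigcup_(i in F) B i, continuous f}.
Proof.
move=> fF cB cf; apply/continuous_closedP => C cC; apply/closed_subspaceP.
exists (\bigcup_(i in F) (B i `&` f @^-1` C)).
  apply: (@closed_bigcup _ {classic I}) => // i Fi.
  by apply: within_preim_closed => //; [exact: cB|exact: cf].
apply/seteqP; split=> x.
  by case=> -[i Fi [Bi Ci]] _; split=> //; exists i.
by move=> [Cx [i Fi Bi]]; split; exists i.
Qed.

Section Final.
Context (R : realType).

(** V carries the final topology for the jointly surjective maps q i.  The
    condition is on maps out of V, which is the form in which it passes to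
    products with the real line. *)
Definition final_family (I : Type) (U : I -> topologicalType)
    (V : topologicalType) (q : forall i, U i -> V) : Prop :=
  (forall v, exists i u, q i u = v) /\
  forall (W : topologicalType) (g : V -> W),
    (forall i, continuous (fun u => g (q i u))) -> continuous g.

Lemma final_open (I : Type) (U : I -> topologicalType)
    (V : topologicalType) (q : forall i, U i -> V) :
  (forall v, exists i u, q i u = v) ->
  (forall B : set V, (forall i, closed (q i @^-1` B)) -> closed B) ->
  final_family q.
Proof.
move=> sq oq; split=> // W g gq; apply/continuous_closedP => B cB.
by apply: oq => i; move: (gq i) => /continuous_closedP/(_ _ cB).
Qed.

Import ArrowAsCompactOpen.

(** By currying, a map on R * V is a map from V to the space of maps R -> W with
    the compact-open topology, where finality applies; uncurrying is continuous
    because R is locally compact Hausdorff. *)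
Lemma final_prodR (I : Type) (U : I -> topologicalType)
    (V : topologicalType) (q : forall i, U i -> V) :
  final_family q ->
  final_family (fun i (p : R * U i) => ((p.1, q i p.2) : R * V)).
Proof.
move=> [sq fq]; split.
  by move=> [t v]; have [i [u <-]] := sq v; exists i, (t, u).
move=> W g gq.
pose G : V -> R -> W := fun v t => g (t, v).
have qU i : continuous (fun u => G (q i u)) /\ forall u, continuous (G (q i u)).
  have := @continuous_curry (U i) R W (fun p => g (p.2, q i p.1)).
  apply; apply: (cts_comp (gq i) (f := fun p => (p.2, p.1))).
  by cts.
have cG : continuous G by apply: fq => i; case: (qU i).
have cGv v : continuous (G v).
  by have [i [u <-]] := sq v; case: (qU i).
have Rh : hausdorff_space R by exact: order_hausdorff.
have := continuous_uncurry (@locally_compactR R) Rh cG cGv.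
move=> cu; have -> : g = (fun p : R * V => uncurry G (p.2, p.1)).
  by apply/funext => -[].
by apply: (cts_comp cu (f := fun p => (p.2, p.1))); cts.
Qed.

End Final.

(** * Families of loops *)

Section Loops.
Context (R : realType).

(** A map S X -> T, as a map on R * X that is trivial outside 0 < t < 1 and over
    the set A.  Letting t range over all of R spares the bounds in concatenations
    and reparametrizations, and a general A allows one to speak of loops, of
    homotopies and of homotopies relative to a subspace in the same way. *)
Record loop (X : topologicalType) (T : ptopologicalType) (A : set X) := Loop {
  loop_fun :> R -> X -> T;
  loop_cts : continuous (fun p : R * X => loop_fun p.1 p.2);
  loop_out : forall t x, t <= 0 \/ 1 <= t -> loop_fun t x = point;
  loop_base : forall t x, A x -> loop_fun t x = point
}.

Section Ops.
Context (X : topologicalType) (T : ptopologicalType) (A : set X).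
Implicit Types c d : loop T A.

Lemma loop_le0 c t x : t <= 0 -> c t x = point.
Proof. by move=> t0; apply: loop_out; left. Qed.

Lemma loop_ge1 c t x : 1 <= t -> c t x = point.
Proof. by move=> t0; apply: loop_out; right. Qed.

Definition loop_cst : loop T A :=
  @Loop X T A (fun _ _ => point) (@cts_cst _ _ _) (fun _ _ _ => erefl) (fun _ _ _ => erefl).

Section Reparam.
Context (c : loop T A) (a : R -> R) (ca : continuous a).
Context (a0 : forall t, t <= 0 -> a t <= 0 \/ 1 <= a t).
Context (a1 : forall t, 1 <= t -> a t <= 0 \/ 1 <= a t).

Lemma reparam_cts : continuous (fun p : R * X => c (a p.1) p.2).
Proof. have h := @loop_cts _ _ _ c; cts. Qed.

Lemma reparam_out t x : t <= 0 \/ 1 <= t -> c (a t) x = point.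
Proof. by case=> h; apply: loop_out; [exact: a0|exact: a1]. Qed.

Definition reparam : loop T A :=
  Loop reparam_cts reparam_out (fun t => @loop_base _ _ _ c (a t)).
End Reparam.

Section LoopAdd.
Context (c d : loop T A).
Let s t x := if 2 * t <= 1 then c (2 * t) x else d (2 * t - 1) x.

Lemma loop_add_cts : continuous (fun p : R * X => s p.1 p.2).
Proof.
apply: (paste_le (a := fun p : R * X => 2 * p.1) (b := fun=> 1)
  (f := fun p => c (2 * p.1) p.2) (g := fun p => d (2 * p.1 - 1) p.2)).
- by cts.
- by cts.
- apply: continuous_subspaceT; have h := @loop_cts _ _ _ c; cts.
- apply: continuous_subspaceT; have h := @loop_cts _ _ _ d; cts.
- by move=> x ->; rewrite subrr loop_ge1 // loop_le0.
Qed.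

Lemma loop_add_out t x : t <= 0 \/ 1 <= t -> s t x = point.
Proof.
rewrite /s; case: ifPn => [|/negP] h [] H; apply: loop_out;
  [left|right|left|right]; lra.
Qed.

Lemma loop_add_base t x : A x -> s t x = point.
Proof. by rewrite /s; case: ifP => _; exact: loop_base. Qed.

Definition loop_add : loop T A := Loop loop_add_cts loop_add_out loop_add_base.
End LoopAdd.

Lemma opp_cts : continuous (fun t : R => 1 - t).
Proof. by cts. Qed.

Lemma opp_out0 (t : R) : t <= 0 -> 1 - t <= 0 \/ 1 <= 1 - t.
Proof. by right; lra. Qed.

Lemma opp_out1 (t : R) : 1 <= t -> 1 - t <= 0 \/ 1 <= 1 - t.
Proof. by left; lra. Qed.

Definition loop_opp c : loop T A := reparam c opp_cts opp_out0 opp_out1.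

(** The concatenation of n loops, each run through in unit time. *)
Fixpoint concat (c : nat -> loop T A) (n : nat) (t : R) (x : X) : T :=
  if n is m.+1 then if t <= m%:R then concat c m t x else c m (t - m%:R) x
  else point.

Lemma concat_le0 (c : nat -> loop T A) n t x : t <= 0 -> concat c n t x = point.
Proof.
elim: n => // n IH t0 /=; case: ifPn => [_|]; first exact: IH.
have n0 : 0 <= n%:R :> R by rewrite ler0n.
by move: t0 n0; clear => t0 n0 /negP h; exfalso; lra.
Qed.

Lemma concat_ge (c : nat -> loop T A) n t x : n%:R <= t -> concat c n t x = point.
Proof.
elim: n => // n IH t0 /=; rewrite -natr1 in t0; case: ifPn => [h|_].
  by exfalso; clear IH; lra.
by apply: loop_ge1; clear IH; lra.
Qed.

Lemma concat_base (c : nat -> loop T A) n t x : A x -> concat c n t x = point.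
Proof. by move=> Ax; elim: n => // n IH /=; case: ifP => _ //; exact: loop_base. Qed.

Lemma concat_cts (c : nat -> loop T A) n :
  continuous (fun p : R * X => concat c n p.1 p.2).
Proof.
elim: n => [|n IH] /=; first exact: cts_cst.
apply: (paste_le (a := fun p : R * X => p.1) (b := fun=> n%:R)
  (f := fun p => concat c n p.1 p.2) (g := fun p => c n (p.1 - n%:R) p.2)).
- by cts.
- by cts.
- exact: continuous_subspaceT.
- apply: continuous_subspaceT; have h := @loop_cts _ _ _ (c n); cts.
- by move=> x ->; rewrite subrr loop_le0 // concat_ge.
Qed.

Lemma concatE (c : nat -> loop T A) n k t x : (k < n)%N ->
  k%:R <= t <= k.+1%:R -> concat c n t x = c k (t - k%:R) x.
Proof.
elim: n => // n IH; rewrite ltnS leq_eqVlt => /predU1P[->|kn] /andP[kt tk] /=.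
  case: ifPn => // tn; have -> : t = n%:R by apply/eqP; rewrite eq_le tn.
  by rewrite concat_ge // subrr loop_le0.
rewrite ifT; first by apply: IH => //; apply/andP.
by apply: le_trans tk _; rewrite ler_nat.
Qed.

Lemma concat_nat (c : nat -> loop T A) n k x : concat c n k%:R x = point.
Proof.
have [nk|kn] := leqP n k; first by rewrite concat_ge // ler_nat.
by rewrite (@concatE _ _ k) // ?subrr ?loop_le0 // lexx ler_nat leqnSn.
Qed.

Lemma sum_cts (c : nat -> loop T A) n :
  continuous (fun p : R * X => concat c n (n%:R * p.1) p.2).
Proof. have h := @concat_cts c n; cts. Qed.

Lemma sum_out (c : nat -> loop T A) n t x :
  t <= 0 \/ 1 <= t -> concat c n (n%:R * t) x = point.
Proof.
have n0 : 0 <= n%:R :> R by rewrite ler0n.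
by case=> H; [apply: concat_le0; nra|apply: concat_ge; nra].
Qed.

Definition loop_sum (c : nat -> loop T A) n : loop T A :=
  Loop (@sum_cts c n) (@sum_out c n) (fun t => @concat_base c n (n%:R * t)).

End Ops.

Section PrePost.
Context (X : topologicalType) (T : ptopologicalType) (A : set X).

Section Post.
Context (T' : ptopologicalType) (f : T -> T') (fP : pointed_map f).
Context (c : loop T A).

Lemma post_cts : continuous (fun p : R * X => f (c p.1 p.2)).
Proof. by case: fP => cf _; have h := @loop_cts _ _ _ c; cts. Qed.

Lemma post_out t x : t <= 0 \/ 1 <= t -> f (c t x) = point.
Proof. by case: fP => _ fp /loop_out ->. Qed.

Lemma post_base t x : A x -> f (c t x) = point.
Proof. by case: fP => _ fp /loop_base ->. Qed.

Definition post : loop T' A := Loop post_cts post_out post_base.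
End Post.

Section Pre.
Context (X' : topologicalType) (A' : set X') (g : X' -> X).
Context (cg : continuous g) (gA : forall x, A' x -> A (g x)) (c : loop T A).

Lemma pre_cts : continuous (fun p : R * X' => c p.1 (g p.2)).
Proof. by have h := @loop_cts _ _ _ c; cts. Qed.

Definition pre : loop T A' := Loop pre_cts
  (fun t x => @loop_out _ _ _ c t (g x))
  (fun t x xA => @loop_base _ _ _ c t (g x) (gA xA)).
End Pre.

End PrePost.

Arguments loop_cst {X T A}.

Section Homotopy.
Context (X : topologicalType) (T : ptopologicalType) (A : set X).
Implicit Types c d e : loop T A.

(** A homotopy is a family of loops over R * X; only its values at the parameters
    0 and 1 are prescribed. *)
Definition lhom c d : Prop := exists h : loop T [set p : R * X | A p.2],
  (forall t x, h t (0, x) = c t x) /\ (forall t x, h t (1, x) = d t x).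

Lemma lhom_eq c d : (forall t x, c t x = d t x) -> lhom c d.
Proof.
move=> cd.
have cs : continuous (@snd R X) by move=> x; exact: cvg_snd.
by exists (@pre _ _ A _ [set p : R * X | A p.2] snd cs (fun _ => id) c).
Qed.

Lemma lhom_refl c : lhom c c. Proof. exact: lhom_eq. Qed.

Lemma lhom_sym c d : lhom c d -> lhom d c.
Proof.
move=> [h [h0 h1]].
have cf : continuous (fun p : R * X => (1 - p.1, p.2)) by cts.
exists (@pre _ _ _ _ [set p : R * X | A p.2] _ cf (fun _ => id) h).
by split=> t x /=; rewrite ?subrr ?subr0 (h0, h1).
Qed.

Lemma lhom_trans d c e : lhom c d -> lhom d e -> lhom c e.
Proof.
move=> [h [h0 h1]] [k [k0 k1]].
pose F t (p : R * X) : T :=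
  if 2 * p.1 <= 1 then h t (2 * p.1, p.2) else k t (2 * p.1 - 1, p.2).
have cF : continuous (fun p : R * (R * X) => F p.1 p.2).
  apply: (paste_le (a := fun p : R * (R * X) => 2 * p.2.1) (b := fun=> 1)
    (f := fun p => h p.1 (2 * p.2.1, p.2.2))
    (g := fun p => k p.1 (2 * p.2.1 - 1, p.2.2))).
  - by cts.
  - by cts.
  - by apply: continuous_subspaceT; have hc := @loop_cts _ _ _ h; cts.
  - by apply: continuous_subspaceT; have hc := @loop_cts _ _ _ k; cts.
  - by move=> x ->; rewrite h1 subrr k0.
have F1 t p : t <= 0 \/ 1 <= t -> F t p = point.
  by move=> tt; rewrite /F; case: ifP => _; rewrite loop_out.
have F2 t (p : R * X) : A p.2 -> F t p = point.
  by move=> tt; rewrite /F; case: ifP => _; rewrite loop_base.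
exists (Loop cF F1 F2); rewrite /= /F; split=> t x /=.
  by rewrite mulr0 ler01.
have -> : (2 * 1 <= 1 :> R) = false by apply/negP; lra.
by rewrite -k1; congr (k _ (_, _)); lra.
Qed.

(** Two changes of parameter with the same behaviour at both ends are joined by
    the straight line between them. *)
Lemma lhom_reparam c (a b : R -> R) (ca : continuous a) (cb : continuous b) a0 a1 b0 b1 :
  (forall t, t <= 0 -> (a t <= 0 /\ b t <= 0) \/ (1 <= a t /\ 1 <= b t)) ->
  (forall t, 1 <= t -> (a t <= 0 /\ b t <= 0) \/ (1 <= a t /\ 1 <= b t)) ->
  lhom (@reparam _ _ _ c a ca a0 a1) (@reparam _ _ _ c b cb b0 b1).
Proof.
move=> h0 h1.
pose F t (p : R * X) : T := c ((1 - clamp p.1) * a t + clamp p.1 * b t) p.2.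
have cF : continuous (fun p : R * (R * X) => F p.1 p.2).
  by have hc := @loop_cts _ _ _ c; rewrite /F; cts.
have cl (s : R) : 0 <= clamp s <= 1.
  by rewrite clamp_ge0 clamp_le1.
have F1 t p : t <= 0 \/ 1 <= t -> F t p = point.
  have /andP[s0 s1] := cl p.1.
  have conv (u v : R) : (u <= 0 /\ v <= 0) \/ (1 <= u /\ 1 <= v) ->
      (1 - clamp p.1) * u + clamp p.1 * v <= 0 \/
      1 <= (1 - clamp p.1) * u + clamp p.1 * v.
    by move: (clamp p.1) s0 s1; clear => s s0 s1; case=> -[u0 v0]; [left|right]; nra.
  by case=> ht; rewrite /F; apply: loop_out; apply: conv; [exact: h0|exact: h1].
have F2 t (p : R * X) : A p.2 -> F t p = point by move=> Ap; exact: loop_base.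
have c0 : clamp (0 : R) = 0 by exact: clamp_le0.
have c1 : clamp (1 : R) = 1 by exact: clamp_ge1.
by exists (Loop cF F1 F2); split=> t x; rewrite /= /F /= (c0, c1); congr (c _ _); lra.
Qed.

Lemma lhom_reparam_eq c c1 c2 (a b : R -> R) :
  continuous a -> continuous b ->
  (forall t x, c1 t x = c (a t) x) -> (forall t x, c2 t x = c (b t) x) ->
  (forall t, t <= 0 -> (a t <= 0 /\ b t <= 0) \/ (1 <= a t /\ 1 <= b t)) ->
  (forall t, 1 <= t -> (a t <= 0 /\ b t <= 0) \/ (1 <= a t /\ 1 <= b t)) ->
  lhom c1 c2.
Proof.
move=> ca cb e1 e2 h0 h1.
have a0 t : t <= 0 -> a t <= 0 \/ 1 <= a t by move=> /h0; tauto.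
have a1 t : 1 <= t -> a t <= 0 \/ 1 <= a t by move=> /h1; tauto.
have b0 t : t <= 0 -> b t <= 0 \/ 1 <= b t by move=> /h0; tauto.
have b1 t : 1 <= t -> b t <= 0 \/ 1 <= b t by move=> /h1; tauto.
apply: (lhom_trans (d := reparam c ca a0 a1)); first exact: lhom_eq.
apply: (lhom_trans (d := reparam c cb b0 b1)); last exact: lhom_eq.
exact: lhom_reparam.
Qed.

Lemma lhom_add c c' d d' : lhom c c' -> lhom d d' -> lhom (loop_add c d) (loop_add c' d').
Proof.
move=> [h [h0 h1]] [k [k0 k1]]; exists (loop_add h k).
by split=> t x /=; rewrite !(h0, h1, k0, k1).
Qed.

Lemma lhom_sum (c d : nat -> loop T A) n :
  (forall k, (k < n)%N -> lhom (c k) (d k)) -> lhom (loop_sum c n) (loop_sum d n).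
Proof.
move=> cd.
have /choice[h hP] : forall k, exists h : loop T [set p : R * X | A p.2],
    (k < n)%N -> (forall t x, h t (0, x) = c k t x) /\
    (forall t x, h t (1, x) = d k t x).
  move=> k; case: (boolP (k < n)%N) => [/cd[h hP]|kn]; first by exists h.
  by exists loop_cst.
exists (loop_sum h n); rewrite /=; split=> t x /=.
- move: (n%:R * t) => {}t; elim: n {cd} hP => // n IH hP /=.
  by case: ifP => _; [apply: IH => k kn; apply: hP; exact: ltnW|case: (hP n (ltnSn n))].
- move: (n%:R * t) => {}t; elim: n {cd} hP => // n IH hP /=.
  by case: ifP => _; [apply: IH => k kn; apply: hP; exact: ltnW|case: (hP n (ltnSn n))].
Qed.

End Homotopy.

(** Concatenation commutes with restriction in the source and with pointed maps
    of the target. *)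
Lemma concat_map (X X' : topologicalType) (T T' : ptopologicalType) (A : set X)
    (A' : set X') (c : nat -> loop T A) (d : nat -> loop T' A') n x x' (f : T -> T') :
  f point = point -> (forall k, (k < n)%N -> forall t, d k t x' = f (c k t x)) ->
  forall t, concat d n t x' = f (concat c n t x).
Proof.
move=> f0; elim: n => [//|n IH] cd t /=; case: ifP => _; last exact: cd.
by apply: IH => k kn; apply: cd; exact: ltnW.
Qed.

End Loops.
Arguments loop_cts {R X T A} l.

(** * The group laws up to homotopy *)

Section LoopGroup.
Context (R : realType) (X : topologicalType) (T : ptopologicalType) (A : set X).
Implicit Types a b c d : @loop R X T A.
Local Notation cst := (@loop_cst R X T A).

(** All the laws below are changes of parameter, by [lhom_reparam_eq]. *)
Lemma lhom_addA a b c : lhom (loop_add (loop_add a b) c) (loop_add a (loop_add b c)).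
Proof.
(* f sends [0, 1/4], [1/4, 1/2], [1/2, 1] to [0, 1/2], [1/2, 3/4], [3/4, 1]. *)
pose f t : R := Num.min (2 * t) (Num.min (t + 4^-1) (2^-1 * (t + 1))).
apply: (@lhom_reparam_eq _ _ _ _ (loop_add a (loop_add b c)) _ _ f (fun t => t)).
- by rewrite /f; cts.
- by cts.
- move=> t x; rewrite /= /f.
  have [h1|h1] := leP (2 * t) 1; last first.
    have -> : Num.min (2 * t) (Num.min (t + 4^-1) (2^-1 * (t + 1))) = 2^-1 * (t + 1).
      by rewrite (min_idPr _) ?ge_min; [apply/min_idPr; lra|apply/orP; right; lra].
    rewrite ifF; last by apply/negP; lra.
    rewrite ifF; last by apply/negP; lra.
    by congr (c _ _); lra.
  have [h2|h2] := leP (2 * (2 * t)) 1.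
    have -> : Num.min (2 * t) (Num.min (t + 4^-1) (2^-1 * (t + 1))) = 2 * t.
      by apply/min_idPl; rewrite le_min; apply/andP; split; lra.
    by rewrite ifT.
  have -> : Num.min (2 * t) (Num.min (t + 4^-1) (2^-1 * (t + 1))) = t + 4^-1.
    by rewrite (min_idPr _) ?ge_min; [apply/min_idPl; lra|apply/orP; left; lra].
  rewrite ifF; last by apply/negP; lra.
  by rewrite ifT; [congr (b _ _)|]; lra.
- by [].
- move=> t t0; left; rewrite /f !ge_min; split => //.
  by apply/orP; left; lra.
- move=> t t1; right; rewrite /f !le_min; split => //.
  by apply/and3P; split; lra.
Qed.

Lemma lhom_add0l c : lhom (loop_add cst c) c.
Proof.
apply: (@lhom_reparam_eq _ _ _ _ c _ _ (fun t => 2 * t - 1) (fun t => t)) => //.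
- by cts.
- by cts.
- by move=> t x /=; case: ifPn => // h; rewrite loop_le0 //; lra.
- by move=> t t0; left; split; lra.
- by move=> t t0; right; split; lra.
Qed.

Lemma lhom_addl0 c : lhom (loop_add c cst) c.
Proof.
apply: (@lhom_reparam_eq _ _ _ _ c _ _ (fun t => 2 * t) (fun t => t)) => //.
- by cts.
- by cts.
- by move=> t x /=; case: ifPn => // /negP h; rewrite loop_ge1 //; lra.
- by move=> t t0; left; split; lra.
- by move=> t t0; right; split; lra.
Qed.

Lemma lhom_addrN c : lhom (loop_add c (loop_opp c)) cst.
Proof.
apply: (@lhom_reparam_eq _ _ _ _ c _ _ (fun t => Num.min (2 * t) (2 - 2 * t))
  (fun=> 0)) => //.
- by cts.
- by cts.
- move=> t x /=; case: ifPn => [h|/negP h].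
    by rewrite (min_idPl _) //; lra.
  by rewrite (min_idPr _) //; [congr (c _ _)|]; lra.
- by move=> t x /=; rewrite loop_le0.
- by move=> t t0; left; rewrite ge_min; split => //; apply/orP; left; lra.
- by move=> t t0; left; rewrite ge_min; split => //; apply/orP; right; lra.
Qed.

Lemma lhom_addNr c : lhom (loop_add (loop_opp c) c) cst.
Proof.
apply: (@lhom_reparam_eq _ _ _ _ c _ _ (fun t => Num.max (1 - 2 * t) (2 * t - 1))
  (fun=> 1)) => //.
- by cts.
- by cts.
- move=> t x /=; case: ifPn => [h|/negP h].
    by rewrite (max_idPl _) //; lra.
  by rewrite (max_idPr _) //; lra.
- by move=> t x /=; rewrite loop_ge1.
- by move=> t t0; right; rewrite le_max; split => //; apply/orP; left; lra.
- by move=> t t0; right; rewrite le_max; split => //; apply/orP; right; lra.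
Qed.

Lemma lhom_sum_recr (c : nat -> loop R T A) n :
  lhom (@loop_sum R X T A c n.+1) (loop_add (loop_sum c n) (c n)).
Proof.
have n0 : 0 <= n%:R :> R by rewrite ler0n.
have n1 : 0 < n.+1%:R :> R by rewrite ltr0n.
(* The first half of the sum is the concatenation of the n first loops, in time
   1 / 2, and the last loop takes the other half. *)
pose f t : R := n.+1%:R^-1 * (n%:R * Num.min (2 * t) 1 + Num.max (2 * t - 1) 0).
apply: lhom_sym.
apply: (@lhom_reparam_eq _ _ _ _ (loop_sum c n.+1) _ _ f (fun t => t)).
- by rewrite /f; cts.
- by cts.
- move=> t x.
  have e : n.+1%:R * f t = n%:R * Num.min (2 * t) 1 + Num.max (2 * t - 1) 0.
    by rewrite /f mulVKf ?gt_eqF.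
  rewrite /= e.
  case: ifPn => [h|/negP h].
    have -> : Num.min (2 * t) 1 = 2 * t by apply/min_idPl.
    have -> : Num.max (2 * t - 1) 0 = 0 by apply/max_idPr; lra.
    by rewrite addr0 ifT //; nra.
  have -> : Num.min (2 * t) 1 = 1 by apply/min_idPr; lra.
  have -> : Num.max (2 * t - 1) 0 = 2 * t - 1 by apply/max_idPl; lra.
  rewrite ifF; last by apply/negP; lra.
  by congr (c _ _ _); lra.
- by [].
- move=> t t0; left; rewrite /f; split => //.
  rewrite (min_idPl _); last by lra.
  rewrite (max_idPr _); last by lra.
  by rewrite addr0 pmulr_rle0 ?invr_gt0 //; nra.
- move=> t t1; right; rewrite /f; split => //.
  rewrite (min_idPr _); last by lra.
  rewrite (max_idPl _); last by lra.
  by rewrite mulrC ler_pdivlMr // -natr1; lra.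
Qed.

Lemma lhom_add_cancel a b c : lhom (loop_add a b) (loop_add a c) -> lhom b c.
Proof.
have key d : lhom (loop_add (loop_opp a) (loop_add a d)) d.
  apply: lhom_trans (lhom_add0l d).
  apply: lhom_trans (lhom_add (lhom_addNr a) (lhom_refl d)).
  by apply: lhom_sym; exact: lhom_addA.
move=> h; apply: lhom_trans (lhom_trans (lhom_add (lhom_refl (loop_opp a)) h) (key c)).
by apply: lhom_sym; exact: key.
Qed.

Lemma lhom_add_opp a b : lhom (loop_add a (loop_add (loop_opp a) b)) b.
Proof.
apply: lhom_trans (lhom_add0l b).
apply: lhom_trans (lhom_add (lhom_addrN a) (lhom_refl b)).
by apply: lhom_sym; exact: lhom_addA.
Qed.

Lemma lhom_diff0 a b : lhom (loop_add a (loop_opp b)) cst -> lhom a b.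
Proof.
move=> h; apply: lhom_trans (lhom_add0l b).
apply: lhom_trans (lhom_add h (lhom_refl b)).
apply: lhom_sym; apply: lhom_trans (lhom_addA _ _ _) _.
by apply: lhom_trans (lhom_add (lhom_refl a) (lhom_addNr b)) (lhom_addl0 a).
Qed.

Lemma lhom_diff a b : lhom a b -> lhom (loop_add (loop_opp b) a) cst.
Proof.
move=> h; apply: lhom_trans (lhom_addNr b).
by apply: lhom_add => //; exact: lhom_refl.
Qed.

Lemma lhom_diffr a b : lhom a b -> lhom (loop_add a (loop_opp b)) cst.
Proof.
move=> h; apply: lhom_trans (lhom_addrN b).
by apply: lhom_add => //; exact: lhom_refl.
Qed.

End LoopGroup.

Section Functor.
Context (R : realType).

Lemma lhom_pre (X X' : topologicalType) (T : ptopologicalType) (A : set X)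
    (A' : set X') (g : X' -> X) (cg : continuous g)
    (gA : forall x, A' x -> A (g x)) (c d : @loop R X T A) :
  lhom c d -> lhom (pre cg gA c) (pre cg gA d).
Proof.
move=> [h [h0 h1]].
have cf : continuous (fun p : R * X' => (p.1, g p.2)) by cts.
have fA (p : R * X') : [set p : R * X' | A' p.2] p ->
  [set p : R * X | A p.2] (p.1, g p.2) by exact: gA.
by exists (pre cf fA h); split=> t x; [exact: h0|exact: h1].
Qed.

Lemma lhom_post (X : topologicalType) (T T' : ptopologicalType) (A : set X)
    (f : T -> T') (fP : pointed_map f) (c d : @loop R X T A) :
  lhom c d -> lhom (post fP c) (post fP d).
Proof.
by move=> [h [h0 h1]]; exists (post fP h); split=> t x; rewrite /= (h0, h1).
Qed.

End Functor.

(** * Homotopy extension from a deformation *)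

(** A closed embedding; continuity of the inverse is stated on neighbourhoods,
    for use with [within_embed]. *)
Definition embedding (A X : topologicalType) (i : A -> X) : Prop :=
  [/\ injective i, continuous i, closed (range i) &
      forall a V, nbhs a V -> exists2 U, nbhs (i a) U & forall a', U (i a') -> V a'].

Definition extend (P A X : Type) (T : pointedType) (i : A -> X)
    (n : P -> A -> T) (p : P) (x : X) : T :=
  if pselect (exists a, i a = x) is left e then n p (projT1 (cid e)) else point.

Lemma extendE (P A X : Type) (T : pointedType) (i : A -> X)
    (n : P -> A -> T) p a : injective i -> extend i n p (i a) = n p a.
Proof.
move=> iI; rewrite /extend; case: pselect => [e|[]]; last by exists a.
by congr (n p _); case: cid => a' /= /iI.
Qed.

Lemma extend_within (P A X : topologicalType) (T : ptopologicalType) (i : A -> X)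
    (n : P -> A -> T) : embedding i ->
  continuous (fun p : P * A => n p.1 p.2) ->
  {within [set p : P * X | range i p.2],
    continuous (fun p => extend i n p.1 p.2)}.
Proof.
move=> [iI _ _ emb] cn.
apply: (within_embed (F := fun p => extend i n p.1 p.2) emb).
rewrite (_ : (fun _ => _) = fun p => n p.1 p.2) //.
by apply/funext => -[p a]; rewrite extendE.
Qed.

Section HomotopyExtension.
Context (R : realType) (A X : topologicalType) (i : A -> X).
Context (phi : X -> R) (H : R -> X -> X).

(** Strom's characterization of the closed cofibrations A -> X: H deforms X rel A,
    and has moved x into A at every time later than phi x. *)
Definition strom_deformation : Prop :=
  [/\ continuous phi, continuous (fun p : R * X => H p.1 p.2),
      (forall x, H 0 x = x) &
      [/\ (forall x, 0 <= phi x), (forall a, phi (i a) = 0),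
       (forall s a, H s (i a) = i a) &
       (forall s x, phi x < s -> s <= 1 -> range i (H s x))]].

Context (emb : embedding i) (st : strom_deformation).
Context (T : ptopologicalType) (B : set (R * X)).
Context (BH : forall p x s, B (p, x) -> B (p, H s x)).
Context (c : loop R T B).
Context (n : loop R T [set q : R * (R * A) | B (q.2.1, i q.2.2)]).
Context (n0 : forall t p a, n t (0, (p, a)) = c t (p, i a)).
Context (n1 : forall t p a, n t (1, (p, a)) = point).

Let nn (q : R * R * R) (x : X) : T :=
  extend i (fun q a => n q.1.1 (q.1.2, (q.2, a))) q x.

(* Families of loops have a parameter p in R, which the deformation ignores. *)
Let K t (q : R * (R * X)) : T :=
  let s := clamp q.1 in let x := q.2.2 in
  if s <= phi x then c t (q.2.1, H s x)
  else nn (t, s - phi x, q.2.1) (H s x).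

Let K_cts : continuous (fun p : R * (R * (R * X)) => K p.1 p.2).
Proof.
have [cphi cH H0 [phi0 phii Hi Hend]] := st.
have [iI ci cli _] := emb.
have cc := @loop_cts _ _ _ _ c.
pose s (p : R * (R * (R * X))) := clamp p.2.1.
have cs : continuous s by rewrite /s; cts.
pose x (p : R * (R * (R * X))) := p.2.2.2.
have cx : continuous x by rewrite /x; cts.
have cHs : continuous (fun p => H (s p) (x p)) by cts.
pose S1 := [set p | phi (x p) <= s p] `&`
  ((fun p => H (s p) (x p)) @^-1` range i).
apply: (@paste _ _ [set p | s p <= phi (x p)] S1).
- by apply: (closed_le_fun (f := s) (g := fun p => phi (x p))); cts.
- apply: closedI; first by apply: (closed_le_fun (f := fun p => phi (x p)) (g := s)); cts.
  by apply: preimage_closed => // z _; exact: cHs.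
- move=> p; have [|h] := leP (s p) (phi (x p)); [by left|right; split => /=].
    exact: ltW.
  by apply: Hend => //; exact: clamp_le1.
- apply: (within_eq (f := fun p => c p.1 (p.2.2.1, H (s p) (x p)))).
    by move=> p /= sp; rewrite /K ifT.
  by apply: continuous_subspaceT; cts.
- apply: (within_eq (f := fun p => nn (p.1, s p - phi (x p), p.2.2.1) (H (s p) (x p)))).
    move=> p [/= h1 [a _ h2]]; rewrite /K -/(x p) -/(s p).
    case: ifP => // h3; rewrite -h2 /nn extendE //=.
    have -> : s p = phi (x p) by apply/eqP; rewrite eq_le h1 h3.
    by rewrite subrr n0.
  apply: (@within_comp_in _ _ _ [set q : (R * R * R) * X | range i q.2] S1
    (fun q => nn q.1 q.2)
    (fun p => ((p.1, s p - phi (x p), p.2.2.1), H (s p) (x p)))).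
  + apply: extend_within => //; have nc := @loop_cts _ _ _ _ n; cts.
  + by apply: continuous_subspaceT; cts.
  + by move=> p [].
Qed.

Let K_const p x s t : (forall s' t a, n t (s', (p, a)) = point) ->
  K t (s, (p, x)) = c t (p, H (clamp s) x).
Proof.
have [cphi cH H0 [phi0 phii Hi Hend]] := st; have [iI ci cli _] := emb.
move=> np; rewrite /K /=; case: ifPn => //; rewrite -ltNge => h.
have [a _ <-] := Hend _ _ h (clamp_le1 s).
by rewrite /nn extendE //= np -n0 np.
Qed.

Let K_out t q : t <= 0 \/ 1 <= t -> K t q = point.
Proof.
move=> tt; rewrite /K; case: ifP => _; rewrite ?loop_out // /nn /extend.
by case: pselect => // e; rewrite loop_out.
Qed.

Let K_base t (q : R * (R * X)) : B q.2 -> K t q = point.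
Proof.
have [iI ci cli _] := emb.
case: q => s [p x] /= Bq; have := BH (clamp s) Bq => BHq.
rewrite /K /=; case: ifP => _; rewrite ?loop_base // /nn /extend.
by case: pselect => // -[a ia]; rewrite loop_base //=; case: cid => a' /= ->.
Qed.

(** The homotopy extension property for [c], and the homotopy [n] from its
    restriction to A to the trivial loop: (s, x) is retracted to
    (s - phi x, H s x) in A if s > phi x, and to (0, H s x) otherwise.  The last
    clause says that where [n] is constant, the extension is the composite of [c]
    with the deformation. *)
Lemma homotopy_extension : exists k : loop R T [set q : R * (R * X) | B q.2],
  [/\ forall t p, k t (0, p) = c t p,
      forall t p a, k t (1, (p, i a)) = point,
      (forall t s p x, B (p, x) -> k t (s, (p, x)) = point) &
      forall p, (forall s t a, n t (s, (p, a)) = point) ->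
        forall s t x, k t (s, (p, x)) = c t (p, H (clamp s) x)].
Proof.
have [cphi cH H0 [phi0 phii Hi Hend]] := st; have [iI ci cli _] := emb.
exists (Loop K_cts K_out K_base); split => /=.
- by move=> t [p x]; rewrite /K /= clamp_le0 // phi0 H0.
- move=> t p a; rewrite /K /= clamp_ge1 // phii ifF; last by apply/negP; lra.
  by rewrite subr0 Hi /nn extendE //= n1.
- by move=> t s p x Bpx; exact: (@K_base t (s, (p, x))).
- by move=> p np s t x; exact: K_const.
Qed.

End HomotopyExtension.

(** * Sums of loops pulled back along a filtration *)

Section Split.
Context (R : realType).

Definition base (X : ptopologicalType) (AP : set R) : set (R * X) :=
  [set p | AP p.1 \/ p.2 = point].
Arguments base : clear implicits.

Section Pull.
Context (X Y : ptopologicalType) (q : X -> Y) (qP : pointed_map q).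
Context (T : ptopologicalType).

Lemma pull_cts : continuous (fun p : R * X => (p.1, q p.2)).
Proof. by have [cq _] := qP; cts. Qed.

Lemma pullP_base AP (p : R * X) : base X AP p -> base Y AP (p.1, q p.2).
Proof. by case: qP => _ q0; case=> [|/= ->]; [left|right]. Qed.

Lemma pull_base (x : X) : [set point] x -> [set point] (q x).
Proof. by case: qP => _ q0 ->. Qed.

Definition pullP AP (b : loop R T (base Y AP)) : loop R T (base X AP) :=
  pre pull_cts (@pullP_base AP) b.

Definition pull (b : loop R T [set (point : Y)]) : loop R T [set (point : X)] :=
  pre (proj1 qP) pull_base b.

End Pull.

Section Weaken.
Context (X : topologicalType) (T : ptopologicalType) (A B : set X).
Definition weaken (AB : A `<=` B) (c : loop R T B) : loop R T A :=
  pre (@cts_id X) AB c.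
End Weaken.

Section Def.
Context (X : ptopologicalType) (Q : nat -> ptopologicalType).
Context (q : forall j, X -> Q j) (qP : forall j, pointed_map (q j)) (k : nat).

(** Every family of loops on X is, up to homotopy, a sum of families pulled back
    along the q j with j < k.  The families depend on a real parameter, and are
    trivial at the parameters in AP; this is used with AP empty, or with AP the
    complement of the interior of the unit interval for loops of loops. *)
Definition sum_onto : Prop := forall (T : ptopologicalType) (AP : set R)
    (c : loop R T (base X AP)),
  exists b : forall j, loop R T (base (Q j) AP),
    lhom c (loop_sum (fun j => pullP (qP j) (b j)) k).

(** The summands in [sum_onto] are determined up to homotopy. *)
Definition sum_inj : Prop := forall (T : ptopologicalType)
    (b b' : forall j, loop R T [set (point : Q j)]),
  lhom (loop_sum (fun j => pull (qP j) (b j)) k)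
       (loop_sum (fun j => pull (qP j) (b' j)) k) ->
  forall j, (j < k)%N -> lhom (b j) (b' j).

End Def.

Lemma sum_onto0 (X : ptopologicalType) (Q : nat -> ptopologicalType)
    (q : forall j, X -> Q j) (qP : forall j, pointed_map (q j)) :
  (forall x : X, x = point) -> sum_onto qP 0.
Proof.
move=> X0 T AP c; exists (fun=> loop_cst _ _ _); apply: lhom_eq => t -[p x] /=.
by rewrite loop_base //; right; exact: X0.
Qed.

Section Step.
Context (A X : ptopologicalType) (i : A -> X) (iP : pointed_map i).
Context (phi : X -> R) (H : R -> X -> X).
Context (emb : embedding i) (st : strom_deformation i phi H).
Context (Q : nat -> ptopologicalType) (q : forall j, X -> Q j).
Context (qP : forall j, pointed_map (q j)) (k : nat).

Lemma qiP j : pointed_map (q j \o i).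
Proof.
have [ci i0] := iP; have [cq q0] := qP j; split; last by rewrite /= i0 q0.
exact: cts_comp cq ci.
Qed.

Context (fq : final_family (fun _ : unit => q k)).
Context (qi : forall a, q k (i a) = point).
Context (q_inj : forall x x', q k x = q k x' ->
  x = x' \/ range i x /\ range i x').

(** The quotient of X by A is Q k, so that loops trivial on A come from Q k. *)
Lemma descends (T : ptopologicalType) AP (g : loop R T (base X AP)) :
  (forall t p a, g t (p, i a) = point) ->
  exists b : loop R T (base (Q k) AP), forall t p x, b t (p, q k x) = g t (p, x).
Proof.
move=> gi.
have /choice[s sP] : forall y, exists x, q k x = y.
  by move=> y; case: fq => sq _; have [[] [x <-]] := sq y; exists x.
pose b t (p : R * Q k) := g t (p.1, s p.2).
have bE t p x : b t (p, q k x) = g t (p, x).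
  rewrite /b /=; have := sP (q k x).
  by move=> /q_inj[->//|[[a _ <-] [a' _ <-]]]; rewrite !gi.
have cb : continuous (fun p : R * (R * Q k) => b p.1 p.2).
  have [_] := final_prodR R (final_prodR R fq); apply => _ /=.
  have -> : (fun u : R * (R * X) => b u.1 (u.2.1, q k u.2.2)) =
            (fun u => g u.1 u.2).
    by apply/funext => -[t [p x]]; rewrite bE.
  exact: loop_cts.
have b_out t p : t <= 0 \/ 1 <= t -> b t p = point by exact: loop_out.
have b_base t p : base (Q k) AP p -> b t p = point.
  case: p => p y [/= Ap|/= ->]; first by rewrite /b loop_base //; left.
  by rewrite -(qi point) bE.
by exists (Loop cb b_out b_base).
Qed.

Context (exA : sum_onto qiP k).

Let i1_cts : continuous (fun p : R * A => (p.1, i p.2)).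
Proof. by have [ci _] := iP; cts. Qed.

Let i1_base AP (p : R * A) : base A AP p -> base X AP (p.1, i p.2).
Proof. by case: iP => _ i0; case=> [|/= ->]; [left|right]. Qed.

Let i_pt (a : A) : i a = point -> a = point.
Proof. by have [iI _ _ _] := emb; have [_ i0] := iP; rewrite -i0 => /iI. Qed.

Let H_pt s : H s point = point.
Proof. by case: st => _ _ _ [_ _ Hi _]; case: iP => _ <-. Qed.

Let base_H AP p x s : base X AP (p, x) -> base X AP (p, H s x).
Proof. by case=> [?|/= ->]; [left|right; exact: H_pt]. Qed.

(** Subtract from c the sum s given by the hypothesis on A, make the difference d
    trivial on A by [homotopy_extension], and let it descend to Q k. *)
Lemma sum_onto_step : sum_onto qP k.+1.
Proof.
move=> T AP c.
have [b hb] := exA (pre i1_cts (@i1_base AP) c).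
pose s := loop_sum (fun j => pullP (qP j) (b j)) k.
pose d := loop_add (loop_opp s) c.
have : lhom (pre i1_cts (@i1_base AP) d) (loop_cst _ _ _).
  apply: lhom_trans (lhom_diff hb); apply: lhom_eq => t x /=.
  have e u : concat (fun j => pullP (qiP j) (b j)) k u x =
      concat (fun j => pullP (qP j) (b j)) k u (x.1, i x.2).
    exact: (concat_map (f := idfun)).
  by case: ifP; rewrite // e.
move=> [n [n0 n1]].
have sub : [set r : R * (R * A) | base X AP (r.2.1, i r.2.2)] `<=`
           [set r | base A AP r.2].
  by move=> [r [p a]] [/= ?|/= /i_pt ?]; [left|right].
have [K [K0 K1 _ _]] := @homotopy_extension R A X i phi H emb st T (base X AP) (@base_H AP) d
   (weaken sub n) (fun t p a => n0 t (p, a)) (fun t p a => n1 t (p, a)).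
have ct1 : continuous (fun p : R * X => ((1 : R), p)) by cts.
pose g := @pre R _ _ _ _ (base X AP) _ ct1 (fun p Bp => Bp) K.
have [bk bkE] := descends (g := g) (fun t p a => K1 t p a).
(* The family b, with bk as its value at k. *)
pose b' := dfwith b k bk.
exists b'; apply: lhom_sym; apply: lhom_trans (lhom_sum_recr _ _) _.
apply: lhom_trans (lhom_add_opp s c); apply: lhom_add.
  apply: lhom_sum => j jk; apply: lhom_eq => t x.
  by rewrite /b' dfwithout // gtn_eqF.
apply: lhom_sym; exists K; split=> t p; first exact: K0.
by case: p => p x; rewrite /b' dfwithin /= bkE.
Qed.

(** A null-homotopy h of the pull-back of b is, on A, a loop of loops; its
    extension e to X by [sum_onto] is subtracted from h, which makes the
    restriction to A null-homotopic relative to the ends.  The extension K of this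
    homotopy provides two homotopies on X that are trivial on A: one from b + 0
    to its composite with the deformation, while the parameter of h is 0, and
    then one to the trivial loop, along the parameter of h.  They descend to
    Q k. *)
Lemma pull_inj (T : ptopologicalType) (b : loop R T [set (point : Q k)]) :
  lhom (pull (qP k) b) (loop_cst _ _ _) -> lhom b (loop_cst _ _ _).
Proof.
move=> [h [h0 h1]].
pose AP : set R := [set s | s <= 0 \/ 1 <= s].
have cc : continuous (fun p : R * X => (clamp p.1, p.2)) by cts.
have hb (p : R * X) : base X set0 p ->
    [set p : R * X | [set point] p.2] (clamp p.1, p.2) by case.
pose h' := pre cc hb h.
have cl0 (s : R) : s <= 0 -> clamp s = 0 by exact: clamp_le0.
have cl1 (s : R) : 1 <= s -> clamp s = 1 by exact: clamp_ge1.
have hAc : continuous (fun p : R * (R * A) => h' p.1 (p.2.1, i p.2.2)).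
  by have [ci _] := iP; have hc := loop_cts h'; cts.
have hAb t (p : R * A) : base A AP p -> h' t (p.1, i p.2) = point.
  case: p => s a [[/= s0|/= s1]|/= ->].
  - by rewrite cl0 // h0 /= qi loop_base.
  - by rewrite cl1 // h1.
  - by rewrite loop_base //=; case: iP.
pose hA : loop R T (base A AP) :=
  Loop hAc (fun t p => @loop_out _ _ _ _ h' t (p.1, i p.2)) hAb.
have [e he] := exA hA.
pose eX := loop_sum (fun j => pullP (qP j) (e j)) k.
have sub0 : base X set0 `<=` base X AP by move=> p []// ?; right.
pose d := loop_add h' (loop_opp (weaken sub0 eX)).
have [n [n0 n1]] := lhom_diffr he.
have sub : [set r : R * (R * A) | base X set0 (r.2.1, i r.2.2)] `<=`
           [set r | base A AP r.2].
  by move=> [r [p a]] []//= /i_pt ?; right.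
have n0' t p a : weaken sub n t (0, (p, a)) = d t (p, i a).
  have eE u : concat (fun j => pullP (qiP j) (e j)) k u (p, a) =
      concat (fun j => pullP (qP j) (e j)) k u (p, i a).
    exact: (concat_map (f := idfun)).
  by rewrite [LHS]n0 /= eE.
have n1' t p a : weaken sub n t (1, (p, a)) = point by exact: n1.
have [K [K0 K1 Kb KH]] := @homotopy_extension R A X i phi H emb st T (base X set0) (@base_H set0) d
   (weaken sub n) n0' n1'.
have KAP p : AP p -> forall s t x, K t (s, (p, x)) = d t (p, H (clamp s) x).
  by move=> Ap; apply: KH => s t a; rewrite /= loop_base //; left.
have eAP t p x : AP p -> eX t (p, x) = point by move=> Ap; rewrite loop_base //; left.
have AP0 : AP 0 by left.
have AP1 : AP 1 by right.
have [_ _ H0 [_ _ Hi _]] := st.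
have cA : continuous (fun p : R * X => (p.1, ((0 : R), p.2))) by cts.
have cB : continuous (fun p : R * X => ((1 : R), p)) by cts.
have bA (p : R * X) : base X set0 p ->
    [set r : R * (R * X) | base X set0 r.2] (p.1, ((0 : R), p.2)) by case=> // ?; right.
have d0 t x : d t (0, x) = (loop_add b (loop_cst _ _ _)) t (q k x).
  rewrite /= cl0 // !h0 /=; case: ifP => // _.
  by apply: (eAP _ 0 x).
have [kA kAE] := descends (g := pre cA bA K) (fun t p a => ltac:(
   rewrite /= KAP // Hi d0 qi loop_base //)).
have [kB kBE] := descends (g := @pre R _ _ _ _ (base X set0) _ cB (fun p Bp => Bp) K)
  (fun t p a => K1 t p a).
have sq y : exists x, q k x = y.
  by case: fq => sq _; have [[] [x <-]] := sq y; exists x.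
have subQ : [set p : R * Q k | [set point] p.2] `<=` base (Q k) set0 by right.
have cs s : continuous (fun y : Q k => (s : R, y)) by cts.
pose b2 : loop R T [set (point : Q k)] :=
  pre (cs 0) (fun y (y0 : [set point] y) => or_intror y0 : base (Q k) set0 (0, y)) kB.
apply: lhom_trans (lhom_sym (lhom_addl0 b)) _; apply: (lhom_trans (d := b2)).
  exists (weaken subQ kA); split=> t y; have [x <-] := sq y.
    by rewrite [LHS]kAE /= KAP // clamp_le0 // H0 d0.
  by rewrite [LHS]kAE [RHS]kBE /= !KAP.
exists (weaken subQ kB); split=> t y //; have [x <-] := sq y.
rewrite [LHS]kBE /= KAP //= cl1 // !h1 /=; case: ifP => // _.
by apply: (eAP _ 1).
Qed.

Context (unA : sum_inj qiP k).

Let i_base (a : A) : [set point] a -> [set point] (i a).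
Proof. by case: iP => _ i0 ->. Qed.

(** On A the last summand vanishes, whence the uniqueness of the others; they are
    then cancelled, and [pull_inj] applies to the last one. *)
Lemma sum_inj_step : sum_inj qP k.+1.
Proof.
move=> T b b' hbb.
have restr (c : forall j, loop R T [set (point : Q j)]) :
    lhom (pre (proj1 iP) i_base (loop_sum (fun j => pull (qP j) (c j)) k.+1))
         (loop_sum (fun j => pull (qiP j) (c j)) k).
  apply: lhom_trans (lhom_addl0 _).
  apply: (lhom_trans (d := loop_sum (fun j => pull (qiP j) (c j)) k.+1)).
    by apply: lhom_eq => t x; symmetry; exact: (concat_map (f := idfun)).
  apply: lhom_trans (lhom_sum_recr _ _) _; apply: lhom_add; first exact: lhom_refl.
  by apply: lhom_eq => t x /=; rewrite qi loop_base.
have lt_k j : (j < k)%N -> lhom (b j) (b' j).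
  apply: unA; apply: lhom_trans (restr b'); apply: lhom_trans (lhom_sym (restr b)) _.
  exact: lhom_pre.
move=> j; rewrite ltnS leq_eqVlt => /predU1P[->|]; last exact: lt_k.
apply: lhom_diff0; apply: pull_inj.
apply: (lhom_trans (d := loop_add (pull (qP k) (b k)) (loop_opp (pull (qP k) (b' k))))).
  exact: lhom_eq.
apply: lhom_diffr; apply: (lhom_add_cancel (a := loop_sum (fun j => pull (qP j) (b j)) k)).
apply: lhom_trans (lhom_sym (lhom_sum_recr (fun j => pull (qP j) (b j)) k)) _.
apply: lhom_trans hbb _; apply: lhom_trans (lhom_sum_recr _ _) _.
apply: lhom_add; last exact: lhom_refl.
apply: lhom_sym; apply: lhom_sum => l lk; apply: lhom_pre; exact: lt_k.
Qed.

End Step.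
End Split.

(** * Continuity on a CW complex, cell by cell *)

Section CWtop.
Context (R : realType) (X : topologicalType) (S : cw_structure R X).

Definition sumsq n (v : 'rV[R]_n) : R := \sum_i v 0 i ^+ 2.

Lemma sumsq_cts n : continuous (@sumsq n).
Proof.
rewrite /sumsq.
elim: (index_enum _) => [|i r IH].
  rewrite (_ : (fun v : 'rV[R]_n => _) = fun=> 0); first exact: cts_cst.
  by apply/funext => v; rewrite big_nil.
rewrite (_ : (fun v : 'rV[R]_n => _) =
  fun v => v 0 i * v 0 i + \sum_(j <- r) v 0 j ^+ 2); last first.
  by apply/funext => v; rewrite big_cons expr2.
by have h := @coord_continuous R 1 n 0 i; cts.
Qed.

Lemma disc_closed n : closed (@disc R n).
Proof.
apply: (closed_le_fun (f := @sumsq n) (g := fun=> 1)); last exact: cts_cst.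
exact: sumsq_cts.
Qed.

Lemma sphere_disc n : @sphere R n `<=` @disc R n.
Proof. by move=> v; rewrite /sphere /disc /= => ->. Qed.

Lemma open_disc_disc n : @open_disc R n `<=` @disc R n.
Proof. by move=> v; rewrite /open_disc /disc /= => /ltW. Qed.

Lemma disc_cases n v : @disc R n v -> open_disc v \/ sphere v.
Proof. by rewrite /disc /open_disc /sphere /= le_eqVlt => /predU1P[|]; [right|left]. Qed.

Lemma sphere_closed n : closed (@sphere R n).
Proof.
have -> : @sphere R n = @disc R n `&` [set v | 1 <= sumsq v].
  apply/seteqP; split=> v; rewrite /sphere /disc /=.
    by move=> h; split; rewrite /= /sumsq h.
  by case=> h1 h2; apply/eqP; rewrite eq_le h1.
apply: closedI; first exact: disc_closed.
apply: (closed_le_fun (f := fun=> 1) (g := @sumsq n)); first exact: cts_cst.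
exact: sumsq_cts.
Qed.

Lemma disc_compact n : compact (@disc R n).
Proof.
apply: bounded_closed_compact; last exact: disc_closed.
exists 1; split => // M M1 v /= vD.
apply: le_trans (ltW M1); rewrite [leLHS]mx_normrE.
apply: bigmax_le => // -[i j] _ /=; rewrite ord1.
rewrite -(@ler_pXn2r _ 2) ?nnegrE // expr1n real_normK ?num_real //.
apply: le_trans vD; rewrite (bigD1 j) //= lerDl.
by apply: sumr_ge0 => k _; exact: sqr_ge0.
Qed.

Lemma closed_cell_closed e : closed (@closed_cell _ _ S e).
Proof.
apply: compact_closed; first exact: (cw_hausdorff S).
apply: continuous_compact; [exact: char_map_continuous|exact: disc_compact].
Qed.

(** The characteristic map of a cell is a closed map from a compact space onto the
    closed cell. *)
Lemma final_closed_cell e :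
  final_family (fun (_ : unit) (v : set_type (@disc R (@cell_dim _ _ S e))) =>
    exist _ (@char_map _ _ S e (sval v))
      (mem_set (ex_intro2 _ _ (sval v) (set_mem (svalP v)) erefl)) :
    set_type (@closed_cell _ _ S e)).
Proof.
apply: final_open => [[x xC]|B oB].
  have [v Dv vx] := set_mem xC.
  exists tt, (exist _ v (mem_set Dv)).
  by apply/eq_exist_uncurried => /=; exists vx; exact: bool_irrelevance.
have [F cF FB] := set_type_closed (oB tt).
suff -> : B = [set a | (@char_map _ _ S e @` (@disc R _ `&` F)) (sval a)].
  have cK : closed (@char_map _ _ S e @` (@disc R (@cell_dim _ _ S e) `&` F)).
    apply: compact_closed; first exact: (cw_hausdorff S).
    apply: continuous_compact.
      apply: continuous_subspaceW (@char_map_continuous _ _ S e).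
      by move=> ? [].
    apply: subclosed_compact (@disc_compact _) _; last by move=> ? [].
    by apply: closedI => //; exact: disc_closed.
  apply: preimage_closed cK => x _; exact: set_val_cts.
apply/seteqP; split=> -[x xC] /=.
  move=> Bx; have [v Dv vx] := set_mem xC; exists v => //; split => //.
  have /= <- := congr1 (fun G => G (exist _ v (mem_set Dv))) FB.
  by move: Bx; congr B; apply/eq_exist_uncurried => /=;
    exists (esym vx); exact: bool_irrelevance.
move=> [v [Dv Fv] vx]; move: Fv.
have /= <- := congr1 (fun G => G (exist _ v (mem_set Dv))) FB.
by congr B; apply/eq_exist_uncurried => /=; exists vx; exact: bool_irrelevance.
Qed.

Lemma final_cells :
  final_family (fun e (v : set_type (@disc R (@cell_dim _ _ S e))) =>
    @char_map _ _ S e (sval v)).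
Proof.
apply: final_open => [x|B oB].
  have [e [[v ov vx] _]] := @cell_partition _ _ S x.
  by exists e, (exist _ v (mem_set (open_disc_disc ov))).
apply: (@weak_topology _ _ S) => e.
have [F cF FB] := set_type_closed (oB e).
rewrite (_ : _ `&` _ = @disc R _ `&` F); first by apply: closedI => //; exact: disc_closed.
apply/seteqP; split=> v [Dv h]; split=> //.
  by have := congr1 (fun G => G (exist _ v (mem_set Dv))) FB => /= <-.
by have := congr1 (fun G => G (exist _ v (mem_set Dv))) FB => /= ->.
Qed.

(** Induction on the dimension of the cell that contains the point. *)
Lemma cell_ind (P : X -> Prop) :
  (forall e v, open_disc v ->
     (forall w, @sphere R (cell_dim e) w -> P (@char_map _ _ S e w)) ->
     P (@char_map _ _ S e v)) ->
  forall x, P x.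
Proof.
move=> IH.
have main n e v : (@cell_dim _ _ S e < n)%N -> open_disc v -> P (@char_map _ _ S e v).
  elim: n e v => // n IHn e v; rewrite ltnS => e_dim ov; apply: IH => // w sw.
  have [F [_ Fdim FS]] := @closure_finite _ _ S e.
  have [|e' Fe' [w' ow' <-]] := FS (@char_map _ _ S e w); first by exists w.
  by apply: IHn => //; apply: leq_trans (Fdim _ Fe') e_dim.
move=> x; have [e [[v ov <-] _]] := @cell_partition _ _ S x.
exact: (main (cell_dim e).+1).
Qed.

(** To check the continuity of a map on R * X one may assume, on each cell, that it
    is continuous on the boundary sphere: the sphere is covered by finitely many
    closed preimages of closed cells of smaller dimension, on which the map is
    continuous by induction. *)
Lemma cw_cts (T : topologicalType) (g : R -> X -> T) :
  (forall e, {within [set p : R * 'rV[R]_(@cell_dim _ _ S e) | sphere p.2],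
      continuous (fun p => g p.1 (@char_map _ _ S e p.2))} ->
    {within [set p : R * 'rV[R]_(@cell_dim _ _ S e) | disc p.2],
      continuous (fun p => g p.1 (@char_map _ _ S e p.2))}) ->
  continuous (fun p : R * X => g p.1 p.2).
Proof.
move=> IH.
suff main n e : (@cell_dim _ _ S e < n)%N ->
    {within [set p : R * 'rV[R]_(@cell_dim _ _ S e) | disc p.2],
      continuous (fun p => g p.1 (@char_map _ _ S e p.2))}.
  have [_] := final_prodR R final_cells; apply => e /=.
  have := @within_set_type R _ T (@disc R (@cell_dim _ _ S e))
    (fun p => g p.1 (@char_map _ _ S e p.2)).
  by case=> _ h; exact: (h (main (cell_dim e).+1 e (ltnSn _))).
elim: n e => // n IHn e; rewrite ltnS => e_dim; apply: IH.
have [F [Ffin Fdim FS]] := @closure_finite _ _ S e.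
pose B e' := [set p : R * 'rV[R]_(@cell_dim _ _ S e) |
  (@disc R _ `&` @char_map _ _ S e @^-1` @closed_cell _ _ S e') p.2 /\ sphere p.2].
have -> : [set p : R * 'rV[R]_(@cell_dim _ _ S e) | sphere p.2] =
    \bigcup_(e' in F) B e'.
  apply/seteqP; split=> -[s v] /=; last by case=> e' _ [].
  move=> sv; have [|e' Fe' [w ow wv]] := FS (@char_map _ _ S e v); first by exists v.
  exists e' => //; split => //; split; first exact: sphere_disc.
  by exists w => //; exact: open_disc_disc.
have csnd : continuous (@snd R 'rV[R]_(@cell_dim _ _ S e)) by move=> x; exact: cvg_snd.
apply: within_bigcup => // e' Fe'.
  have pc (C : set 'rV[R]_(@cell_dim _ _ S e)) :
      closed C -> closed (@snd R _ @^-1` C).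
    by move=> cC; apply: preimage_closed cC => x _; exact: csnd.
  have cA := within_preim_closed (@disc_closed _) (@char_map_continuous _ _ S e)
    (@closed_cell_closed e').
  exact: (closedI (pc _ cA) (pc _ (@sphere_closed _))).
have Q : {within [set p : R * X | @closed_cell _ _ S e' p.2],
    continuous (fun p : R * X => g p.1 p.2)}.
  apply/within_set_type; have [_] := final_prodR R (final_closed_cell e').
  apply => _ /=.
  have := @within_set_type R _ T (@disc R (@cell_dim _ _ S e'))
    (fun p => g p.1 (@char_map _ _ S e' p.2)).
  by case=> _ h; exact: (h (IHn _ (leq_trans (Fdim _ Fe') e_dim))).
apply: (within_comp_in (f := fun p => (p.1, @char_map _ _ S e p.2)) Q).
  have := @within_set_type R _ (R * X)%type (@disc R (@cell_dim _ _ S e))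
    (fun p => (p.1, @char_map _ _ S e p.2)).
  have cc : continuous (fun v : set_type (@disc R (@cell_dim _ _ S e)) =>
      @char_map _ _ S e (sval v)).
    apply: (within_comp (@char_map_continuous _ _ S e)); first exact: set_val_cts.
    by move=> v; exact: (set_mem (svalP v)).
  case=> h _; apply: continuous_subspaceW (h _); first by move=> p [[]].
  rewrite /=; apply: cts_pair; first by move=> x; exact: cvg_fst.
  have cs : continuous (@snd R (set_type (@disc R (@cell_dim _ _ S e)))).
    by move=> x; exact: cvg_snd.
  exact: (cts_comp cc cs).
by move=> p [[]].
Qed.

(** A closed cell meets finitely many open cells, hence meets a subcomplex in a
    finite union of closed cells. *)
Lemma subcomplex_closed (A : set X) : subcomplex S A -> closed A.
Proof.
move=> [C [AE CA]]; apply: (@weak_topology _ _ S) => e.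
have [F [Ffin Fdim FS]] := @closure_finite _ _ S e.
pose G := [set e' | (e' = e \/ F e') /\ C e'].
have Gfin : finite_set G.
  apply: (@sub_finite_set _ _ (e |` F)); first by move=> e' [[->|]]; [left|right].
  by rewrite finite_setU; split => //; exact: finite_set1.
rewrite (_ : _ `&` _ = @disc R _ `&` @char_map _ _ S e @^-1`
   \bigcup_(e' in G) @closed_cell _ _ S e').
  apply: within_preim_closed; [exact: disc_closed|exact: char_map_continuous|].
  by apply: (@closed_bigcup _ {classic cell S}) => // e1 _; exact: closed_cell_closed.
apply/seteqP; split=> v [Dv h]; split=> //; last first.
  by case: h => e' [_ Ce'] h; exact: (CA _ Ce').
have in_closed e' x : @open_cell _ _ S e' x -> @closed_cell _ _ S e' x.
  by case=> w ow <-; exists w => //; exact: open_disc_disc.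
move: h; rewrite /= AE => -[e1 Ce1 oe1].
suff [e2 e2F oe2] : exists2 e2, e2 = e \/ F e2 & @open_cell _ _ S e2 (@char_map _ _ S e v).
  have [e3 [_ uniq]] := @cell_partition _ _ S (@char_map _ _ S e v).
  exists e2; last exact: in_closed.
  by split=> //; rewrite -(uniq _ oe2) (uniq _ oe1).
have [ov|sv] := disc_cases Dv; first by exists e; [left|exists v].
have [|e2 Fe2 oe2] := FS (@char_map _ _ S e v); first by exists v.
by exists e2 => //; right.
Qed.

End CWtop.

(** * Contracting the disc around an interior point *)

Section Disc.
Context (R : realType) (n : nat).
Implicit Types v w : 'rV[R]_n.

Definition enorm v : R := Num.sqrt (sumsq v).

Lemma sumsq_ge0 v : 0 <= sumsq v.
Proof. by apply: sumr_ge0 => i _; exact: sqr_ge0. Qed.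

Lemma enorm_ge0 v : 0 <= enorm v. Proof. exact: sqrtr_ge0. Qed.

Lemma enorm_cts : continuous enorm.
Proof. by apply: cts_comp; [exact: sqrt_continuous|exact: sumsq_cts]. Qed.

Lemma enorm_sqr v : enorm v ^+ 2 = sumsq v.
Proof. by rewrite sqr_sqrtr // sumsq_ge0. Qed.

Lemma disc_enorm v : disc v <-> enorm v <= 1.
Proof.
rewrite /disc /= -/(sumsq v) -enorm_sqr; split=> h; last by have := enorm_ge0 v; nra.
by rewrite -(@ler_pXn2r _ 2) ?nnegrE ?enorm_ge0 // expr1n.
Qed.

Lemma sphere_enorm v : sphere v <-> enorm v = 1.
Proof.
rewrite /sphere /= -/(sumsq v) -enorm_sqr; split=> [h|->]; last by rewrite expr1n.
by apply/eqP; rewrite -(@eqrXn2 _ 2) ?enorm_ge0 // expr1n h.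
Qed.

Lemma open_disc_enorm v : open_disc v <-> enorm v < 1.
Proof.
rewrite /open_disc /= -/(sumsq v) -enorm_sqr; split=> h; last by have := enorm_ge0 v; nra.
by rewrite -(@ltr_pXn2r _ 2) ?nnegrE ?enorm_ge0 // expr1n.
Qed.

Lemma enormZ a v : 0 <= a -> enorm (a *: v) = a * enorm v.
Proof.
move=> a0; rewrite /enorm.
have -> : sumsq (a *: v) = a ^+ 2 * sumsq v.
  by rewrite /sumsq mulr_sumr; apply: eq_bigr => i _; rewrite mxE exprMn.
by rewrite sqrtrM ?sqr_ge0 // sqrtr_sqr ger0_norm.
Qed.

Lemma open_disc_open : open (@open_disc R n).
Proof.
rewrite -[X in open X]setCK openC.
have -> : ~` @open_disc R n = [set v | 1 <= sumsq v].
  by apply/seteqP; split=> v; rewrite /open_disc /= leNgt => /negP.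
apply: (closed_le_fun (f := fun=> 1) (g := @sumsq R n)); first exact: cts_cst.
exact: sumsq_cts.
Qed.

(** A deformation k of the disc that is the identity near the boundary, together
    with a function m that is 1 on the boundary and such that k has moved v into
    C at every time later than m v.  Here C has at most one point; the last
    clause says that k is trivial if C is empty. *)
Definition disc_contraction (C : set 'rV[R]_n) (k : R -> 'rV[R]_n -> 'rV[R]_n)
    (m : 'rV[R]_n -> R) : Prop :=
  [/\ continuous (fun p : R * 'rV[R]_n => k p.1 p.2), continuous m,
      (forall v, k 0 v = v) /\ (forall v, 0 <= m v <= 1),
      (forall s v, open_disc v -> open_disc (k s v)) &
  [/\ forall v, ~ open_disc v -> m v = 1 /\ forall s, k s v = v,
      forall v, m v = 0 -> C v,
      forall v, C v -> m v = 0 /\ forall s, k s v = v,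
      forall s v, m v < s -> s <= 1 -> C (k s v) &
      C = set0 -> forall v, m v = 1 /\ forall s, k s v = v]].

Lemma contraction0 : disc_contraction set0 (fun _ v => v) (fun=> 1).
Proof.
split=> //; [by move=> x; exact: cvg_snd|exact: cts_cst| |split=> //].
- by split=> // v; rewrite ler01 lexx.
- by move=> v /eqP; rewrite oner_eq0.
- by move=> s v h1 h2; exfalso; lra.
Qed.

(* The deformation multiplies v - v0 by [lam], which decreases to 0 for v in the
   ball of radius eps around v0, and is 1 outside the ball of radius 2 * eps. *)
Section Contr1.
Context (v0 : 'rV[R]_n) (eps : R) (eps0 : 0 < eps).
Context (ball0 : forall v, `|v - v0| < 3 * eps -> open_disc v).

Let a v : R := eps^-1 * `|v - v0|.
Let lam s v : R := Num.max 0 (1 - clamp s * clamp (2 - a v) * (a v)^-1).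
Let k s v : 'rV[R]_n := v0 + lam s v *: (v - v0).
Let m v : R := Num.min 1 (a v).

Let a_cts : continuous a.
Proof.
rewrite /a; apply: ctsM; first exact: cts_cst.
have cs : continuous (fun v => v - v0).
  by apply: cts_addv; [exact: cts_id|exact: cts_cst].
exact: (cts_comp (@norm_continuous _ _) cs).
Qed.

Let a_ge0 v : 0 <= a v.
Proof. by rewrite /a mulr_ge0 // ?invr_ge0 ?normr_ge0 // ltW. Qed.

Let aE v : `|v - v0| = eps * a v.
Proof. by rewrite /a mulVKf // gt_eqF. Qed.

Let lam_ge0 s v : 0 <= lam s v.
Proof. by rewrite /lam le_max lexx. Qed.

Let lam_le1 s v : lam s v <= 1.
Proof.
rewrite /lam ge_max ler01 /= gerBl.
by rewrite !mulr_ge0 ?clamp_ge0 // invr_ge0.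
Qed.

Let lam_far s v : 2 <= a v -> lam s v = 1.
Proof.
move=> h; rewrite /lam [clamp (2 - _)]clamp_le0 ?mulr0 ?mul0r ?subr0; last by lra.
by apply/max_idPr; exact: ler01.
Qed.

Let k_far s v : 2 <= a v -> k s v = v.
Proof. by move=> h; rewrite /k lam_far // scale1r addrC subrK. Qed.

Let k_dist s v : `|k s v - v0| <= `|v - v0|.
Proof.
rewrite /k addrC addKr normrZ ger0_norm //.
by rewrite ler_piMl // normr_ge0.
Qed.

Let out_far v : ~ open_disc v -> 3 <= a v.
Proof.
move=> h; rewrite leNgt; apply/negP => av; apply: h; apply: ball0.
by rewrite aE mulrC ltr_pM2r.
Qed.

Let k_cts : continuous (fun p : R * 'rV[R]_n => k p.1 p.2).
Proof.
(* At v0 the factor lam is not continuous, but it is bounded by 1. *)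
move=> [s v]; have [->|vv0] := eqVneq v v0.
  have k0 : k s v0 = v0 by rewrite /k subrr scaler0 addr0.
  apply/cvgrPdist_lt => /= e e0; rewrite k0.
  exists (setT, ball v0 e); first by split => /=; [exact: filterT|exact: nbhsx_ballx].
  move=> [s' v'] /= [_]; rewrite -ball_normE /= => h.
  by rewrite distrC; apply: le_lt_trans (k_dist _ _) _; rewrite distrC.
have csnd : continuous (fun p : R * 'rV[R]_n => p.2) by move=> x; exact: cvg_snd.
have av : a v != 0 by rewrite /a mulf_neq0 ?invr_eq0 ?gt_eqF // normr_gt0 subr_eq0.
apply: (@cvgD _ _ _ (nbhs (s, v)) _ (fun=> v0)); first exact: (@cts_cst _ _ v0 (s, v)).
apply: (@cvgZ _ _ _ (nbhs (s, v)) _ (fun p => lam p.1 p.2) (fun p => p.2 - v0)); last first.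
  have cs : continuous (fun p : R * 'rV[R]_n => p.2 - v0).
    by apply: cts_addv; [exact: csnd|exact: cts_cst].
  exact: cs.
pose F (p : R * 'rV[R]_n) : R := clamp p.1 * clamp (2 - a p.2).
have hF : continuous F by rewrite /F; cts.
have hA : {for (s, v), continuous (fun p : R * 'rV[R]_n => a p.2)}.
  exact: (cts_comp a_cts csnd).
have hV : {for (s, v), continuous (fun p : R * 'rV[R]_n => (a p.2)^-1)}.
  exact: cvgV.
have hM : {for (s, v), continuous (fun p : R * 'rV[R]_n => F p * (a p.2)^-1)}.
  by apply: cvgM => //; exact: hF.
have hN : {for (s, v), continuous (fun p : R * 'rV[R]_n => - (F p * (a p.2)^-1))}.
  exact: cvgN.
have h1 : {for (s, v), continuous (fun p : R * 'rV[R]_n => 1 - F p * (a p.2)^-1)}.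
  by apply: cvgD => //; exact: (@cts_cst _ R (1 : R) (s, v)).
have h0 : {for (s, v), continuous (fun p : R * 'rV[R]_n => (0 : R))}.
  exact: (@cts_cst _ R (0 : R) (s, v)).
exact: (continuous_max h0 h1).
Qed.

Lemma contraction1 : disc_contraction [set v0] k m.
Proof.
have kv0 s : k s v0 = v0 by rewrite /k subrr scaler0 addr0.
have av0 : a v0 = 0 by rewrite /a subrr normr0 mulr0.
split; [exact: k_cts|by rewrite /m; cts|split=> v| |split].
- rewrite /k /lam clamp_le0 // !mul0r subr0 (max_idPr _) ?ler01 // scale1r.
  by rewrite addrC subrK.
- by rewrite /m le_min ler01 a_ge0 ge_min lexx.
- move=> s v ov; have [h|h] := leP 2 (a v); first by rewrite k_far.
  apply: ball0; apply: le_lt_trans (k_dist _ _) _; rewrite aE.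
  by rewrite mulrC ltr_pM2r //; lra.
- move=> v /out_far h; split; first by apply/min_idPl; lra.
  by move=> s; apply: k_far; lra.
- move=> v; rewrite /m; case: leP => [_ /eqP|_ av]; first by rewrite oner_eq0.
  by apply/eqP; rewrite -subr_eq0 -normr_eq0 aE av mulr0.
- by move=> v ->; split; [rewrite /m av0 (min_idPr _) ?ler01|exact: kv0].
- move=> s v; rewrite /m gt_min => /orP[h1 h2|h1 s1]; first by exfalso; lra.
  have := a_ge0 v; rewrite le_eqVlt => /predU1P[av|av]; rewrite /k.
    have -> : v = v0 by apply/eqP; rewrite -subr_eq0 -normr_eq0 aE -av mulr0.
    by rewrite /= subrr scaler0 addr0.
  suff -> : lam s v = 0 by rewrite scale0r addr0.
  apply/max_idPl; rewrite [clamp (2 - _)]clamp_ge1; last by lra.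
  rewrite mulr1 clamp_id; last by apply/andP; split; lra.
  by rewrite subr_le0 ler_pdivlMr // mul1r ltW.
- by move=> /seteqP [/(_ v0 erefl)].
Qed.

End Contr1.

Lemma contraction_ex (C : set 'rV[R]_n) : C `<=` @open_disc R n ->
  (forall v w, C v -> C w -> v = w) -> exists k m, disc_contraction C k m.
Proof.
move=> Co C1; have [[v0 Cv0]|nC] := pselect (exists v, C v); last first.
  exists (fun _ v => v), (fun=> 1); rewrite (_ : C = set0); first exact: contraction0.
  by apply/seteqP; split=> // v Cv; case: nC; exists v.
have CE : C = [set v0] by apply/seteqP; split=> v; [move=> /C1; exact|move=> ->].
have /nbhs_ballP[d /= d0 dC] : nbhs v0 (@open_disc R n).
  by apply: open_nbhs_nbhs; split; [exact: open_disc_open|exact: Co].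
have e0 : 0 < d / 3 by rewrite divr_gt0.
rewrite CE; do 2 eexists; apply: (contraction1 e0) => v h; apply: dC.
by rewrite -ball_normE /= distrC; apply: lt_le_trans h _; lra.
Qed.

End Disc.

(** * Deforming a CW complex towards its base-point *)

Ltac clear_nonarith := repeat match goal with
  | H : forall _, _ |- _ => clear H | H : _ = point |- _ => clear H end.
Ltac arith_lra := clear_nonarith; lra.
Ltac arith_nra := clear_nonarith; nra.

Section CellRec.
Context (R : realType) (X : topologicalType) (S : cw_structure R X).

Local Notation dim e := (@cell_dim _ _ S e).
Local Notation "'Phi' e" := (@char_map _ _ S e) (at level 10, e at next level).

Lemma cell_pos_ex x : exists p : {e : cell S & 'rV[R]_(dim e)},
  open_disc (projT2 p) /\ Phi _ (projT2 p) = x.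
Proof.
by have [e [[v ov vx] _]] := @cell_partition _ _ S x; exists (existT _ e v).
Qed.

Lemma cell_pos_uniq (e e' : cell S) v v' : open_disc v -> open_disc v' ->
  Phi e v = Phi e' v' ->
  existT (fun e => 'rV[R]_(dim e)) e v = existT (fun e => 'rV[R]_(dim e)) e' v'.
Proof.
move=> ov ov' vv'.
have [e1 [_ uniq]] := @cell_partition _ _ S (Phi e v).
have h1 : e1 = e by apply: uniq; exists v.
have h2 : e1 = e' by apply: uniq; exists v'.
have ee' : e = e' by rewrite -h1.
move: v' ov' vv'; rewrite -ee' => v' ov' vv'; congr (existT _ _ _).
by apply: (@char_map_inj _ _ S e) => //; rewrite inE.
Qed.

(** Functions on a CW complex can be defined by recursion on cells, the value on an
    open cell depending on the values on its boundary. *)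
Lemma cell_rec (Y : Type) (y0 : Y)
    (G : forall e, (X -> Y) -> 'rV[R]_(dim e) -> Y) :
  (forall e h h' v, open_disc v ->
     (forall w, @sphere R (dim e) w -> h (Phi e w) = h' (Phi e w)) ->
     G e h v = G e h' v) ->
  exists h : X -> Y, forall e v, open_disc v -> h (Phi e v) = G e h v.
Proof.
move=> Gext.
have /choice[pos posP] := cell_pos_ex.
pose r := fix r (n : nat) : X -> Y := if n is m.+1
  then fun x => G (projT1 (pos x)) (r m) (projT2 (pos x)) else fun=> y0.
have rE n e v : open_disc v -> r n.+1 (Phi e v) = G e (r n) v.
  move=> ov; have [op pE] := posP (Phi e v).
  have pe := cell_pos_uniq op ov pE.
  exact: (congr1 (fun p => G (projT1 p) (r n) (projT2 p)) pe).
have fuel e v n m : open_disc v -> (dim e < n)%N -> (dim e < m)%N ->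
    r n (Phi e v) = r m (Phi e v).
  elim: n m e v => // n IHn [//|m] e v ov; rewrite !ltnS => e_dim em.
  rewrite !rE //; apply: Gext => // w sw.
  have [F [_ Fdim FS]] := @closure_finite _ _ S e.
  have [|e' Fe' [w' ow' <-]] := FS (Phi e w); first by exists w.
  by have lt := Fdim _ Fe'; apply: IHn => //; exact: leq_trans lt _.
pose h x := r (dim (projT1 (pos x))).+1 x.
have hE e v n : open_disc v -> (dim e < n)%N -> h (Phi e v) = r n (Phi e v).
  move=> ov e_dim; have [op pE] := posP (Phi e v).
  have pe := cell_pos_uniq op ov pE; rewrite /h.
  have -> : dim (projT1 (pos (Phi e v))) = dim e.
    exact: (congr1 (fun p => dim (projT1 p)) pe).
  exact: fuel.
exists h => e v ov; rewrite (hE e v (dim e).+1) // rE //; apply: Gext => // w sw.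
have [F [_ Fdim FS]] := @closure_finite _ _ S e.
have [|e' Fe' [w' ow' <-]] := FS (Phi e w); first by exists w.
by rewrite (hE e' w' (dim e)) //; exact: Fdim.
Qed.

End CellRec.

Section CWContract.
Context (R : realType) (X : ptopologicalType) (S : cw_structure R X).

Local Notation dim e := (@cell_dim _ _ S e).
Local Notation "'Phi' e" := (@char_map _ _ S e) (at level 10, e at next level).

(** A deformation of X towards its base-point; [point] has been reached at every
    time later than u x. *)
Definition contracts (u : X -> R) (d : R -> X -> X) : Prop :=
  [/\ continuous u, continuous (fun p : R * X => d p.1 p.2),
      (forall x, 0 <= u x) /\ (forall x, u x = 0 <-> x = point),
      (forall x, d 0 x = x) /\ (forall s, d s point = point) &
      forall s x, u x < s -> s <= 1 -> d s x = point].

(** Let e0 be the cell of the base-point, n0 its dimension.  The deformation is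
    [disc_contraction] on the cells of dimension at most n0, hence trivial on all
    of them but e0.  On a cell of larger dimension the cylinder over the disc is
    projected from the point of height 2 above its centre onto the union of its
    bottom and of its side.  The point (s, v) goes to the bottom if
    2 |v| <= 2 - s, where the deformation is the identity, and else to the point
    of height 2 - (2 - s) / |v| over v / |v| on the side, where it is known.
    This height exceeds u (v / |v|) if and only if s exceeds
    2 - |v| (2 - u (v / |v|)), which gives u on the cell. *)
Lemma cw_contracts : exists u d, contracts u d /\
  forall A, subcomplex S A -> forall s x, A x -> A (d s x).
Proof.
have [e0 [[v0 ov0 v0E] uniq0]] := @cell_partition _ _ S point.
pose n0 := dim e0.
pose C e := [set v | @open_disc R (dim e) v /\ Phi e v = point].
have C_sub e : C e `<=` @open_disc R (dim e) by move=> v [].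
have C_uniq e v w : C e v -> C e w -> v = w.
  move=> [ov vE] [ow wE]; apply: (@char_map_inj _ _ S e); rewrite ?inE //.
  by rewrite vE.
have kmex e : {km : (R -> 'rV[R]_(dim e) -> 'rV[R]_(dim e)) * ('rV[R]_(dim e) -> R) |
    disc_contraction (C e) km.1 km.2}.
  apply: cid; have [k [m h]] := contraction_ex (C_sub e) (C_uniq e).
  by exists (k, m).
pose k e := (sval (kmex e)).1; pose m e := (sval (kmex e)).2.
have kmP e : disc_contraction (C e) (k e) (m e) := svalP (kmex e).
have C0 e : e <> e0 -> C e = set0.
  move=> ee0; apply/seteqP; split=> // v [ov vE]; apply: ee0.
  by symmetry; apply: uniq0; exists v.
have openP n (v : 'rV[R]_n) : disc v -> open_disc v \/ sphere v by exact: disc_cases.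
have snO n (v : 'rV[R]_n) : sphere v -> ~ open_disc v.
  by move=> /sphere_enorm sv /open_disc_enorm; rewrite sv ltxx.
have unitv n (v : 'rV[R]_n) : 1 < 2 * enorm v -> sphere ((enorm v)^-1 *: v).
  move=> h; apply/sphere_enorm; rewrite enormZ ?invr_ge0 ?enorm_ge0 //.
  by rewrite mulVf // gt_eqF //; lra.
pose Gu e (h : X -> R) (v : 'rV[R]_(dim e)) : R :=
  if (dim e <= n0)%N then m e v else
  if 2 * enorm v <= 1 then 1
  else Num.min 1 (2 - enorm v * (2 - h (Phi e ((enorm v)^-1 *: v)))).
have [u uE] : exists u : X -> R, forall e v, open_disc v -> u (Phi e v) = Gu e u v.
  apply: (cell_rec 0) => e h h' v ov hh'; rewrite /Gu; case: ifP => // _.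
  by case: ifPn => // /negP en1; rewrite hh' //; apply: unitv; lra.
have u01 x : 0 <= u x <= 1.
  move: x; apply: (@cell_ind _ _ S) => e v ov IH; rewrite uE // /Gu.
  case: ifP => _; first by case: (kmP e) => _ _ [_ +] _ _; exact.
  case: ifPn => [_|/negP en1]; first by rewrite ler01 lexx.
  have /IH/andP[h0 h1] : sphere ((enorm v)^-1 *: v) by apply: unitv; lra.
  move/open_disc_enorm: ov => ov; rewrite ge_min lexx andbT le_min ler01 /=; nra.
(* The boundary of a cell of dimension at most n0 is away from e0. *)
have low e w : (dim e <= n0)%N -> @sphere R (dim e) w ->
    exists e' w', [/\ (dim e' < n0)%N, open_disc w', C e' = set0 & Phi e w = Phi e' w'].
  move=> e_dim sw; have [F [_ Fdim FS]] := @closure_finite _ _ S e.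
  have [|e' Fe' [w' ow' w'E]] := FS (Phi e w); first by exists w.
  exists e', w'; split=> //; first exact: leq_trans (Fdim _ Fe') e_dim.
  apply: C0 => ee'; have := leq_trans (Fdim _ Fe') e_dim.
  by rewrite ee' ltnn.
(* The formula for u is valid on the closed discs too. *)
have uE' e v : disc v -> u (Phi e v) = Gu e u v.
  move=> /openP[|sv]; first exact: uE.
  rewrite /Gu; case: ifPn => [e_dim|_].
    have [e' [w' [e'n ow' C'0 ->]]] := low _ _ e_dim sv.
    rewrite uE // /Gu ifT; last exact: ltnW.
    case: (kmP e') => _ _ _ _ [_ _ _ _ /(_ C'0 w')[-> _]].
    by case: (kmP e) => _ _ _ _ [/(_ v (snO _ _ sv))[-> _]].
  have /sphere_enorm -> := sv; rewrite ifF; last by apply/negP; lra.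
  rewrite invr1 scale1r mul1r opprB addrC subrK.
  by have /andP[_ h1] := u01 (Phi e v); symmetry; exact/min_idPr.
have u_cts : continuous u.
  have ci : continuous (fun v : R => v) by exact: cts_id.
  suff : continuous (fun p : R * X => u p.2).
    move=> h; have cp : continuous (fun x : X => ((0 : R), x)) by cts.
    exact: (cts_comp h cp).
  apply: (@cw_cts _ _ S _ (fun _ x => u x)) => e IH.
  apply: (within_eq (f := fun p => Gu e u p.2)).
    by move=> p Dp; rewrite uE'.
  rewrite /Gu; case: (boolP (dim e <= n0)%N) => le_e.
    apply: continuous_subspaceT; have [_ cm _ _ _] := kmP e.
    by apply: cts_comp => // x; exact: cvg_snd.
  have cen : continuous (fun p : R * 'rV[R]_(dim e) => enorm p.2).
    by apply: cts_comp; [exact: enorm_cts|move=> x; exact: cvg_snd].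
  pose D1 := [set p : R * 'rV[R]_(dim e) | 2 * enorm p.2 <= 1].
  pose D2 := [set p : R * 'rV[R]_(dim e) | 1 <= 2 * enorm p.2] `&` [set p | enorm p.2 <= 1].
  apply: (@continuous_subspaceW _ _ _ (D1 `|` D2)).
    move=> p /= /disc_enorm pD; have [h|h] := leP (2 * enorm p.2) 1; [by left|right].
    by split => //=; exact: ltW.
  have c2en : continuous (fun p : R * 'rV[R]_(dim e) => 2 * enorm p.2) by cts.
  apply: withinU_continuous.
  - by apply: closed_le_fun => //; exact: cts_cst.
  - apply: closedI; apply: closed_le_fun => //; exact: cts_cst.
  - apply: (@within_eq _ _ D1 (fun=> (1 : R))); last by apply: continuous_subspaceT => x; exact: cts_cst.
    by move=> p; rewrite /D1 /= => ->.
  (* The inverse of the norm on D2, continuous everywhere. *)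
  pose r (p : R * 'rV[R]_(dim e)) := (Num.max (enorm p.2) 2^-1)^-1.
  have rc : continuous r.
    move=> p; apply: cvgV; last first.
      have h : continuous (fun p : R * 'rV[R]_(dim e) => Num.max (enorm p.2) 2^-1) by cts.
      exact: h.
    by rewrite gt_eqF // lt_max invr_gt0 ltr0n orbT.
  have rE p : D2 p -> r p = (enorm p.2)^-1.
    by move=> [/= h _]; rewrite /r (max_idPl _) //; lra.
  apply: (within_eq (f := fun p =>
      Num.min 1 (2 - enorm p.2 * (2 - u (Phi e (r p *: p.2)))))).
    move=> p D2p; rewrite rE //; case: ifP => // h.
    case: D2p => /= h1 h2; apply/min_idPl.
    have /andP[u0 u1] := u01 (Phi e ((enorm p.2)^-1 *: p.2)); nra.
  have cu : {within D2, continuous (fun p => u (Phi e (r p *: p.2)))}.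
    apply: (within_comp_in (f := fun p : R * 'rV[R]_(dim e) => (p.1, r p *: p.2)) IH).
      apply: continuous_subspaceT; apply: cts_pair; first by move=> x; exact: cvg_fst.
      by apply: cts_scalev => // x; exact: cvg_snd.
    move=> p D2p /=; rewrite rE //; apply/sphere_enorm.
    have [/= h1 h2] := D2p.
    by rewrite enormZ ?invr_ge0 ?enorm_ge0 // mulVf // gt_eqF //; lra.
  have cF : continuous (fun q : R * R => Num.min 1 (2 - q.1 * (2 - q.2))) by cts.
  have cfst : {within D2, continuous (fun p => enorm p.2)} by apply: continuous_subspaceT.
  exact: (within_post cF (within_pair cfst cu)).
pose Gd e (h : X -> R -> X) (v : 'rV[R]_(dim e)) (s : R) : X :=
  if (dim e <= n0)%N then Phi e (k e (clamp s) v) else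
  if 2 * enorm v <= 2 - clamp s then Phi e ((2 / (2 - clamp s)) *: v)
  else h (Phi e ((enorm v)^-1 *: v)) (2 - (2 - clamp s) / enorm v).
have cl01 (s : R) : 0 <= clamp s <= 1 by rewrite clamp_ge0 clamp_le1.
have [d dE] : exists d : X -> R -> X, forall e v, open_disc v -> d (Phi e v) = Gd e d v.
  apply: (cell_rec (fun=> point)) => e h h' v ov hh'; apply/funext => s.
  rewrite /Gd; case: ifP => // _; case: ifPn => // /negP en1; rewrite hh' //.
  by apply: unitv; have /andP[s0 s1] := cl01 s; lra.
have clampK (s : R) : clamp (clamp s) = clamp s by rewrite clamp_id.
have d_clamp x s : d x (clamp s) = d x s.
  move: x s; apply: (@cell_ind _ _ S) => e v ov IH s.
  by rewrite dE // /Gd clampK.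
have d0 x : d x 0 = x.
  move: x; apply: (@cell_ind _ _ S) => e v ov _; rewrite dE // /Gd clamp_le0 //.
  case: ifP => _; first by case: (kmP e) => _ _ [-> _].
  move/open_disc_enorm: ov => ov; rewrite ifT; last by lra.
  by rewrite subr0 divff ?scale1r // pnatr_eq0.
have dE' e v : disc v -> d (Phi e v) = Gd e d v.
  move=> /openP[|sv]; first exact: dE.
  apply/funext => s; rewrite /Gd; case: ifPn => [e_dim|_].
    case: (kmP e) => _ _ _ _ [/(_ v (snO _ _ sv))[_ ->] _ _ _ _].
    have [e' [w' [e'n ow' C'0 ->]]] := low _ _ e_dim sv.
    rewrite dE // /Gd ifT; last exact: ltnW.
    by case: (kmP e') => _ _ _ _ [_ _ _ _ /(_ C'0 w')[_ ->]].
  have /sphere_enorm -> := sv; have /andP[s0 s1] := cl01 s.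
  case: ifPn => [h|_].
    have cs0 : clamp s = 0 by lra.
    by rewrite -d_clamp cs0 d0 subr0 divff ?scale1r // pnatr_eq0.
  by rewrite invr1 scale1r mulr1 opprB addrC subrK d_clamp.
have d_cts : continuous (fun p : R * X => d p.2 p.1).
  apply: (@cw_cts _ _ S _ (fun s x => d x s)) => e IH.
  apply: (within_eq (f := fun p => Gd e d p.2 p.1)).
    by move=> p Dp; rewrite dE'.
  have cfst : continuous (fun p : R * 'rV[R]_(dim e) => p.1) by move=> x; exact: cvg_fst.
  have csnd : continuous (fun p : R * 'rV[R]_(dim e) => p.2) by move=> x; exact: cvg_snd.
  have cPhi (f : R * 'rV[R]_(dim e) -> 'rV[R]_(dim e)) (D : set (R * 'rV[R]_(dim e))) :
     continuous f -> (forall p, D p -> disc (f p)) ->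
     {within D, continuous (fun p => Phi e (f p))}.
    move=> cf fD; apply: (within_comp_in (@char_map_continuous _ _ S e)) => //.
    exact: continuous_subspaceT.
  rewrite /Gd; case: (boolP (dim e <= n0)%N) => le_e.
    have [ck _ _ ko [kn _ _ _ _]] := kmP e.
    apply: (cPhi (fun p => k e (clamp p.1) p.2) [set p | disc p.2]).
      by apply: (cts_comp2 (F := k e) (f := fun p => clamp p.1) (g := fun p => p.2) ck); cts.
    move=> p /= Dp; case: (openP _ _ Dp) => [op|/snO np]; first by apply: open_disc_disc; exact: ko.
    by have [_ ->] := kn _ np.
  have cen : continuous (fun p : R * 'rV[R]_(dim e) => enorm p.2).
    by apply: cts_comp csnd; exact: enorm_cts.
  pose D1 := [set p : R * 'rV[R]_(dim e) | 2 * enorm p.2 <= 2 - clamp p.1].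
  pose D2 := [set p : R * 'rV[R]_(dim e) | 2 - clamp p.1 <= 2 * enorm p.2] `&`
             [set p | enorm p.2 <= 1].
  apply: (@continuous_subspaceW _ _ _ (D1 `|` D2)).
    move=> p /= /disc_enorm pD.
    have [h|h] := leP (2 * enorm p.2) (2 - clamp p.1); [by left|right].
    by split => //=; exact: ltW.
  have c2en : continuous (fun p : R * 'rV[R]_(dim e) => 2 * enorm p.2) by cts.
  have c2s : continuous (fun p : R * 'rV[R]_(dim e) => 2 - clamp p.1) by cts.
  have s2 (p : R * 'rV[R]_(dim e)) : 1 <= 2 - clamp p.1.
    by have /andP[s0 s1] := cl01 p.1; lra.
  apply: withinU_continuous.
  - exact: closed_le_fun.
  - apply: closedI; apply: closed_le_fun => //; exact: cts_cst.
  - apply: (@within_eq _ _ D1 (fun p => Phi e ((2 / (2 - clamp p.1)) *: p.2))).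
      by move=> p; rewrite /D1 /= => ->.
    apply: cPhi.
      apply: cts_scalev => //; apply: ctsM; first exact: cts_cst.
      by move=> p; apply: cvgV; [rewrite gt_eqF //; have := s2 p; lra|exact: c2s].
    move=> p; rewrite /D1 /= => h; apply/disc_enorm.
    have := s2 p => h2; rewrite enormZ ?divr_ge0 //; last by lra.
    by rewrite mulrAC ler_pdivrMr; lra.
  (* The inverse of the norm on D2, continuous everywhere. *)
  pose r (p : R * 'rV[R]_(dim e)) := (Num.max (enorm p.2) 2^-1)^-1.
  have rc : continuous r.
    move=> p; apply: cvgV; last first.
      have h : continuous (fun p : R * 'rV[R]_(dim e) => Num.max (enorm p.2) 2^-1) by cts.
      exact: h.
    by rewrite gt_eqF // lt_max invr_gt0 ltr0n orbT.
  have rE p : D2 p -> r p = (enorm p.2)^-1.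
    by move=> [/= h _]; rewrite /r (max_idPl _) //; have := s2 p; lra.
  have rS p : D2 p -> sphere (r p *: p.2).
    move=> D2p /=; rewrite rE //; apply/sphere_enorm.
    have [/= h1 h2] := D2p; have := s2 p => h3.
    by rewrite enormZ ?invr_ge0 ?enorm_ge0 // mulVf // gt_eqF //; lra.
  apply: (@within_eq _ _ D2 (fun p => d (Phi e (r p *: p.2)) (2 - (2 - clamp p.1) * r p))).
    move=> p D2p; have rSp := rS p D2p; rewrite rE // in rSp *.
    case: ifP => // h; case: D2p => /= h1 h2.
    have hE : 2 - clamp p.1 = 2 * enorm p.2 by apply/eqP; rewrite eq_le h h1.
    have en0 : enorm p.2 != 0 by rewrite gt_eqF //; have := s2 p; lra.
    by rewrite hE mulfK // subrr d0 invfM mulrA divff ?mul1r // pnatr_eq0.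
  apply: (within_comp_in (f := fun p : R * 'rV[R]_(dim e) =>
     (2 - (2 - clamp p.1) * r p, r p *: p.2)) IH) => //.
  apply: continuous_subspaceT; apply: cts_pair; first by cts.
  exact: cts_scalev.
have C00 : C e0 v0 by [].
exists u, (fun s x => d x s); split.
  split=> //; [split=> x| |].
  - by have /andP[] := u01 x.
  - split=> [|->]; last first.
      rewrite -v0E uE // /Gu leqnn.
      by case: (kmP e0) => _ _ _ _ [_ _ /(_ _ C00)[-> _]].
    move: x; apply: (@cell_ind _ _ S) => e v ov IH; rewrite uE // /Gu.
    case: ifP => _.
      by case: (kmP e) => _ _ _ _ [_ /(_ v) h _ _ _] /h[].
    case: ifPn => [_ /eqP|/negP en1]; first by rewrite oner_eq0.
    move/open_disc_enorm: ov => ov.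
    have /andP[u0 u1] := u01 (Phi e ((enorm v)^-1 *: v)).
    have : 0 < Num.min 1 (2 - enorm v * (2 - u (Phi e ((enorm v)^-1 *: v)))).
      move: (enorm v) (u _) ov u0 u1 (enorm_ge0 v); clear => r w ov u0 u1 r0.
      by rewrite lt_min ltr01 /=; arith_nra.
    by move=> /gt_eqF + /eqP => ->.
  - split=> [x|s]; first exact: d0.
    rewrite -v0E dE // /Gd leqnn.
    by case: (kmP e0) => _ _ _ _ [_ _ /(_ _ C00)[_ ->]].
  - move=> s x; move: x s; apply: (@cell_ind _ _ S) => e v ov IH s.
    rewrite uE // dE // /Gu /Gd; case: ifP => le_e.
      move=> h1 h2; rewrite clamp_id; last first.
        by case: (kmP e) => _ _ [_ /(_ v)/andP[m0 _]] _ _; apply/andP; split; arith_lra.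
      by case: (kmP e) => _ _ _ _ [_ _ _ /(_ s v h1 h2)[]].
    move=> h1 h2; have s0 : 0 <= s.
      apply: le_trans (ltW h1); case: ifPn => [_|/negP en1]; first exact: ler01.
      move/open_disc_enorm: ov => ov.
      have /andP[u0 u1] := u01 (Phi e ((enorm v)^-1 *: v)).
      by rewrite le_min ler01 /=; arith_nra.
    have cs : clamp s = s by apply: clamp_id; rewrite s0.
    move: h1; case: ifPn => [_|/negP en1]; first by move=> ?; exfalso; arith_lra.
    rewrite gt_min => /orP[?|h1]; first by exfalso; arith_lra.
    move/open_disc_enorm: ov => ov; rewrite cs.
    have sw : sphere ((enorm v)^-1 *: v) by apply: unitv; arith_lra.
    have /andP[u0 u1] := u01 (Phi e ((enorm v)^-1 *: v)).
    have en0 : 0 < enorm v by arith_lra.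
    rewrite ifF; last by apply/negP => h3; arith_nra.
    apply: IH => //.
      rewrite ltrBrDr -ltrBrDl ltr_pdivrMr //; arith_lra.
    by rewrite lerBlDr -lerBlDl ler_pdivlMr //; arith_lra.
move=> A [Cs [AE CA]] s x; move: x s; apply: (@cell_ind _ _ S) => e v ov IH s Av.
have Ce : Cs e.
  move: Av; rewrite AE => -[e' Ce' oe'].
  have [e3 [_ uniq]] := @cell_partition _ _ S (Phi e v).
  have oe : @open_cell _ _ S e (Phi e v) by exists v.
  by have := uniq _ oe; rewrite (uniq _ oe') => <-.
have DA w : disc w -> A (Phi e w) by move=> Dw; apply: (CA _ Ce); exists w.
rewrite dE // /Gd; case: ifP => le_e.
  apply: DA; apply: open_disc_disc.
  by case: (kmP e) => _ _ _ + _; exact.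
have /andP[s0 s1] := cl01 s.
case: ifPn => [h|/negP h].
  apply: DA; apply/disc_enorm; rewrite enormZ ?divr_ge0 //; last by arith_lra.
  by rewrite mulrAC ler_pdivrMr; arith_lra.
have sw : sphere ((enorm v)^-1 *: v) by apply: unitv; arith_lra.
by apply: IH => //; apply: DA; exact: sphere_disc.
Qed.

End CWContract.

(** * Suspensions and wedges *)

Section Susp.
Context (R : realType).

Lemma loop_clamp (X : topologicalType) (T : ptopologicalType) (A : set X)
    (c : loop R T A) t x : c (clamp t) x = c t x.
Proof.
have [t0|t0] := leP t 0; first by rewrite clamp_le0 // !loop_le0.
have [t1|t1] := leP 1 t; first by rewrite clamp_ge1 // !loop_ge1.
by rewrite clamp_id // !ltW.
Qed.

Lemma clampI_sval (t : unitI R) : clampI (sval t) = t.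
Proof.
case: t => t tI; apply/eq_exist_uncurried => /=.
have E : clamp t = t by apply: clamp_id; move: tI; rewrite inE /= in_itv.
by exists E; exact: bool_irrelevance.
Qed.

Lemma sval_unitI_cts : continuous (fun t : unitI R => sval t).
Proof. exact: initial_continuous. Qed.

Lemma clampI_cts : continuous (@clampI R).
Proof.
have cc : continuous (fun t : R => clamp t) by cts.
by apply: continuous_comp_initial; exact: cc.
Qed.

Section One.
Context (X T : ptopologicalType).

Lemma susp_ptP (s : susp R X) : exists t x, s = susp_pt t x.
Proof. by exists (repr s).1, (repr s).2; rewrite /susp_pt -surjective_pairing reprK. Qed.

Lemma susp_ptP0 (t : unitI R) (x : X) :
  sval t = 0 \/ sval t = 1 \/ x = point -> susp_pt t x = point.
Proof.
move=> h; apply/collapseP; right; split; last exact: Or33.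
by case: h => [?|[?|?]]; [exact: Or31|exact: Or32|exact: Or33].
Qed.

Lemma susp_pt_cts : continuous (fun p : unitI R * X => susp_pt p.1 p.2).
Proof.
have -> : (fun p : unitI R * X => susp_pt p.1 p.2) =
    \pi_(collapse (@susp_base R X)) by apply/funext => -[].
exact: (@pi_continuous _ {eq_quot (collapse_rel (@susp_base R X))}).
Qed.

Lemma final_susp : final_family (fun (_ : unit) (p : unitI R * X) => susp_pt p.1 p.2).
Proof.
split=> [s|W g gc].
  by have [t [x ->]] := susp_ptP s; exists tt, (t, x).
apply/quotient_continuous; rewrite (_ : _ \o _ = fun p => g (susp_pt p.1 p.2)).
  exact: (gc tt).
by apply/funext => -[].
Qed.

End One.

Definition susp_at (X : ptopologicalType) (t : R) (x : X) : susp R X :=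
  susp_pt (clampI t) x.

Section Hat.
Context (X T : ptopologicalType).

Lemma susp_loop_cts : continuous (fun p : R * X => susp_at p.1 p.2).
Proof.
have h := @susp_pt_cts X; have cI := clampI_cts.
have h1 : continuous (fun p : R * X => clampI p.1) by cts.
have h2 : continuous (fun p : R * X => p.2) by cts.
exact: (cts_comp2 h h1 h2).
Qed.

Lemma susp_loop_out t (x : X) : t <= 0 \/ 1 <= t -> susp_at t x = point.
Proof.
case=> h; apply: susp_ptP0; [left|right; left] => /=.
  exact: clamp_le0.
exact: clamp_ge1.
Qed.

Lemma susp_loop_base t (x : X) : [set point] x -> susp_at t x = point.
Proof. by move=> ->; apply: susp_ptP0; right; right. Qed.

(** The identity of the suspension. *)
Definition susp_loop : loop R (susp R X) [set (point : X)] := Loop susp_loop_cts susp_loop_out susp_loop_base.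

(** The map on the suspension that corresponds to a family of loops; see [hatE]. *)
Definition hat (c : R -> X -> T) (s : susp R X) : T :=
  c (sval (repr s).1) (repr s).2.

Lemma hatE (c : loop R T [set (point : X)]) t x :
  hat c (susp_pt t x) = c (sval t) x.
Proof.
rewrite /hat /susp_pt; case: piP => -[t' x'] /= /collapseP[[<- <-]//|].
have b (p : unitI R * X) : susp_base p -> c (sval p.1) p.2 = point.
  by case=> [->|->|->]; [exact: loop_le0|exact: loop_ge1|exact: loop_base].
by move=> [/b /= -> /b /= ->].
Qed.

Lemma hat_susp_at (c : loop R T [set (point : X)]) t x : hat c (susp_at t x) = c t x.
Proof. by rewrite hatE /= loop_clamp. Qed.

Lemma hat_ext (f g : susp R X -> T) :
  (forall t x, f (susp_at t x) = g (susp_at t x)) -> f = g.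
Proof.
move=> fg; apply/funext => s; have [t [x ->]] := susp_ptP s.
by have := fg (sval t) x; rewrite /susp_at clampI_sval.
Qed.

Lemma hat_pointed (c : loop R T [set (point : X)]) : pointed_map (hat c).
Proof.
split.
  have [_] := @final_susp X; apply => _.
  rewrite (_ : (fun _ => _) = fun p => c (sval p.1) p.2); last first.
    by apply/funext => -[t x]; rewrite hatE.
  have h := loop_cts c; have hs := sval_unitI_cts.
  have h1 : continuous (fun p : unitI R * X => sval p.1).
    by apply: (cts_comp (f := fst) hs) => x; exact: cvg_fst.
  have h2 : continuous (fun p : unitI R * X => p.2) by cts.
  exact: (cts_comp2 h h1 h2).
have -> : (point : susp R X) = susp_pt (clampI 0) point.
  by rewrite susp_ptP0 //; right; right.
by rewrite hatE loop_base.
Qed.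

Lemma hat_homotopic (c d : loop R T [set (point : X)]) :
  lhom c d -> pointed_homotopic R (hat c) (hat d).
Proof.
move=> [h [h0 h1]].
have ch s : continuous (fun p : R * X => h p.1 (s, p.2)).
  by have hc := loop_cts h; cts.
pose K (s : R) : loop R T [set (point : X)] := Loop (ch s)
    (fun t x => @loop_out _ _ _ _ h t (s, x))
    (fun t x (xA : [set point] x) => @loop_base _ _ _ _ h t (s, x) xA).
have KE s t x : hat (K s) (susp_pt t x) = h (sval t) (s, x) by rewrite hatE.
exists (fun p => hat (K (sval p.1)) p.2); split.
- have cK : continuous (fun p : R * susp R X => hat (K p.1) p.2).
    have [_] := final_prodR R (@final_susp X); apply => _ /=.
    rewrite (_ : (fun _ => _) = fun p => h (sval p.2.1) (p.1, p.2.2)); last first.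
      by apply/funext => -[s [t x]]; exact: KE.
    have hc := loop_cts h; have hs := sval_unitI_cts.
    have k1 : continuous (fun p : R * (unitI R * X) => sval p.2.1).
      by apply: (cts_comp (f := fun p : R * (unitI R * X) => p.2.1) hs); cts.
    have k2 : continuous (fun p : R * (unitI R * X) => (p.1, p.2.2)) by cts.
    exact: (cts_comp2 hc k1 k2).
  have hs := sval_unitI_cts.
  have k1 : continuous (fun p : unitI R * susp R X => sval p.1).
    by apply: (cts_comp (f := fst) hs) => x; exact: cvg_fst.
  have k2 : continuous (fun p : unitI R * susp R X => p.2) by cts.
  exact: (@cts_comp2 _ _ _ _ (fun s => hat (K s)) _ _ cK k1 k2).
- move=> s; have [t [x ->]] := susp_ptP s; rewrite hatE -h0.
  by apply: etrans (KE _ _ _) _; rewrite /= clamp_le0.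
- move=> s; have [t [x ->]] := susp_ptP s; rewrite hatE -h1.
  by apply: etrans (KE _ _ _) _; rewrite /= clamp_ge1.
- by move=> t; case: (hat_pointed (K (sval t))).
Qed.

End Hat.

Lemma hat_susp_loop (X : ptopologicalType) : hat (susp_loop X) = id :> (susp R X -> susp R X).
Proof. by apply: hat_ext => t x; rewrite hat_susp_at. Qed.

Lemma susp_mapE (X Y : ptopologicalType) (f : X -> Y) (t : unitI R) x :
  f point = point -> susp_map f (susp_pt t x) = susp_pt t (f x).
Proof.
move=> f0; rewrite /susp_map /susp_pt collapse_mapE // => -[t' x'].
case=> h; [exact: Or31|exact: Or32|apply: Or33].
by move: h => /= ->.
Qed.

Section Wedge.
Context (I : pointedType) (W : I -> ptopologicalType).

Definition wlift i (x : W i) : pwedge W := wedge_lift (fun i => @point (W i)) x.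

Lemma wlift_pt i : wlift (@point (W i)) = point.
Proof. exact: (@wedge_liftE _ _ (fun i => @point (W i)) point point i point). Qed.

Lemma final_wedge : final_family (fun i (x : W i) => wlift x).
Proof.
split=> [v|Z g gc].
  have : [set: pwedge W] v by [].
  by rewrite -wedgeTE => -[i _ [x _ <-]]; exists i, x.
apply/continuousP => B oB; apply/wedge_openP => i.
by move: (gc i) => /continuousP/(_ _ oB).
Qed.

Context (T : ptopologicalType).

Definition wmap (b : forall i, W i -> T) : pwedge W -> T := wedge_fun b.

Lemma wedge_funE (b : forall i, W i -> T) i (x : W i) :
  (forall i, b i point = point) -> wmap b (wlift x) = b i x.
Proof. by move=> b0; rewrite /wmap /wlift wedge_lift_funE // => j k; rewrite !b0. Qed.

Section WLoop.
Context (b : forall i, loop R T [set (point : W i)]).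

Definition wedge_loop_fun (t : R) : pwedge W -> T := wmap (fun i => b i t).

Lemma wedge_loopE t i (x : W i) : wedge_loop_fun t (wlift x) = b i t x.
Proof. by rewrite /wedge_loop_fun wedge_funE // => j; exact: loop_base. Qed.

Lemma wedge_loop_cts : continuous (fun p : R * pwedge W => wedge_loop_fun p.1 p.2).
Proof.
have [_] := final_prodR R final_wedge; apply => i.
rewrite (_ : (fun _ => _) = fun p => b i p.1 p.2); first exact: loop_cts.
by apply/funext => -[t x]; rewrite wedge_loopE.
Qed.

Lemma wedge_loop_out t (v : pwedge W) : t <= 0 \/ 1 <= t -> wedge_loop_fun t v = point.
Proof.
have [sf _] := final_wedge; have [i [x <-]] := sf v.
by move=> tt; rewrite wedge_loopE loop_out.
Qed.

Lemma wedge_loop_base t (v : pwedge W) : [set point] v -> wedge_loop_fun t v = point.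
Proof. by move=> ->; rewrite -(wlift_pt point) wedge_loopE loop_base. Qed.

Definition wedge_loop : loop R T [set (point : pwedge W)] := Loop wedge_loop_cts wedge_loop_out wedge_loop_base.
End WLoop.

Lemma lhom_wedge_loop (b b' : forall i, loop R T [set (point : W i)]) :
  (forall i, lhom (b i) (b' i)) -> lhom (wedge_loop b) (wedge_loop b').
Proof.
move=> bb'; pose h i := cid (bb' i).
have hP i : (forall t x, sval (h i) t (0, x) = b i t x) /\
    (forall t x, sval (h i) t (1, x) = b' i t x) := svalP (h i).
pose F t (p : R * pwedge W) := wmap (fun i x => sval (h i) t (p.1, x)) p.2.
have FE t s i (x : W i) : F t (s, wlift x) = sval (h i) t (s, x).
  by rewrite /F /= wedge_funE // => j; exact: loop_base.
have [sf _] := final_wedge.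
have cF : continuous (fun p : R * (R * pwedge W) => F p.1 p.2).
  have [_] := final_prodR R (final_prodR R final_wedge); apply => i /=.
  rewrite (_ : (fun _ => _) = fun p => sval (h i) p.1 p.2); first exact: loop_cts.
  by apply/funext => -[t [s x]]; rewrite FE.
have F1 t p : t <= 0 \/ 1 <= t -> F t p = point.
  by case: p => s v; have [i [x <-]] := sf v => tt; rewrite FE loop_out.
have F2 t (p : R * pwedge W) : [set point] p.2 -> F t p = point.
  by case: p => s v /= ->; rewrite -(wlift_pt point) FE loop_base.
exists (Loop cF F1 F2); split=> t v /=; have [i [x <-]] := sf v.
  by rewrite FE wedge_loopE (hP i).1.
by rewrite FE wedge_loopE (hP i).2.
Qed.

End Wedge.
End Susp.

(** * The sum of the suspensions of a family of maps *)

Section Slots.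
Context (n : nat).

Lemma card_nesub : #|{: nesub n}| = (2 ^ n.+1).-1.
Proof.
rewrite card_sig -[RHS](congr1 predn (_ : #|{: {set 'I_n.+1}}| = _)).
  by rewrite -(cardC1 finset.set0); apply: eq_card => A; rewrite !inE.
by rewrite -cardsT -powersetT card_powerset cardsT card_ord.
Qed.

(** There are as many slots as non-empty subsets. *)
Lemma slot_onto k : (k < (2 ^ n.+1).-1)%N -> exists I : nesub n, slot I = k.
Proof.
move=> kN; pose f (I : nesub n) := Ordinal (slot_lt I).
have fI : injective f by move=> I J /(congr1 val) /= /slot_inj.
have [|g _ gK] := inj_card_bij fI; first by rewrite card_ord card_nesub.
by exists (g (Ordinal kN)); have /(congr1 val) := gK (Ordinal kN).
Qed.

Definition unslot (k : nat) : nesub n := odflt point [pick I : nesub n | slot I == k].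

Lemma unslotK k : (k < (2 ^ n.+1).-1)%N -> slot (unslot k) = k.
Proof.
move=> /slot_onto[I Ik]; rewrite /unslot.
by case: pickP => [J /eqP//|/(_ I)]; rewrite Ik eqxx.
Qed.

Lemma slotK (I : nesub n) : unslot (slot I) = I.
Proof. by apply: slot_inj; rewrite unslotK // slot_lt. Qed.

Lemma interval_find (R : realType) m (u : R) : 0 <= u <= m.+1%:R ->
  exists2 k, (k < m.+1)%N & k%:R <= u <= k.+1%:R.
Proof.
elim: m => [|m IH] /andP[u0 um]; first by exists 0%N; rewrite // u0.
have [h|h] := leP u m.+1%:R; last by exists m.+1; rewrite // (ltW h).
by have [|k km ku] := IH; [rewrite u0|exists k => //; exact: ltnW].
Qed.

Lemma slot_find (R : realType) (u : R) : 0 <= u <= (2 ^ n.+1).-1%:R ->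
  exists I : nesub n, (slot I)%:R <= u <= (slot I).+1%:R.
Proof.
have N0 : (0 < (2 ^ n.+1).-1)%N by apply: leq_ltn_trans (slot_lt (point : nesub n)).
rewrite -(prednK N0) => /interval_find[k]; rewrite prednK // => /slot_onto[I <-] ku.
by exists I.
Qed.

End Slots.

Section SuspSum.
Context (R : realType) (n : nat).

Lemma mulN_unitI (t : unitI R) : 0 <= (2 ^ n.+1).-1%:R * sval t <= (2 ^ n.+1).-1%:R.
Proof.
case: t => t tI /=; move: (tI); rewrite inE /= in_itv /= => /andP[t0 t1].
by rewrite mulr_ge0 //= ler_piMr.
Qed.

Section Loop.
Context (X : ptopologicalType) (W : nesub n -> ptopologicalType).
Context (q : forall I, X -> W I) (qP : forall I, pointed_map (q I)).

Lemma wliftP (I : nesub n) : pointed_map (@wlift _ W I).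
Proof. by split; [exact: wedge_lift_continuous|exact: wlift_pt]. Qed.

(** The suspension of the inclusion of the summand of number k. *)
Definition inL (k : nat) : loop R (susp R (pwedge W)) [set (point : W (unslot n k))] :=
  pull (wliftP (unslot n k)) (susp_loop R (pwedge W)).

Definition sumL : loop R (susp R (pwedge W)) [set (point : X)] :=
  loop_sum (fun k => pull (qP (unslot n k)) (inL k)) (2 ^ n.+1).-1.

(** The intervals into which [susp_sum] divides the suspension coordinate are
    those of a concatenation of 2 ^ n.+1 - 1 loops. *)
Lemma susp_sum_hat : susp_sum q = hat sumL.
Proof.
apply/funext => s; have [t [x ->]] := susp_ptP s.
have [I tI] := slot_find (mulN_unitI t).
rewrite hatE (susp_sumE x (fun I => (qP I).2) tI).
have E := concatE (fun k => pull (qP (unslot n k)) (inL k)) x (slot_lt I) tI.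
rewrite [RHS]E.
suff h J : J = I -> susp_pt (clampI ((2 ^ n.+1).-1%:R * sval t - (slot I)%:R)) (wlift (q I x)) =
  susp_at (((2 ^ n.+1).-1%:R * sval t - (slot I)%:R)) (wlift (q J x)).
  by apply: h; rewrite slotK.
by move=> ->.
Qed.

End Loop.

Lemma wedge_mapE (I J : pointedType) (W : I -> ptopologicalType)
    (W' : J -> ptopologicalType) (g : I -> J) (h : forall i, W i -> W' (g i)) i x :
  (forall i, h i point = point) ->
  wedge_map h (wlift (W := W) (i := i) x) = wlift (h i x).
Proof.
move=> h0; rewrite /wedge_map /wlift wedge_lift_funE // => j l.
by rewrite !h0; have E := @wlift_pt _ W'; rewrite /wlift in E; rewrite !E.
Qed.

Lemma wedge_map_pt (I J : pointedType) (W : I -> ptopologicalType)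
    (W' : J -> ptopologicalType) (g : I -> J) (h : forall i, W i -> W' (g i)) :
  (forall i, h i point = point) -> wedge_map h (point : pwedge W) = point.
Proof.
move=> h0; have E := @wedge_mapE I J W W' g h point point h0.
by rewrite h0 (wlift_pt W') (wlift_pt W) in E.
Qed.

(** Naturality of the sum of maps in its source and in its summands. *)
Lemma susp_sum_nat (X X' : ptopologicalType) (W W' : nesub n -> ptopologicalType)
    (q : forall I, X -> W I) (q' : forall I, X' -> W' I) (f : X -> X')
    (h : forall I, W I -> W' I) :
  (forall I, q I point = point) -> (forall I, q' I point = point) ->
  f point = point -> (forall I, h I point = point) ->
  (forall I x, h I (q I x) = q' I (f x)) ->
  susp_map (R := R) (wedge_map (g := fun I => I) h) \o susp_sum q =
  susp_sum q' \o susp_map (R := R) f.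
Proof.
move=> q0 q'0 f0 h0 hq; apply/funext => s; have [t [x ->]] := susp_ptP s.
have [I tI] := slot_find (mulN_unitI t).
rewrite /= susp_mapE // (susp_sumE x q0 tI) (susp_sumE _ q'0 tI).
by rewrite susp_mapE ?wedge_map_pt // -hq -[RHS](congr1 _ (wedge_mapE (g := fun I => I) _ h0)).
Qed.

End SuspSum.

Section Equiv.
Context (R : realType) (n : nat).
Context (X : ptopologicalType) (W : nesub n -> ptopologicalType).
Context (q : forall I, X -> W I) (qP : forall I, pointed_map (q I)).

Local Notation N := (2 ^ n.+1).-1.
Local Notation V := (pwedge W).
Local Notation uq := (fun k => qP (unslot n k)).

Context (ex : sum_onto R uq N) (un : sum_inj R uq N).

Let H : susp R X -> susp R V := susp_sum q.

Let HP : pointed_map H.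
Proof. by rewrite /H (susp_sum_hat R qP); exact: hat_pointed. Qed.

Let point0 (Y : ptopologicalType) (x : Y) : [set point] x -> @base R Y set0 ((0 : R), x).
Proof. by right. Qed.

Let at0_cts (Y : ptopologicalType) : continuous (fun x : Y => ((0 : R), x)).
Proof. by cts. Qed.

Let left_data : exists b : forall k, loop R (susp R X) [set (point : W (unslot n k))],
  lhom (susp_loop R X) (loop_sum (fun k => pull (uq k) (b k)) N).
Proof.
have snd_cts : continuous (fun p : R * X => p.2) by move=> x; exact: cvg_snd.
have snd_base (p : R * X) : @base R X set0 p -> [set point] p.2 by case.
have [b hb] := ex (pre snd_cts snd_base (susp_loop R X)).
exists (fun k => pre (@at0_cts _) (@point0 _) (b k)).
have := lhom_pre (@at0_cts X) (@point0 X) hb => h.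
apply: lhom_trans (lhom_trans _ h) _; apply: lhom_eq => t x //=.
by symmetry; exact: (concat_map (f := idfun)).
Qed.

(** The left inverse L has the components b I such that the sum of the b I o S(q I)
    is the identity of the suspension of X.  As H o L o H and H are homotopic,
    the composites of H with the b I and the inclusions of the summands, which
    have homotopic sums over the S(q I), are homotopic. *)
Lemma susp_sum_equiv : pointed_homotopy_equivalence R H.
Proof.
split; first exact: HP.
have [b hb] := left_data.
pose B k t x := b k t (q (unslot n k) x).
have Hb k : (k < N)%N -> lhom (post HP (b k)) (inL R W k).
  apply: (un (b := fun k => post HP (b k)) (b' := inL R W)).
  apply: (lhom_trans (d := post HP (loop_sum (fun k => pull (uq k) (b k)) N))).
    by apply: lhom_eq => t x; apply: (concat_map (f := H)); [case: HP|].
  apply: (lhom_trans (lhom_sym (lhom_post HP hb))).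
  by apply: lhom_eq => t x; rewrite /= /H (susp_sum_hat R qP) hat_susp_at.
(* Transport of b k from the summand [unslot k] to the summand I of slot k. *)
have key (I : nesub n) k : unslot n k = I -> (k < N)%N ->
    exists c : loop R (susp R X) [set (point : W I)],
      (forall t x, c t (q I x) = B k t x) /\
      lhom (post HP c) (pull (wliftP W I) (susp_loop R V)).
  by move=> <- kN; exists (b k); split => //; exact: Hb.
have c_ex (I : nesub n) : {c : loop R (susp R X) [set (point : W I)] |
      (forall t x, c t (q I x) = B (slot I) t x) /\
      lhom (post HP c) (pull (wliftP W I) (susp_loop R V))}.
  by apply: cid; apply: key; [exact: slotK|exact: slot_lt].
pose c I := sval (c_ex I).
have cB I t x : c I t (q I x) = B (slot I) t x by case: (svalP (c_ex I)).
have cH I : lhom (post HP (c I)) (pull (wliftP W I) (susp_loop R V)).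
  by case: (svalP (c_ex I)).
pose L := hat (wedge_loop c).
have LP : pointed_map L by exact: hat_pointed.
exists L; split=> //.
  have -> : L \o H = hat (post LP (sumL R qP)).
    apply: hat_ext => t x; rewrite hat_susp_at /= /H (susp_sum_hat R qP) hat_susp_at //.
  rewrite -(hat_susp_loop R X); apply: hat_homotopic.
  apply: lhom_trans (lhom_sym hb); apply: lhom_eq => t x /=.
  symmetry; apply: (concat_map (f := L)); first by case: LP.
  move=> k kN u /=; rewrite /L hat_susp_at /= wedge_loopE cB unslotK //.
have -> : H \o L = hat (post HP (wedge_loop c)).
  by apply: hat_ext => t v; rewrite hat_susp_at /= /L hat_susp_at.
rewrite -(hat_susp_loop R V); apply: hat_homotopic.
apply: lhom_trans (lhom_trans _ (lhom_wedge_loop cH)) _; apply: lhom_eq => t v /=;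
  have [sf _] := final_wedge W; have [I [x <-]] := sf v; by rewrite !wedge_loopE.
Qed.

End Equiv.

(** * Polyhedral products as closed subspaces and quotients *)

Section ProdCts.
Context (I : Type) (X : I -> topologicalType).

Lemma cts_prodP (T : topologicalType) (g : T -> prod_topology X) :
  (forall i, continuous (fun t => g t i)) -> continuous g.
Proof.
move=> gc x; apply/cvg_sup => i.
have := gc i x; move=> h B [C [[W oW <-] /= Wx] CB].
apply: filterS CB _; apply: h; exact: open_nbhs_nbhs.
Qed.

Lemma proj_cts (i : I) : continuous (fun y : prod_topology X => y i).
Proof.
move=> x; have /cvg_sup/(_ i) h : x --> x by exact: cvg_id.
move=> B xB; apply: h; exists ((fun y : prod_topology X => y i) @^-1` B°).
split => //=; first by exists (B°) => //; exact: open_interior.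
by move=> y /=; exact: interior_subset.
Qed.
End ProdCts.

Definition psub_mk (X : ptopologicalType) (A : set X) (Apt : A point) x (Ax : A x) :
  psub Apt := exist _ x (mem_set Ax).

Lemma psub_eq (X : ptopologicalType) (A : set X) (Apt : A point) (x y : psub Apt) :
  sval x = sval y -> x = y.
Proof.
case: x y => [x xA] [y yA] /= e; apply/eq_exist_uncurried => /=.
by exists e; exact: bool_irrelevance.
Qed.

Lemma psub_val_cts (X : ptopologicalType) (A : set X) (Apt : A point) :
  continuous (fun b : psub Apt => sval b).
Proof. exact: (@set_val_cts _ A). Qed.

Lemma cts_psub (X : ptopologicalType) (A : set X) (Apt : A point)
    (T : topologicalType) (f : T -> psub Apt) :
  continuous (fun t => sval (f t)) -> continuous f.
Proof. by move=> cf; apply: continuous_comp_initial; exact: cf. Qed.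

Section CollapseClosed.
Context (X : ptopologicalType) (F : set X) (cF : closed F).

(** Collapsing a closed set is a closed map. *)
Lemma collapse_closed (C : set X) : closed C ->
  closed [set \pi_(collapse F) x | x in C].
Proof.
move=> cC; rewrite -openC.
suff cp : closed (\pi_(collapse F) @^-1` [set \pi_(collapse F) x | x in C]).
  exact: (closed_openC cp).
have [[x [Cx Fx]]|CF] := pselect (exists x, C x /\ F x).
  rewrite (_ : _ @^-1` _ = C `|` F); first exact: closedU.
  apply/seteqP; split=> y /=.
    by case=> z Cz /collapseP[<-|[_ Fy]]; [left|right].
  by case=> [Cy|Fy]; [exists y|exists x => //; apply/collapseP; right].
rewrite (_ : _ @^-1` _ = C) //; apply/seteqP; split=> y /=.
  by case=> z Cz /collapseP[<-//|[Fz _]]; case: CF; exists z.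
by move=> Cy; exists y.
Qed.

(** The image T of a closed set S in the quotient, with the subspace topology, is
    also a quotient of S, the projection being a closed map. *)
Lemma collapse_final_on (S : set X) (Spt : S point) (T : set (collapse F))
    (Tpt : T point) (p : psub Spt -> psub Tpt) :
  closed S -> (forall t, T t -> exists2 x, S x & t = \pi_(collapse F) x) ->
  (forall x, sval (p x) = \pi_(collapse F) (sval x)) ->
  final_family (fun _ : unit => p).
Proof.
move=> cS TS pE; have sp y : exists x, p x = y.
  have [x Sx xE] := TS _ (set_mem (svalP y)).
  by exists (exist _ x (mem_set Sx)); apply: psub_eq; rewrite pE.
apply: final_open => [y|B cB]; first by have [x <-] := sp y; exists tt, x.
have [G cG GB] := set_type_closed (cB tt).
have cl := collapse_closed (closedI cS cG).
rewrite (_ : B = (fun y : psub Tpt => sval y) @^-1`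
  [set \pi_(collapse F) x | x in S `&` G]).
  by apply: preimage_closed cl => y _; exact: set_val_cts.
have BG x : B (p x) = G (sval x) by exact: (congr1 (fun D => D x) GB).
apply/seteqP; split=> y /=.
  have [x <-] := sp y; rewrite BG => Gx; exists (sval x); last by rewrite pE.
  by split => //; exact: (set_mem (svalP x)).
move=> [x [Sx Gx] xy].
have -> : y = p (exist _ x (mem_set Sx)) by apply: psub_eq; rewrite pE.
by rewrite BG.
Qed.

End CollapseClosed.

Section ZFinal.
Context (R : realType) (V : finType) (K : scomplex V) (P : V -> cw_pair R).

Lemma cw_sub_closed (Q : cw_pair R) : closed (@cw_sub _ Q).
Proof. by have [S sub] := cw_subP Q; exact: (subcomplex_closed sub). Qed.

Lemma cw_point_closed (Q : cw_pair R) : closed [set (point : Q)].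
Proof.
have [S _] := cw_subP Q.
by apply: accessible_closed_set1; apply: hausdorff_accessible; exact: (cw_hausdorff S).
Qed.

Lemma poly_set_closed : closed (poly_set (P := P) K).
Proof.
apply: closed_bigcup => [|s _]; first exact: finite_finset.
rewrite (_ : poly_box s = \bigcap_(i in [set: V])
  ((fun y : prod_topology (fun i => cw_space (P i)) => y i) @^-1`
   (if i \in s then [set: P i] else @cw_sub _ (P i)))).
  apply: closed_bigI => i _; apply: preimage_closed.
    by move=> y _; exact: proj_cts.
  by case: ifP => _; [exact: closedT|exact: cw_sub_closed].
by apply/seteqP; split=> y h i; [move=> _|]; exact: h.
Qed.

Lemma fat_wedge_closed : closed (@fat_wedge V (fun i => cw_space (P i))).
Proof.
rewrite (_ : @fat_wedge V (fun i => cw_space (P i)) = \bigcup_(i in [set: V])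
  ((fun y : prod_topology (fun i => cw_space (P i)) => y i) @^-1` [set point])).
  apply: closed_bigcup => [|i _]; first exact: finite_finset.
  apply: preimage_closed; last exact: cw_point_closed.
  by move=> y _; exact: proj_cts.
by apply/seteqP; split=> y [i]; [exists i|move=> _ yi; exists i].
Qed.

Lemma smash_mem (z : Z K P) : smash_poly_set (P := P) K
  (\pi_(smash (fun i => cw_space (P i))) (sval z)).
Proof. by exists (sval z) => //; exact: (set_mem (svalP z)). Qed.

(** The polyhedral smash product carries the quotient topology. *)
Definition zhat_pi (z : Z K P) : Zhat K P :=
  psub_mk (@smash_poly_set_point _ _ K P) (smash_mem z).

Lemma zhat_pi_final : final_family (fun _ : unit => zhat_pi).
Proof.
apply: (collapse_final_on fat_wedge_closed poly_set_closed) => //.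
by move=> t [x xK <-]; exists x.
Qed.

End ZFinal.

Section ZProj.
Context (R : realType) (n : nat) (K : scomplex 'I_n.+1) (P : 'I_n.+1 -> cw_pair R).
Local Notation X := (fun i => cw_space (P i)).

Lemma zproj_mem (I : nesub n) y : poly_set (P := P) K y ->
  smash_poly_set (P := fun i => P (val i)) (full_sub K (val I))
    (smash_proj (Y := X) I y).
Proof.
move=> [s sK ys]; exists (fun i => y (val i)) => //.
exists [set j | val j \in s]%SET; first exact: imset_f.
by move=> i; have := ys (val i); rewrite inE.
Qed.

Section OnSubset.
Context (S : set (prod_topology X)) (Spt : S point) (SK : S `<=` poly_set (P := P) K).

Definition zprojS (I : nesub n) (z : psub Spt) : Zhat_sub K P I :=
  psub_mk (@smash_poly_set_point _ _ (full_sub K (val I)) (fun i => P (val i)))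
    (zproj_mem I (SK (set_mem (svalP z)))).

Lemma restr_cts (I : nesub n) : continuous (fun y : prod_topology X =>
  (fun i => y (val i)) : prod_topology (fun i : {i | i \in val I} => X (val i))).
Proof. by apply: cts_prodP => i; exact: proj_cts. Qed.

Lemma smash_proj_cts (I : nesub n) : continuous (smash_proj (Y := X) I).
Proof.
have h := @pi_continuous _ {eq_quot (collapse_rel (@fat_wedge _
  (fun i : {i | i \in val I} => X (val i))))}.
exact: (@cts_comp _ _ _ _ _ h (@restr_cts I)).
Qed.

Lemma zprojSP (I : nesub n) : pointed_map (zprojS I).
Proof.
split; last by apply: psub_eq.
apply: continuous_comp_initial.
exact: (cts_comp (@smash_proj_cts I) (@set_val_cts _ S)).
Qed.

End OnSubset.
End ZProj.

(** * The filtration of a polyhedral product by supports *)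

Section Code.
Context (n : nat).
Implicit Types A B : {set 'I_n.+1}.

Definition bincode A : nat := \sum_(i in A) 2 ^ i.

Lemma code_sub A B : A \subset B -> (bincode A <= bincode B)%N.
Proof.
move=> AB; rewrite /bincode [leqRHS](bigID (fun i => i \in A)) /=.
apply: leq_trans (leq_addr _ _); apply: eq_leq; apply: eq_bigl => i.
by case: (boolP (i \in A)) => [/(fintype.subsetP AB) ->|]; rewrite ?andbF.
Qed.

Lemma code_gt0 (I : nesub n) : (0 < bincode (val I))%N.
Proof.
have /set0Pn[i iI] := valP I.
by rewrite /bincode (bigD1 i) //= addn_gt0 expn_gt0.
Qed.

Lemma code_slot (I : nesub n) : bincode (val I) = (slot I).+1.
Proof. by rewrite /slot prednK // code_gt0. Qed.

Lemma code_inj A (I : nesub n) : bincode A = bincode (val I) -> A = val I.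
Proof.
have [->|A0] := eqVneq A finset.set0.
  by rewrite {1}/bincode big_set0 => e; have := code_gt0 I; rewrite -e.
move=> e; have := @slot_inj n (exist _ A A0) I; rewrite /slot -!/(bincode _) /= e.
by move=> /(_ erefl) <-.
Qed.

Lemma code_le A : (bincode A <= (2 ^ n.+1).-1)%N.
Proof.
have [->|A0] := eqVneq A finset.set0; first by rewrite /bincode big_set0.
by have := slot_lt (exist _ A A0 : nesub n); rewrite -code_slot.
Qed.

Lemma code0 A : (bincode A <= 0)%N -> A = finset.set0.
Proof.
by case: (eqVneq A finset.set0) => // A0; rewrite (code_slot (exist _ A A0 : nesub n)).
Qed.

End Code.

Section MinList.
Context (R : realType) (I : eqType).

Definition min_over (u : I -> R) (s : seq I) : R := foldr (fun i r => Num.min (u i) r) 1 s.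

Lemma min_over_cts (T : topologicalType) (u : T -> I -> R) s :
  (forall i, continuous (fun t => u t i)) -> continuous (fun t => min_over (u t) s).
Proof. by move=> cu; elim: s => [|i s IH] /=; [exact: cts_cst|have h := cu i; cts]. Qed.

Lemma min_over_ge0 u s : (forall i, 0 <= u i) -> 0 <= min_over u s.
Proof. by move=> u0; elim: s => [|i s IH] /=; rewrite ?ler01 // le_min u0. Qed.

Lemma min_over_le u s i : i \in s -> min_over u s <= u i.
Proof.
elim: s => //= j s IH; rewrite inE ge_min => /predU1P[->|/IH ->]; rewrite ?lexx //.
by rewrite orbT.
Qed.

Lemma min_over_attained u s : min_over u s < 1 -> exists2 i, i \in s & u i <= min_over u s.
Proof.
elim: s => [|j s IH] /=; first by rewrite ltxx.
have [h m1|h m1] := leP (u j) (min_over u s); first by exists j; rewrite // mem_head.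
have [i si ui] := IH m1; by exists i => //; rewrite inE si orbT.
Qed.

End MinList.

Section Filtration.
Context (R : realType) (n : nat) (K : scomplex 'I_n.+1) (P : 'I_n.+1 -> cw_pair R).
Local Notation X := (fun i => cw_space (P i)).
Local Notation N := (2 ^ n.+1).-1.

Definition supp (y : prod_topology X) : {set 'I_n.+1} := [set i | y i != point]%SET.

Definition stage k : set (prod_topology X) :=
  [set y | poly_set (P := P) K y /\ (bincode (supp y) <= k)%N].

Lemma stage_point k : stage k point.
Proof.
split; first exact: poly_set_point.
rewrite (_ : supp point = finset.set0) ?/bincode ?big_set0 //.
by apply/setP => i; rewrite !inE eqxx.
Qed.

Lemma stage_sub k : stage k `<=` poly_set (P := P) K.
Proof. by move=> y []. Qed.

Definition factor_data (u : forall i, X i -> R) (d : forall i, R -> X i -> X i) :=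
  forall i, contracts (u i) (d i) /\
    forall s x, cw_sub x -> cw_sub (d i s x).

Lemma factor_data_ex : exists u d, factor_data u d.
Proof.
have ex i : {ud : (X i -> R) * (R -> X i -> X i) | contracts ud.1 ud.2 /\
    forall s x, cw_sub x -> cw_sub (ud.2 s x)}.
  apply: cid; have [S sub] := cw_subP (P i).
  have [u [d [ud dA]]] := cw_contracts S.
  by exists (u, d); split => //; exact: dA.
by exists (fun i => (sval (ex i)).1), (fun i => (sval (ex i)).2) => i; exact: (svalP (ex i)).
Qed.

Section Step.
Context (u : forall i, X i -> R) (d : forall i, R -> X i -> X i).
Arguments u : clear implicits.
Arguments d : clear implicits.
Context (ud : factor_data u d) (k : nat) (kN : (k < N)%N).
Let J := unslot n k.

Let codeJ : bincode (val J) = k.+1.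
Proof. by rewrite code_slot unslotK. Qed.

(** How far y is from having a coordinate at the base-point among those of the
    k-th set. *)
Definition gap (y : prod_topology X) : R := min_over (fun i => u i (y i)) (enum (val J)).
(** The factor 2 makes the time exceed the value of u at the coordinate of y where
    the minimum is attained, while keeping the points with gap 0 fixed. *)
Definition push (s : R) (y : prod_topology X) : prod_topology X :=
  fun i => d i (clamp (Num.min s (2 * gap y))) (y i).

Let u_ge0 i x : 0 <= u i x. Proof. by have [[_ _ [h _] _ _] _] := ud i. Qed.
Let u_eq0 i x : u i x = 0 <-> x = point. Proof. by have [[_ _ [_ h] _ _] _] := ud i. Qed.
Let d0 i x : d i 0 x = x. Proof. by have [[_ _ _ [h _] _] _] := ud i. Qed.
Let d_pt i s : d i s point = point. Proof. by have [[_ _ _ [_ h] _] _] := ud i. Qed.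

Lemma gap_ge0 y : 0 <= gap y.
Proof. by apply: min_over_ge0 => i; exact: u_ge0. Qed.

Lemma gap_cts : continuous gap.
Proof.
apply: (min_over_cts (u := fun (y : prod_topology X) i => u i (y i))) => i.
have [[cu _ _ _ _] _] := ud i.
exact: (cts_comp cu (@proj_cts _ X i)).
Qed.

Lemma push_cts : continuous (fun p : R * prod_topology X => push p.1 p.2).
Proof.
apply: cts_prodP => i; have [[_ cd _ _ _] _] := ud i.
have cphi := gap_cts; have cp := @proj_cts _ X i.
have h1 : continuous (fun p : R * prod_topology X => clamp (Num.min p.1 (2 * gap p.2))) by cts.
have h2 : continuous (fun p : R * prod_topology X => p.2 i).
  by apply: (cts_comp (f := snd) cp) => x; exact: cvg_snd.
exact: (cts_comp2 cd h1 h2).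
Qed.

Lemma push_id s y : gap y = 0 -> push s y = y.
Proof.
move=> p0; apply: functional_extensionality_dep => i.
by rewrite /push p0 mulr0 clamp_le0 ?d0 // ge_min lexx orbT.
Qed.

Lemma push0 y : push 0 y = y.
Proof.
apply: functional_extensionality_dep => i.
by rewrite /push clamp_le0 ?d0 // ge_min lexx.
Qed.

Lemma push_supp s y : supp (push s y) \subset supp y.
Proof.
apply/fintype.subsetP => i; rewrite !inE; apply: contra => /eqP yi.
by rewrite /push yi d_pt.
Qed.

Lemma push_stage s y l : stage l y -> stage l (push s y).
Proof.
move=> [[t tK ty] cy]; split; last first.
  by apply: leq_trans cy; apply: code_sub; exact: push_supp.
exists t => // i; have := ty i; rewrite /push; case: ifP => // _.
by have [_ h] := ud i; exact: h.
Qed.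

(** If no coordinate in J is at the base-point, then the support contains J, and
    its code is at least that of J. *)
Lemma stageSP y : stage k.+1 y ->
  stage k y <-> exists2 i, i \in val J & y i = point.
Proof.
move=> [yK cy]; split=> [[_ cyk]|[i iJ yi]].
  apply: contrapT => h.
  have JS : val J \subset supp y.
    apply/fintype.subsetP => i iJ; rewrite inE; apply/eqP => yi; apply: h.
    by exists i.
  by have := leq_trans (code_sub JS) cyk; rewrite codeJ ltnn.
split=> //; move: cy; rewrite leq_eqVlt => /predU1P[e|//]; exfalso.
have sJ : supp y = val J by apply: code_inj; rewrite e codeJ.
by move: iJ; rewrite -sJ inE yi eqxx.
Qed.

Lemma stageS_supp y : stage k.+1 y -> ~ stage k y -> supp y = val J.
Proof.
move=> sy nsy; have [yK cy] := sy; apply: code_inj; rewrite codeJ.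
move: cy; rewrite leq_eqVlt => /predU1P[//|cy].
by case: nsy; split.
Qed.

Lemma gap_eq0 y : stage k.+1 y -> stage k y <-> gap y = 0.
Proof.
move=> sy; rewrite stageSP //; split=> [[i iJ yi]|p0].
  apply/eqP; rewrite eq_le gap_ge0 andbT.
  have := @min_over_le _ _ (fun i => u i (y i)) (enum (val J)) i.
  by rewrite mem_enum => /(_ iJ); rewrite (iffRL (@u_eq0 _ _) yi).
have [|i] := @min_over_attained _ _ (fun i => u i (y i)) (enum (val J)).
  by rewrite -/(gap y) p0.
rewrite mem_enum -/(gap y) p0 => iJ ui; exists i => //; apply/u_eq0.
by apply/eqP; rewrite eq_le ui u_ge0.
Qed.

Lemma push_end s y : stage k.+1 y -> gap y < s -> s <= 1 -> stage k (push s y).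
Proof.
move=> sy ps s1; have [p0|p0] := eqVneq (gap y) 0.
  by rewrite push_id //; apply/gap_eq0.
have pgt : 0 < gap y by rewrite lt_def p0 gap_ge0.
apply/stageSP; first exact: push_stage.
have [|i] := @min_over_attained _ _ (fun i => u i (y i)) (enum (val J)).
  by rewrite -/(gap y); lra.
rewrite mem_enum -/(gap y) => iJ ui; exists i => //.
have [[_ _ _ _ h] _] := ud i; apply: h.
  rewrite clamp_id; last by rewrite le_min ge_min s1 /= andbT; apply/andP; split; lra.
  by rewrite lt_min; apply/andP; split; lra.
exact: clamp_le1.
Qed.

End Step.
End Filtration.
Arguments gap_cts {R n P u d} ud k.
Arguments push_cts {R n P u d} ud k.

Section SplitExt.
Context (R : realType) (X : ptopologicalType) (Q : nat -> ptopologicalType).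
Context (q q' : forall j, X -> Q j) (qq' : forall j x, q j x = q' j x).
Context (qP : forall j, pointed_map (q j)) (q'P : forall j, pointed_map (q' j)).

Lemma sum_onto_ext k : sum_onto R qP k -> sum_onto R q'P k.
Proof.
move=> ex T AP c; have [b hb] := ex T AP c; exists b.
apply: lhom_trans hb _; apply: lhom_sum => j _; apply: lhom_eq => t [p x] /=.
by rewrite qq'.
Qed.

Lemma sum_inj_ext k : sum_inj R qP k -> sum_inj R q'P k.
Proof.
move=> un T b b' hb; apply: un.
apply: lhom_trans (lhom_trans _ hb) _; apply: lhom_sum => j _;
  by apply: lhom_eq => t x /=; rewrite qq'.
Qed.
End SplitExt.

Section SplitStage.
Context (R : realType) (n : nat) (K : scomplex 'I_n.+1) (P : 'I_n.+1 -> cw_pair R).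
Local Notation X := (fun i => cw_space (P i)).
Local Notation N := (2 ^ n.+1).-1.
Local Notation PX := (prod_topology X).

Section OneStep.
Context (u : forall i, X i -> R) (d : forall i, R -> X i -> X i).
Context (ud : factor_data u d) (k : nat) (kN : (k < N)%N).
Let J := unslot n k.

Local Notation A := (psub (stage_point K P k)).
Local Notation B := (psub (stage_point K P k.+1)).
Local Notation qA I := (@zprojS _ _ K P _ (stage_point K P k) (@stage_sub _ _ K P k) I).
Local Notation qB I :=
  (@zprojS _ _ K P _ (stage_point K P k.+1) (@stage_sub _ _ K P k.+1) I).

Let stage_le (y : PX) : stage K k y -> stage K k.+1 y.
Proof. by move=> [yK cy]; split => //; exact: leqW. Qed.

Let inc (a : A) : B := psub_mk (stage_point K P k.+1) (stage_le (set_mem (svalP a))).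

Let incP : pointed_map inc.
Proof.
split; last exact: psub_eq.
by apply: cts_psub; exact: psub_val_cts.
Qed.

Let phiB (b : B) : R := gap u k (sval b).
Let HB s (b : B) : B :=
  psub_mk (stage_point K P k.+1) (push_stage ud k s (set_mem (svalP b))).

Let range_inc (b : B) : range inc b <-> stage K k (sval b).
Proof.
split=> [[a _ <-]|bk]; first exact: (set_mem (svalP a)).
by exists (psub_mk (stage_point K P k) bk) => //; exact: psub_eq.
Qed.

Let bS (b : B) : stage K k.+1 (sval b) := set_mem (svalP b).

Let phiB_cts : continuous phiB.
Proof.
exact: (@cts_comp _ _ _ _ _ (gap_cts ud k)
  (@psub_val_cts _ _ (stage_point K P k.+1))).
Qed.

Let inc_emb : embedding inc.
Proof.
split.
- by move=> a a' /(congr1 sval) /= aa'; exact: psub_eq.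
- by case: incP.
- rewrite (_ : range inc = [set b | phiB b <= 0]).
    by apply: closed_le_fun; [exact: phiB_cts|exact: cts_cst].
  apply/seteqP; split=> b; rewrite range_inc (gap_eq0 ud kN (bS b)) /=.
    by rewrite /phiB => ->.
  by move=> h; apply/eqP; rewrite eq_le h (gap_ge0 ud).
- move=> a V /set_val_embed[U aU UV].
  exists (fun b : B => U (sval b)); last by move=> a' /UV.
  exact: (@psub_val_cts _ _ (stage_point K P k.+1) (inc a)).
Qed.

Let inc_strom : strom_deformation inc phiB HB.
Proof.
split.
- exact: phiB_cts.
- apply: cts_psub.
  have h := push_cts ud k; have hv := @psub_val_cts _ _ (stage_point K P k.+1).
  have h1 : continuous (fun p : R * B => p.1) by move=> x; exact: cvg_fst.
  have h2 : continuous (fun p : R * B => sval p.2).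
    by apply: (cts_comp (f := snd) hv) => x; exact: cvg_snd.
  exact: (cts_comp2 h h1 h2).
- by move=> b; apply: psub_eq; exact: push0.
- split.
  + by move=> b; exact: (gap_ge0 ud).
  + by move=> a; apply/(gap_eq0 ud kN (bS (inc a))); exact: (set_mem (svalP a)).
  + move=> s a; apply: psub_eq; apply: (push_id ud).
    by apply/(gap_eq0 ud kN (bS (inc a))); exact: (set_mem (svalP a)).
  + by move=> s b ps s1; apply/range_inc; apply: (push_end ud kN) => //; exact: bS.
Qed.

Let qB_pt (b : B) : stage K k (sval b) -> qB J b = point.
Proof.
move=> bk; apply: psub_eq => /=; apply/collapseP; right.
have [i iJ bi] := iffLR (stageSP kN (bS b)) bk.
by split; exists (exist _ i iJ).
Qed.

Let qB_inj b b' : qB J b = qB J b' -> b = b' \/ range inc b /\ range inc b'.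
Proof.
move=> /(congr1 sval) /= /collapseP[e|[[[i iJ] /= bi] [[i' iJ'] /= bi']]]; last first.
  by right; split; apply/range_inc/(stageSP kN (bS _)); [exists i|exists i'].
have eJ i : i \in val J -> sval b i = sval b' i.
  by move=> iJ; exact: (congr1 (fun f => f (exist _ i iJ)) e).
have [bk|nbk] := pselect (stage K k (sval b)).
  have [i iJ bi] := iffLR (stageSP kN (bS b)) bk.
  right; split; apply/range_inc => //; apply/(stageSP kN (bS _)).
  by exists i => //; rewrite -eJ.
have nbk' : ~ stage K k (sval b').
  move=> bk; apply: nbk; have [i iJ bi] := iffLR (stageSP kN (bS b')) bk.
  by apply/(stageSP kN (bS _)); exists i => //; rewrite eJ.
left; apply: psub_eq; apply: functional_extensionality_dep => i.
have [iJ|iJ] := boolP (i \in val J); first exact: eJ.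
have out c : stage K k.+1 c -> ~ stage K k c -> c i = point.
  move=> h1 h2; have sJ := stageS_supp kN h1 h2; move: iJ; rewrite -/J -sJ inE.
  by move=> /negPn/eqP.
by rewrite !out.
Qed.

Let ext_mem (z : Z (full_sub K (val J)) (fun i => P (val i))) :
  stage K k.+1 (ext (f := fun i : {i | i \in val J} => val i) (X := X) (sval z)).
Proof.
have vI : injective (fun i : {i | i \in val J} => val i) by exact: val_inj.
split.
  apply: (poly_set_ext (P := P) vI) (set_mem (svalP z)) => s /imsetP[t tK ->].
  apply: scS tK _; apply/fintype.subsetP => _ /imsetP[j jt ->].
  by rewrite inE in jt.
have -> : k.+1 = bincode (val J) by rewrite code_slot unslotK.
apply: code_sub; apply/fintype.subsetP => i.
rewrite inE; apply: contraNT => iJ; apply/eqP; apply: ext_out => -[j _ ji].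
by move: iJ; rewrite -ji (valP j).
Qed.

(* The stratum J, by extension of the points of the product over J. *)
Let sigma z : B := psub_mk (stage_point K P k.+1) (ext_mem z).

Let qB_final : final_family (fun _ : unit => qB J).
Proof.
have vI : injective (fun i : {i | i \in val J} => val i) by exact: val_inj.
have sE z : qB J (sigma z) = zhat_pi z.
  apply: psub_eq => /=; congr (\pi_(_) _); apply: functional_extensionality_dep => i.
  exact: (extE (f := fun i : {i | i \in val J} => val i)).
have csig : continuous sigma.
  apply: cts_psub; apply: cts_prodP => i.
  have hv := @psub_val_cts _ _ (@poly_set_point _ _ (full_sub K (val J))
    (fun i => P (val i))).
  have [iJ|iJ] := boolP (i \in val J).
    pose j : {i | i \in val J} := exist _ i iJ.
    have -> : (fun z => (sval \o sigma) z i) = (fun z => sval z j).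
      by apply/funext => z; exact: (extE (f := fun i : {i | i \in val J} => val i) _ j).
    exact: (cts_comp (@proj_cts _ _ j) hv).
  have -> : (fun z => (sval \o sigma) z i) = fun=> point.
    apply/funext => z; apply: ext_out => -[j _ ji].
    by move: iJ; rewrite -ji (valP j).
  exact: cts_cst.
have [sf ff] := zhat_pi_final (full_sub K (val J)) (fun i => P (val i)).
split=> [y|T g gc].
  by have [[] [z <-]] := sf y; exists tt, (sigma z).
apply: ff => _; have -> : (fun z => g (zhat_pi z)) = (fun z => g (qB J (sigma z))).
  by apply/funext => z; rewrite sE.
exact: (cts_comp (gc tt) csig).
Qed.

Lemma split_step :
  sum_onto R (fun j => zprojSP (stage_point K P k) (@stage_sub _ _ K P k) (unslot n j)) k ->
  sum_inj R (fun j => zprojSP (stage_point K P k) (@stage_sub _ _ K P k) (unslot n j)) k ->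
  sum_onto R (fun j => zprojSP (stage_point K P k.+1) (@stage_sub _ _ K P k.+1) (unslot n j)) k.+1 /\
  sum_inj R (fun j => zprojSP (stage_point K P k.+1) (@stage_sub _ _ K P k.+1) (unslot n j)) k.+1.
Proof.
move=> ex un.
pose qP j := zprojSP (stage_point K P k.+1) (@stage_sub _ _ K P k.+1) (unslot n j).
have ext j (a : A) : qA (unslot n j) a = (qB (unslot n j) \o inc) a by exact: psub_eq.
have ex' : sum_onto R (qiP incP qP) k by apply: sum_onto_ext ex => j a; exact: ext.
have un' : sum_inj R (qiP incP qP) k by apply: sum_inj_ext un => j a; exact: ext.
have qi a : qB J (inc a) = point by apply: qB_pt; exact: (set_mem (svalP a)).
split.
  exact: (sum_onto_step inc_emb inc_strom qB_final qi qB_inj ex').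
exact: (sum_inj_step inc_emb inc_strom qB_final qi qB_inj ex' un').
Qed.

End OneStep.

Lemma split_stage k : (k <= N)%N ->
  sum_onto R (fun j => zprojSP (stage_point K P k) (@stage_sub _ _ K P k) (unslot n j)) k /\
  sum_inj R (fun j => zprojSP (stage_point K P k) (@stage_sub _ _ K P k) (unslot n j)) k.
Proof.
have [u [d ud]] := factor_data_ex P.
elim: k => [_|k IH kN].
  split; last by move=> T b b' _ j.
  apply: sum_onto0 => -[y yS]; apply: psub_eq => /=.
  have [_ /code0 sy] := set_mem yS; apply: functional_extensionality_dep => i.
  have : i \notin supp y by rewrite sy inE.
  by rewrite inE => /negPn/eqP.
by have [ex un] := IH (ltnW kN); exact: (split_step ud kN).
Qed.

Definition zproj (I : nesub n) (z : Z K P) : Zhat_sub K P I :=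
  @zprojS _ _ K P _ (@poly_set_point _ _ K P) (fun _ => id) I z.

Lemma zprojP I : pointed_map (zproj I).
Proof. exact: zprojSP. Qed.

Lemma split_Z : sum_onto R (fun j => zprojP (unslot n j)) N /\
  sum_inj R (fun j => zprojP (unslot n j)) N.
Proof.
have SE : poly_set (P := P) K = stage K N.
  by apply/seteqP; split=> y [] //; move=> s sK ys; split; [exists s|exact: code_le].
have gen (S : set PX) (Spt : S point) (SK : S `<=` poly_set (P := P) K) :
    S = stage K N ->
    sum_onto R (fun j => zprojSP Spt SK (unslot n j)) N /\
    sum_inj R (fun j => zprojSP Spt SK (unslot n j)) N.
  move=> E; move: Spt SK; rewrite E => Spt SK.
  have [ex un] := split_stage (leqnn N).
  rewrite (Prop_irrelevance Spt (stage_point K P N)).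
  by split; [apply: sum_onto_ext ex|apply: sum_inj_ext un] => j x; exact: psub_eq.
have [ex un] := gen _ (@poly_set_point _ _ K P) (fun _ => id) SE.
by split; [apply: sum_onto_ext ex|apply: sum_inj_ext un].
Qed.

Lemma zsplitting_equiv : pointed_homotopy_equivalence R
  (susp_sum zproj : susp R (Z K P) -> susp R (pwedge (Zhat_sub K P))).
Proof. by have [ex un] := split_Z; exact: (susp_sum_equiv ex un). Qed.

End SplitStage.

(** * Naturality and the splitting theorem *)

Section BinaryOrder.

Lemma binsum_lt (g : nat -> nat) (p : nat -> bool) m :
  {homo g : i j / (i < j)%N} ->
  (\sum_(i < m) p i * 2 ^ g i < 2 ^ g m)%N.
Proof.
move=> gm; elim: m => [|m IH]; first by rewrite big_ord0 expn_gt0.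
rewrite big_ord_recr /=.
apply: (@leq_trans (2 ^ (g m).+1)); last by rewrite leq_exp2l //; exact: gm.
rewrite expnS mul2n -addnn -addSn leq_add //.
by case: (p m); rewrite ?mul1n ?mul0n.
Qed.

(** Comparison of the highest digits. *)
Lemma binsum_mono (g : nat -> nat) (p q : nat -> bool) m :
  {homo g : i j / (i < j)%N} ->
  (\sum_(i < m) p i * 2 ^ i < \sum_(i < m) q i * 2 ^ i)%N ->
  (\sum_(i < m) p i * 2 ^ g i < \sum_(i < m) q i * 2 ^ g i)%N.
Proof.
move=> gm; elim: m => [|m IH]; first by rewrite !big_ord0.
rewrite !big_ord_recr /=; case: (p m); case: (q m); rewrite ?mul1n ?mul0n ?addn0 ?ltn_add2r //.
- have := @binsum_lt id q m (fun _ _ => id); move=> h1 h2; exfalso.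
  by have := ltn_trans h2 h1; rewrite ltnNge leq_addl.
- by move=> _; apply: leq_trans (binsum_lt p m gm) (leq_addl _ _).
Qed.

Lemma slot_lt_code n (I J : nesub n) :
  (slot I < slot J)%N = (bincode (val I) < bincode (val J))%N.
Proof. by rewrite !code_slot ltnS. Qed.

(** The order of the slots is the colexicographic order of sets, which an
    increasing embedding preserves. *)
Lemma slot_image_lt k n (f : 'I_k.+1 -> 'I_n.+1) (I J : nesub k) :
  injective f -> {homo f : i j / (i < j)%N} ->
  (slot I < slot J)%N -> (slot (nesub_image f I) < slot (nesub_image f J))%N.
Proof.
move=> fI fm; rewrite !slot_lt_code => h.
(* An increasing extension of f to the natural numbers. *)
pose g i := if (i < k.+1)%N then val (f (inord i)) else (n.+1 + i)%N.
have gm : {homo g : i j / (i < j)%N}.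
  move=> i j ij; rewrite /g; case: (ltnP i k.+1) => ik; case: (ltnP j k.+1) => jk.
  - by apply: fm; rewrite !inordK.
  - by apply: leq_trans (ltn_ord _) (leq_addr _ _).
  - by have := leq_trans (leq_trans ik (ltnW ij)) jk; rewrite ltnn.
  - by rewrite ltn_add2l.
have E (A : {set 'I_k.+1}) (e : nat -> nat) :
    (\sum_(i in A) 2 ^ e i = \sum_(i < k.+1) (inord i \in A) * 2 ^ e i)%N.
  rewrite big_mkcond /=; apply: eq_bigr => i _; rewrite inord_val.
  by case: (_ \in _); rewrite ?mul1n ?mul0n.
have Ef (A : {set 'I_k.+1}) : bincode (f @: A) = (\sum_(i in A) 2 ^ g i)%N.
  rewrite /bincode big_imset /=; last by move=> i j _ _ /fI.
  by apply: eq_bigr => i _; rewrite /g ltn_ord inord_val.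
rewrite /= !Ef !E.
apply: (binsum_mono (p := fun i => inord i \in val I) (q := fun i => inord i \in val J)) => //.
by move: h; rewrite /bincode !(E _ id).
Qed.

End BinaryOrder.

Section Main.
Context (R : realType).

Lemma smash_mapE (V : Type) (X Y : V -> ptopologicalType) (f : forall i, X i -> Y i) y :
  (forall i, f i point = point) ->
  smash_map f (\pi_(smash X) y) = \pi_(smash Y) (prod_map f y).
Proof.
move=> f0; rewrite /smash_map collapse_mapE // => z [i zi]; exists i.
by rewrite /prod_map zi f0.
Qed.

Section Naturality.
Context (n : nat) (K L : scomplex 'I_n.+1) (P Q : 'I_n.+1 -> cw_pair R).
Context (KL : {subset K <= L}) (phi : forall i, pair_map (P i) (Q i)).

Lemma phi_pt i : phi i point = point. Proof. by case: (pair_funP (phi i)). Qed.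

Lemma zsplitting_incl :
  susp_map (R := R) (wedge_map (@Zhat_sub_incl R n K P)) \o susp_sum (@zproj R n K P) =
  splitting R (fun i => cw_space (P i)) \o susp_map (@Z_incl R _ K P).
Proof. by apply: susp_sum_nat => // I; exact: (zprojP K P I).2. Qed.

Lemma zsplitting_map :
  susp_map (R := R) (wedge_map (Zhat_sub_map KL phi)) \o susp_sum (@zproj R n K P) =
  susp_sum (@zproj R n L Q) \o susp_map (R := R) (Z_map KL phi).
Proof.
apply: susp_sum_nat => [I|I||I|I z].
- exact: (zprojP K P I).2.
- exact: (zprojP L Q I).2.
- apply: psub_eq => /=; apply: functional_extensionality_dep => i; exact: phi_pt.
- apply: psub_eq; rewrite /= smash_mapE; last by move=> i; exact: phi_pt.
  congr (\pi_(_) _); apply: functional_extensionality_dep => i; exact: phi_pt.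
- apply: psub_eq; rewrite /= /smash_proj smash_mapE //.
  by move=> i; exact: phi_pt.
Qed.

End Naturality.

Section Embedding.
Context (k n : nat) (f : 'I_k.+1 -> 'I_n.+1).
Context (K : scomplex 'I_k.+1) (L : scomplex 'I_n.+1) (P : 'I_n.+1 -> cw_pair R).
Context (fI : injective f) (fKL : forall s : {set 'I_k.+1}, s \in K -> f @: s \in L).
Context (fm : {homo f : i j / (i < j)%N}).

Local Notation Pf := (fun i => P (f i)).
Local Notation Ze := (Z_ext (P := P) fI fKL).
Local Notation Nk := (2 ^ k.+1).-1.
Local Notation Nn := (2 ^ n.+1).-1.
Local Notation V := (pwedge (Zhat_sub L P)).
Local Notation zK := (@zproj R k K Pf).
Local Notation zL := (@zproj R n L P).

Lemma ext_cts : continuous (fun y : prod_topology (fun i => cw_space (P (f i))) =>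
  ext (X := fun j => cw_space (P j)) y).
Proof.
apply: cts_prodP => j; have [[i _ <-]|jf] := pselect (range f j).
  rewrite (_ : (fun _ => _) = fun y => y i); first exact: proj_cts.
  by apply/funext => y; rewrite extE.
rewrite (_ : (fun _ => _) = fun=> point); first exact: cts_cst.
by apply/funext => y; rewrite ext_out.
Qed.

Lemma ZeP : pointed_map Ze.
Proof.
split.
  by apply: cts_psub; apply: (cts_comp ext_cts); exact: psub_val_cts.
apply: psub_eq => /=; apply: functional_extensionality_dep => j.
have [[i _ <-]|jf] := pselect (range f j); last by rewrite ext_out.
by rewrite (extE (X := fun j => cw_space (P j))).
Qed.

Lemma zproj_ext (I : nesub k) z :
  Zhat_sub_ext (P := P) fI fKL (zK I z) = zL (nesub_image f I) (Ze z).
Proof.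
apply: psub_eq => /=; rewrite /smash_proj /smash_ext collapse_mapE; last first.
  by move=> y [i yi]; exists (sub_fun f i); rewrite extE //; exact: sub_fun_inj.
congr (\pi_(_) _); apply: functional_extensionality_dep => -[j jI].
have [i iI fij] := imsetP jI.
have -> : exist _ j jI = sub_fun f (exist (fun i => i \in val I) i iI).
  by apply: val_inj.
rewrite (extE (X := fun j : {j | j \in f @: val I} => cw_space (P (val j)))); last exact: sub_fun_inj.
by rewrite /= (extE (X := fun j => cw_space (P j))).
Qed.

(** A set M that is not an image has a vertex outside the range of f, where the
    extended point has its coordinate at the base-point. *)
Lemma zproj_ext_out (M : nesub n) z :
  (forall I, nesub_image f I <> M) -> zL M (Ze z) = point.
Proof.
move=> MI; have [j jM jf] : exists2 j, j \in val M & ~ range f j.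
  apply: contrapT => h.
  have Mf : val M = f @: (f @^-1: val M).
    apply/setP => j; apply/idP/imsetP => [jM|[i]]; last by rewrite inE => ? ->.
    have [[i _ fij]|jf] := pselect (range f j); last by case: h; exists j.
    by exists i => //; rewrite inE fij.
  have M0 : f @^-1: val M != finset.set0.
    by apply: contra (valP M) => /eqP M0; rewrite {1}Mf M0 imset0.
  pose I0 : nesub k := exist _ (f @^-1: val M) M0.
  by apply: (MI I0); apply: val_inj.
apply: psub_eq => /=; apply/collapseP; right; split; exists (exist _ j jM) => //=.
exact: ext_out.
Qed.

Let inL (M : nesub n) : loop R (susp R V) [set (point : Z K Pf)] :=
  pull ZeP (pull (zprojP L P M) (pull (wliftP (Zhat_sub L P) M) (susp_loop R V))).

Let c j := inL (nesub_image f (unslot k j)).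
Let e m := inL (unslot n m).
(* c lists the non-trivial loops of the concatenation e, the j-th one of them being
   at sigma j; alpha maps [sigma j, sigma j + 1] to [j, j + 1], and is constant on
   the other intervals. *)
Let sigma j : nat := slot (nesub_image f (unslot k j)).
Let alpha (t : R) : R := \sum_(j < Nk) clamp (t - (sigma j)%:R).

Let sigma_lt i j : (j < Nk)%N -> (i < j)%N -> (sigma i < sigma j)%N.
Proof.
move=> jN ij; apply: slot_image_lt => //.
by rewrite !unslotK //; exact: ltn_trans jN.
Qed.

Let sigma_bound j : (sigma j < Nn)%N. Proof. exact: slot_lt. Qed.

Let alpha_cts : continuous alpha.
Proof.
rewrite /alpha; elim: (index_enum _) => [|j r IH].
  rewrite (_ : (fun _ => _) = fun=> 0); first exact: cts_cst.
  by apply/funext => t; rewrite big_nil.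
rewrite (_ : (fun _ => _) = fun t => clamp (t - (sigma j)%:R) +
  \sum_(j <- r) clamp (t - (sigma j)%:R)); first by cts.
by apply/funext => t; rewrite big_cons.
Qed.

Let alpha_le0 t : t <= 0 -> alpha t = 0.
Proof.
move=> t0; apply: big1 => j _; apply: clamp_le0.
by rewrite subr_le0; apply: le_trans t0 _; rewrite ler0n.
Qed.

Let alpha_ge t : Nn%:R <= t -> alpha t = Nk%:R.
Proof.
move=> tN; rewrite /alpha (eq_bigr (fun=> 1)) ?sumr_const ?card_ord // => j _.
apply: clamp_ge1; rewrite lerBrDl natr1; apply: le_trans tN.
by rewrite ler_nat; exact: sigma_bound.
Qed.

Let alpha_const m t : (forall j, (j < Nk)%N -> sigma j != m) ->
  m%:R <= t <= m.+1%:R -> exists i, alpha t = i%:R.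
Proof.
move=> ms /andP[mt tm].
exists (\sum_(j < Nk) (sigma j < m)%N)%N; rewrite natr_sum; apply: eq_bigr => j _.
have := ms j (ltn_ord j); case: ltngtP => // h _.
  apply: clamp_ge1; rewrite lerBrDl natr1; apply: le_trans mt.
  by rewrite ler_nat.
apply: clamp_le0; rewrite subr_le0; apply: le_trans tm _.
by rewrite ler_nat.
Qed.

Let alpha_slope j t : (j < Nk)%N ->
  (sigma j)%:R <= t <= (sigma j).+1%:R -> alpha t = j%:R + (t - (sigma j)%:R).
Proof.
move=> jN /andP[jt tj]; rewrite /alpha (bigID (fun i : 'I_Nk => (i < j)%N)) /=.
congr (_ + _).
  rewrite (eq_bigr (fun=> 1)) => [|i ij]; last first.
    apply: clamp_ge1; rewrite lerBrDl natr1; apply: le_trans jt.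
    by rewrite ler_nat; exact: sigma_lt.
  rewrite sumr_const; congr (_%:R).
  transitivity #|[set i : 'I_Nk | (i < j)%N]%SET|.
    by rewrite cardsE.
  have wI : injective (widen_ord (ltnW jN)).
    by move=> x y /(congr1 val) /= xy; exact: val_inj.
  rewrite -[RHS](card_ord j) -(card_imset _ wI).
  apply: eq_card => i; rewrite inE; apply/idP/imsetP => [ij|[i' _ ->]]; last exact: (ltn_ord i').
  by exists (Ordinal ij) => //; exact: val_inj.
rewrite (bigD1 (Ordinal jN)) ?ltnn //= big1 ?addr0 => [|i /andP[ij ni]].
  by rewrite clamp_id // subr_ge0 jt lerBlDl natr1.
apply: clamp_le0; rewrite subr_le0; apply: le_trans tj _; rewrite ler_nat.
apply: sigma_lt => //; rewrite ltn_neqAle leqNgt ij andbT.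
by rewrite eq_sym; apply: contra ni => /eqP h; apply/eqP/val_inj.
Qed.

Let concat_alpha t z : concat e Nn t z = concat c Nk (alpha t) z.
Proof.
have [t0|t0] := leP t 0; first by rewrite alpha_le0 // !concat_le0.
have [tN|tN] := leP Nn%:R t; first by rewrite alpha_ge // concat_nat concat_ge.
have [M Mt] : exists M : nesub n, (slot M)%:R <= t <= (slot M).+1%:R.
  by apply: slot_find; rewrite !ltW.
rewrite (concatE _ _ (slot_lt M) Mt).
have [[I IM]|nM] := pselect (exists I, nesub_image f I = M).
  have IN := slot_lt I; have sI : sigma (slot I) = slot M by rewrite /sigma slotK IM.
  rewrite (@alpha_slope (slot I)) ?sI // (concatE c (k := slot I)) //; last first.
    by move: Mt => /andP[? ?]; rewrite lerDl subr_ge0 -natr1 lerD2l lerBlDl natr1; apply/andP.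
  by rewrite addrAC subrr add0r /= /inL /= !slotK IM.
have [i ->] : exists i, alpha t = i%:R.
  apply: (@alpha_const (slot M)) => // j jN; apply/eqP => h; apply: nM.
  by exists (unslot k j); apply: slot_inj.
rewrite concat_nat /= /inL /= slotK zproj_ext_out; last by move=> I IM; apply: nM; exists I.
by rewrite (wlift_pt (Zhat_sub L P)); apply: susp_loop_base.
Qed.

Lemma zsplitting_ext : pointed_homotopic R
  (susp_map (R := R) (wedge_map (Zhat_sub_ext (P := P) fI fKL)) \o susp_sum zK)
  (susp_sum zL \o susp_map (R := R) Ze).
Proof.
have G0 I : Zhat_sub_ext (P := P) fI fKL (I := I) point = point.
  rewrite -(zprojP K Pf I).2 zproj_ext.
  by rewrite (proj2 ZeP) (zprojP L P (nesub_image f I)).2.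
have left_eq : susp_map (R := R) (wedge_map (Zhat_sub_ext (P := P) fI fKL)) \o susp_sum zK =
    hat (loop_sum c Nk).
  apply: hat_ext => t z; rewrite hat_susp_at /= (susp_sum_hat R (fun I => zprojP K Pf I)) hat_susp_at /=.
  symmetry; apply: (concat_map (f := susp_map (R := R) (wedge_map (Zhat_sub_ext (P := P) fI fKL)))).
    rewrite -[X in susp_map _ X](@susp_ptP0 R _ (clampI 0) point); last by right; right.
    rewrite susp_mapE ?wedge_map_pt // susp_ptP0 //; by right; right.
  move=> j jN u /=; rewrite /susp_at susp_mapE ?wedge_map_pt //.
  by rewrite wedge_mapE // zproj_ext.
have right_eq : susp_sum zL \o susp_map (R := R) Ze = hat (loop_sum e Nn).
  apply: hat_ext => t z; rewrite hat_susp_at /= /susp_at susp_mapE ?(proj2 ZeP) // -/(susp_at t (Ze z)).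
  rewrite (susp_sum_hat R (fun I => zprojP L P I)) hat_susp_at /=.
  by symmetry; apply: (concat_map (f := idfun)).
rewrite left_eq right_eq; apply: hat_homotopic.
have Nk0 : (0 : R) < Nk%:R.
  by rewrite ltr0n; apply: leq_ltn_trans (slot_lt (point : nesub k)).
have Nn0 : (0 : R) < Nn%:R.
  by rewrite ltr0n; apply: leq_ltn_trans (slot_lt (point : nesub n)).
apply: lhom_sym; apply: (@lhom_reparam_eq _ _ _ _ (loop_sum c Nk) _ _
   (fun t => Nk%:R^-1 * alpha (Nn%:R * t)) (fun t => t)) => //.
- by have h := alpha_cts; cts.
- by cts.
- by move=> t z; rewrite /= mulVKf ?gt_eqF // concat_alpha.
- move=> t t0; left; split=> //; rewrite alpha_le0 ?mulr0 //.
  by rewrite pmulr_rle0.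
- move=> t t1; right; split=> //; rewrite alpha_ge; last by rewrite ler_peMr // ltW.
  by rewrite mulVf ?gt_eqF.
Qed.

End Embedding.
End Main.

Theorem theorem2p10 (R : realType) :
  exists H : forall (n : nat) (K : scomplex 'I_n.+1)
                    (P : 'I_n.+1 -> cw_pair R),
      susp R (Z K P) -> susp R (pwedge (Zhat_sub K P)),
  [/\ forall (n : nat) (K : scomplex 'I_n.+1) (P : 'I_n.+1 -> cw_pair R),
        (forall i, connected_pair (P i)) ->
        susp_map (wedge_map (@Zhat_sub_incl R n K P)) \o H n K P =
        splitting R (fun i => cw_space (P i)) \o susp_map (@Z_incl R _ K P),

      forall (n : nat) (K : scomplex 'I_n.+1) (P : 'I_n.+1 -> cw_pair R),
        (forall i, connected_pair (P i)) ->
        pointed_homotopy_equivalence R (H n K P),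

      forall (n : nat) (K L : scomplex 'I_n.+1) (P Q : 'I_n.+1 -> cw_pair R)
             (KL : {subset K <= L}) (phi : forall i, pair_map (P i) (Q i)),
        (forall i, connected_pair (P i)) -> (forall i, connected_pair (Q i)) ->
        susp_map (wedge_map (Zhat_sub_map KL phi)) \o H n K P =
        H n L Q \o susp_map (Z_map KL phi) &

      forall (k n : nat) (f : 'I_k.+1 -> 'I_n.+1)
             (K : scomplex 'I_k.+1) (L : scomplex 'I_n.+1)
             (P : 'I_n.+1 -> cw_pair R) (fI : injective f)
             (fKL : forall s : {set 'I_k.+1}, s \in K -> f @: s \in L),
        {homo f : i j / (i < j)%N} ->
        (forall i, connected_pair (P i)) ->
        pointed_homotopic R
          (susp_map (wedge_map (Zhat_sub_ext (P := P) fI fKL))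
            \o H k K (fun i => P (f i)))
          (H n L P \o susp_map (Z_ext (P := P) fI fKL))].
Proof.
exists (fun n K P => susp_sum (@zproj R n K P)); split.
- by move=> n K P _; exact: zsplitting_incl.
- by move=> n K P _; exact: zsplitting_equiv.
- by move=> n K L P Q KL phi _ _; exact: zsplitting_map.
- by move=> k n f K L P fI fKL fm _; exact: zsplitting_ext.
Qed.
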